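(* Let $\alpha>0$ be a constant and let $\Gamma\subset\mathbb{R}^2$ be a loop, i.e. a closed continuous, piecewise-$C^1$ curve of finite length $L$, such that $c(\Gamma)>0$. Let $H_{\alpha,\Gamma}$ be the self-adjoint Schrödinger operator in $L^2(\mathbb{R}^2)$ with attractive $\delta$-potential of strength $\alpha$ supported by $\Gamma$. Then $$\inf\sigma(H_{\alpha,\Gamma})\ \geq\ -\frac{\alpha^2}{4c(\Gamma)^2}.$$
   Context: A loop $\Gamma$ of length $L$ is the image of a continuous piecewise-$C^1$ map $\gamma:[0,L]\to\mathbb{R}^2$ with $\gamma(0)=\gamma(L)$, in natural (arc-length) parametrization, $|\dot\gamma(s)|=1$. The constant $c(\Gamma)$ is $c(\Gamma)=\inf_{x,y\in\Gamma,\ x\neq y}\frac{\operatorname{dist}_{\mathbb{R}^2}(x,y)}{\operatorname{dist}_\Gamma(x,y)}$, where $\operatorname{dist}_{\mathbb{R}^2}$ is the Euclidean distance and $\operatorname{dist}_\Gamma$ is the distance along the curve. In terms of the parametrization, $c(\Gamma)$ is the infimum of $\frac{|\gamma(s)-\gamma(s')|}{\min\{|s-s'|,\,L-|s-s'|\}}$ over $s,s'\in[0,L]$ with $0<|s-s'|<L$. Let $m_\Gamma(M)=l_1(M\cap\Gamma)$ for Borel $M\subset\mathbb{R}^2$, where $l_1$ is the one-dimensional Hausdorff measure, and $L^2(\Gamma):=L^2(\mathbb{R}^2,m_\Gamma)$. When $c(\Gamma)>0$, the restriction map $\psi\mapsto\psi|_\Gamma$ from the Schwartz space $\mathcal{S}(\mathbb{R}^2)$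 to $L^2(\Gamma)$ extends uniquely to a bounded operator $I_\Gamma:H^1(\mathbb{R}^2)\to L^2(\Gamma)$, and the quadratic form $$q_{\alpha,\Gamma}[u]=\int_{\mathbb{R}^2}|\nabla u|^2\,dx-\alpha\int_{\mathbb{R}^2}|I_\Gamma u|^2\,dm_\Gamma,\qquad \operatorname{dom}q_{\alpha,\Gamma}=H^1(\mathbb{R}^2),$$ is closed and bounded from below in $L^2(\mathbb{R}^2)$. $H_{\alpha,\Gamma}$ is the unique self-adjoint operator in $L^2(\mathbb{R}^2)$ associated with this form, and $\sigma(\cdot)$ denotes the spectrum. *)

(* Defs.v *)
From HB Require Import structures.
From mathcomp Require Import all_boot all_order all_algebra.
From mathcomp Require Import complex zify.
From mathcomp Require Import all_classical all_reals all_analysis.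

Set Implicit Arguments.
Unset Strict Implicit.
Unset Printing Implicit Defensive.
Import Order.TTheory GRing.Theory Num.Theory.
Import numFieldNormedType.Exports.

Local Open Scope classical_set_scope.
Local Open Scope ring_scope.

(* R * R carries the maximum norm in the library; all distances in the plane
   below are taken with respect to [enorm], the Euclidean norm. *)
Definition enorm {R : realType} (p : R * R) : R :=
  Num.sqrt (p.1 ^+ 2 + p.2 ^+ 2).

Section Hausdorff.
Context {R : realType}.
Local Notation plane := (R * R)%type.
Implicit Types (p q : plane) (A B U : set plane) (delta eta : R).

Local Open Scope ereal_scope.

(* 0 is adjoined to the distances so that the empty set has diameter 0. *)
Definition ediam A : \bar R :=
  ereal_sup (0 |` [set (enorm (z.1 - z.2))%:E | z in A `*` A]).

Definition hausdorff1_delta delta A : \bar R :=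
  ereal_inf [set \sum_(k <oo) ediam (U k) | U in
    [set U : (set plane)^nat | A `<=` \bigcup_k U k /\
                               forall k, ediam (U k) <= delta%:E]].

(* Coverings are weighted by the diameters without a normalizing factor, so that
   [hausdorff1] of a segment is its length. *)
Definition hausdorff1 A : \bar R :=
  ereal_sup [set hausdorff1_delta delta A | delta in [set x : R | (0 < x)%R]].

Lemma ediam_ge0 A : 0 <= ediam A.
Proof. by apply: ereal_sup_ubound; left. Qed.

Lemma ediam0 : ediam set0 = 0.
Proof.
apply/eqP; rewrite eq_le ediam_ge0 andbT; by apply: ge_ereal_sup => x [->//|[z [[]]]].
Qed.

Lemma le_ediam A p q : A p -> A q -> (enorm (p - q))%:E <= ediam A.
Proof. by move=> Ap Aq; apply: ereal_sup_ubound; right; exists (p, q). Qed.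

Let small delta (U : set (g_sigma_algebraType [set: set plane])) : \bar R :=
  if ediam U <= delta%:E then ediam U else +oo.

Let small_ge0 delta U : 0 <= small delta U.
Proof. by rewrite /small; case: ifPn => // _; exact: ediam_ge0. Qed.

Let small0 delta : (0 < delta)%R -> small delta set0 = 0.
Proof. by move=> d0; rewrite /small ediam0 lee_fin (ltW d0). Qed.

Let hausdorff1_deltaE delta : hausdorff1_delta delta = mu_ext (small delta).
Proof.
apply/funext => A; apply/eqP; rewrite eq_le; apply/andP; split.
  apply: le_ereal_inf_tmp => _ [U [_ AU] <-].
  have [Us|/existsNP[k Uk]] := pselect (forall k, ediam (U k) <= delta%:E).
    apply: ereal_inf_lbound; exists U => //.
    by apply: eq_eseriesr => k _; rewrite /small Us.
  rewrite (@eseries_pinfty _ _ _ k) ?leey//.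
    by move=> n _; rewrite gt_eqF// (lt_le_trans _ (small_ge0 _ _)) ?ltNy0.
  by rewrite /small ifF//; apply/negP.
apply: le_ereal_inf_tmp => _ [U [AU Us] <-]; apply: ereal_inf_lbound.
exists U; first by split=> // i; apply: sub_sigma_algebra.
by apply: eq_eseriesr => k _; rewrite /small Us.
Qed.

Lemma hausdorff1_delta_ge0 delta A : 0 <= hausdorff1_delta delta A.
Proof.
by rewrite hausdorff1_deltaE; apply: mu_ext_ge0 => U; exact: small_ge0.
Qed.

Lemma le_hausdorff1_delta delta delta' A : (delta <= delta')%R ->
  hausdorff1_delta delta' A <= hausdorff1_delta delta A.
Proof.
move=> dd'; apply/ereal_inf_le_tmp => _ [U [AU Us] <-]; exists U => //.
by split=> // k; rewrite (le_trans (Us k))// lee_fin.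
Qed.

Lemma hausdorff1_deltaW delta A : (0 < delta)%R ->
  hausdorff1_delta delta A <= hausdorff1 A.
Proof. by move=> d0; apply: ereal_sup_ubound; exists delta. Qed.

Lemma hausdorff1_ge0 A : 0 <= hausdorff1 A.
Proof.
exact: le_trans (hausdorff1_delta_ge0 1 A) (hausdorff1_deltaW _ ltr01).
Qed.

Lemma hausdorff1_0 : hausdorff1 set0 = 0.
Proof.
apply/eqP; rewrite eq_le hausdorff1_ge0 andbT.
apply: ge_ereal_sup => _ [delta /= d0 <-].
by rewrite hausdorff1_deltaE mu_ext0//; exact: small0.
Qed.

Lemma le_hausdorff1 : {homo hausdorff1 : A B / A `<=` B >-> A <= B}.
Proof.
move=> A B AB; apply: ge_ereal_sup => _ [delta /= d0 <-].
apply: (le_trans _ (hausdorff1_deltaW B d0)).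
by rewrite hausdorff1_deltaE; exact: le_mu_ext.
Qed.

Lemma hausdorff1_sigma_subadditive : sigma_subadditive hausdorff1.
Proof.
move=> A; apply: ge_ereal_sup => _ [delta /= d0 <-].
apply: (@le_trans _ _ (\sum_(n <oo) hausdorff1_delta delta (A n))).
  rewrite hausdorff1_deltaE; apply: mu_ext_sigma_subadditive => U.
  exact: small_ge0.
by apply: lee_nneseries => *; [exact: hausdorff1_delta_ge0|
  exact: hausdorff1_deltaW].
Qed.

HB.instance Definition _ := isOuterMeasure.Build R plane hausdorff1
  hausdorff1_0 hausdorff1_ge0 le_hausdorff1 hausdorff1_sigma_subadditive.

Lemma hausdorff1_separated eta A B : (0 < eta)%R ->
  (forall p q, A p -> B q -> (eta <= enorm (p - q))%R) ->
  hausdorff1 A + hausdorff1 B <= hausdorff1 (A `|` B).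
Proof.
move=> eta0 AB.
have sep delta : (0 < delta < eta)%R ->
    hausdorff1_delta delta A + hausdorff1_delta delta B <= hausdorff1 (A `|` B).
  move=> /andP[d0 de]; apply: (le_trans _ (hausdorff1_deltaW _ d0)).
  apply: le_ereal_inf_tmp => _ [U [ABU Us] <-].
  pose b k := `[< U k `&` A !=set0 >].
  pose V k := if b k then U k else set0.
  pose W k := if b k then set0 else U k.
  have -> : \sum_(k <oo) ediam (U k) =
      \sum_(k <oo) ediam (V k) + \sum_(k <oo) ediam (W k).
    rewrite -nneseriesD; [|by move=> *; exact: ediam_ge0..].
    apply: eq_eseriesr => k _; rewrite /V /W.
    by case: (b k); rewrite ediam0 ?adde0 ?add0e.
  have Vd k : ediam (V k) <= delta%:E.
    by rewrite /V; case: (b k) => //; rewrite ediam0 lee_fin ltW.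
  have Wd k : ediam (W k) <= delta%:E.
    by rewrite /W; case: (b k) => //; rewrite ediam0 lee_fin ltW.
  apply: leeD; apply: ereal_inf_lbound.
    exists V => //; split=> // p Ap.
    have [k _ Ukp] := ABU p (or_introl Ap); exists k => //.
    by rewrite /V ifT//; apply/asboolP; exists p.
  exists W => //; split=> // q Bq.
  have [k _ Ukq] := ABU q (or_intror Bq); exists k => //.
  rewrite /W ifF//; apply/asboolP => -[p [Ukp Ap]].
  have := le_trans (le_ediam Ukp Ukq) (Us k); rewrite lee_fin.
  by move=> /(le_trans (AB _ _ Ap Bq)); rewrite leNgt de.
have sep2 delta delta' : (0 < delta)%R -> (0 < delta')%R ->
    hausdorff1_delta delta A + hausdorff1_delta delta' B <=
    hausdorff1 (A `|` B).
  move=> d0 d'0; pose d := (Num.min (Num.min delta delta') (eta / 2))%R.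
  apply: (@le_trans _ _ (hausdorff1_delta d A + hausdorff1_delta d B)).
    by apply: leeD; apply: le_hausdorff1_delta; rewrite /d !ge_min lexx ?orbT.
  apply: sep; rewrite /d !lt_min d0 d'0 divr_gt0//= gt_min; apply/orP; right.
  by rewrite ltr_pdivrMr// ltr_pMr// ltr1n.
have [->|ABfin] := eqVneq (hausdorff1 (A `|` B)) +oo; first by rewrite leey.
have fin X : hausdorff1 X <= hausdorff1 (A `|` B) -> hausdorff1 X \is a fin_num.
  move=> XAB; rewrite ge0_fin_numE ?hausdorff1_ge0//.
  by rewrite (le_lt_trans XAB)// ltey.
have Bfin : hausdorff1 B \is a fin_num by apply/fin/le_hausdorff1 => p; right.
rewrite -leeBrDr//; apply: ge_ereal_sup => _ [delta /= d0 <-].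
have dfin : hausdorff1_delta delta A \is a fin_num.
  rewrite ge0_fin_numE ?hausdorff1_delta_ge0//.
  rewrite (le_lt_trans (hausdorff1_deltaW A d0))//.
  rewrite (@le_lt_trans _ _ (hausdorff1 (A `|` B))) ?ltey//.
  by apply: le_hausdorff1 => p; left.
rewrite leeBrDr// addeC -leeBrDr//; apply: ge_ereal_sup => _ [delta' /= d'0 <-].
by rewrite leeBrDr// addeC; exact: sep2.
Qed.


Section Lipschitz.
Variable f : plane -> R.
Hypothesis f_lip : forall p q, (`|f p - f q| <= enorm (p - q))%R.
Variables (a : R) (X : set plane).
Hypothesis Xfin : hausdorff1 X < +oo.

Let r n : R := (a + n.+1%:R^-1)%R.

Let r_gt n : (a < r n)%R.
Proof. by rewrite ltrDl. Qed.

Let r_decr n m : (n <= m)%N -> (r m <= r n)%R.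
Proof. by move=> nm; rewrite lerD2l lef_pV2 ?posrE// ler_nat. Qed.

Let r_ltS n : (r n.+1 < r n)%R.
Proof. by rewrite ltrD2l ltf_pV2 ?posrE// ltr_nat. Qed.

Let band n := X `&` [set p | (r n.+1 < f p <= r n)%R].

Let sep b c A B : (b < c)%R -> (forall p, A p -> (f p <= b)%R) ->
  (forall q, B q -> (c < f q)%R) ->
  hausdorff1 A + hausdorff1 B <= hausdorff1 (A `|` B).
Proof.
move=> bc Ab Bc; apply: (@hausdorff1_separated (c - b)); first by rewrite subr_gt0.
move=> p q Ap Bq; apply: le_trans (f_lip p q).
rewrite distrC ler_normr; apply/orP; left.
by apply: lerB; [exact/ltW/Bc|exact: Ab].
Qed.

Let sum_band i n : (0 < i)%N ->
  \sum_(0 <= k < n) hausdorff1 (band (k.*2 + i)%N) <=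
  hausdorff1 (X `&` [set p | (r (n.*2 + i)%N.-1 < f p)%R]).
Proof.
move=> i0; elim: n => [|n ih]; first by rewrite big_nil hausdorff1_ge0.
rewrite big_nat_recr//= addeC.
apply: (le_trans (leeD (lexx _) ih)).
have n0 : (0 < n.*2 + i)%N by lia.
apply: (@le_trans _ _ (hausdorff1 (band (n.*2 + i)%N `|`
    X `&` [set p | (r (n.*2 + i)%N.-1 < f p)%R]))).
  apply: (@sep (r (n.*2 + i)%N) (r (n.*2 + i)%N.-1)).
  - by rewrite -[X in (r X < _)%R](prednK n0).
  - by move=> p [_ /andP[]].
  - by move=> p [].
apply: le_hausdorff1 => p [[Xp /= /andP[rp _]]|[Xp /= rp]]; split=> //=.
by rewrite (le_lt_trans _ rp)//; apply: r_decr; lia.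
Qed.

Let u k := hausdorff1 (band k.+1).

Let u_ge0 k : 0 <= u k. Proof. exact: hausdorff1_ge0. Qed.

Let sum_u n : \sum_(0 <= k < n.*2) u k <= hausdorff1 X + hausdorff1 X.
Proof.
have -> : \sum_(0 <= k < n.*2) u k =
    \sum_(0 <= k < n) hausdorff1 (band (k.*2 + 1)%N) +
    \sum_(0 <= k < n) hausdorff1 (band (k.*2 + 2)%N).
  rewrite -big_split/=; elim: n => [|n ih]; first by rewrite !big_nil.
  by rewrite doubleS !big_nat_recr//= ih -addeA /u addn1 addn2.
by apply: leeD; apply: (le_trans (sum_band _ _)) => //;
  apply: le_hausdorff1 => p [].
Qed.

Let series_u : \sum_(k <oo) u k < +oo.
Proof.
apply: (@le_lt_trans _ _ (hausdorff1 X + hausdorff1 X)); last exact: lte_add_pinfty.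
apply: lime_le; first by apply: is_cvg_nneseries => *; exact: u_ge0.
apply: nearW => n; apply: (le_trans _ (sum_u n)).
rewrite (@big_cat_nat _ _ _ n 0 n.*2)//=; last by lia.
by rewrite leeDl// sume_ge0.
Qed.

Let tail n : hausdorff1 (X `&` [set p | (a < f p)%R]) <=
  hausdorff1 (X `&` [set p | (r n.+1 < f p)%R]) + \sum_(n <= k <oo) u k.
Proof.
rewrite -nneseries_addn//; pose A k := band (k + n)%N.+1.
apply: (@le_trans _ _ (hausdorff1
    (X `&` [set p | (r n.+1 < f p)%R] `|` \bigcup_k A k))).
  apply: le_hausdorff1 => p [Xp /= afp].
  have [rp|pr] := ltP (r n.+1) (f p); first by left.
  right; have exm : exists m, (r m < f p)%R.
    by have [m] := ltr_add_invr afp; exists m.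
  have [m rm minm] := ex_minnP exm.
  have nm : (n.+1 < m)%N.
    rewrite ltnNge; apply/negP => mn.
    by have := lt_le_trans rm (le_trans pr (r_decr mn)); rewrite ltxx.
  exists (m.-2 - n)%N => //; split=> //=.
  rewrite (_ : (m.-2 - n + n).+2 = m)%N ?rm//=; last by lia.
  by rewrite leNgt; apply/negP => /minm; lia.
apply: (le_trans (outer_measureU2 _ _ _)); rewrite leeD2l//.
apply: (le_trans (outer_measure_sigma_subadditive _ _)).
by [].
Qed.

Lemma half_plane_caratheodory :
  hausdorff1 (X `&` [set p | (a < f p)%R]) +
  hausdorff1 (X `&` ~` [set p | (a < f p)%R]) <= hausdorff1 X.
Proof.
pose G := [set p | (a < f p)%R].
have le_n n : hausdorff1 (X `&` G) + hausdorff1 (X `&` ~` G) <=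
    hausdorff1 X + \sum_(n <= k <oo) u k.
  apply: (le_trans (leeD (tail n) (lexx _))).
  rewrite addeAC leeD2r// addeC.
  apply: (le_trans (@sep a (r n.+1) _ _ _ _ _)) => //.
  - by move=> p [_ /negP]; rewrite -leNgt.
  - by move=> p [].
  - by apply: le_hausdorff1 => p [[]|[]].
have := @nneseries_tail_cvg _ _ xpredT series_u (fun k _ => u_ge0 k).
move=> tail0; have := cvgeD _ (cvg_cst (hausdorff1 X)) tail0.
rewrite adde0 => h; apply: (cvge_to_ge (h _ _ _)); last exact: nearW.
by rewrite fin_num_adde_defl.
Qed.

End Lipschitz.

Lemma caratheodory_half_plane (f : plane -> R) (a : R) :
  (forall p q, (`|f p - f q| <= enorm (p - q))%R) ->
  hausdorff1.-caratheodory [set p | (a < f p)%R].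
Proof.
move=> f_lip; apply: le_caratheodory_measurable => X.
have [Xfin|] := ltP (hausdorff1 X) +oo; first exact: half_plane_caratheodory.
by rewrite leye_eq => /eqP Xoo; rewrite [leRHS]Xoo leey.
Qed.

Lemma norm_fst_le p q : (`|p.1 - q.1| <= enorm (p - q))%R.
Proof. by rewrite -sqrtr_sqr ler_wsqrtr// lerDl sqr_ge0. Qed.

Lemma norm_snd_le p q : (`|p.2 - q.2| <= enorm (p - q))%R.
Proof. by rewrite -sqrtr_sqr ler_wsqrtr// lerDr sqr_ge0. Qed.

Lemma caratheodory_borel :
  @measurable _ (measurableTypeR R * measurableTypeR R)%type `<=`
  hausdorff1.-caratheodory.
Proof.
have cara_fun (f : plane -> R) :
    (forall p q, (`|f p - f q| <= enorm (p - q))%R) ->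
    measurable_fun (setT : set (caratheodory_type hausdorff1))
      (f : _ -> measurableTypeR R).
  move=> f_lip; apply: (measurability _ (measurable_realfun.RGenOInfty.measurableE R)).
  move=> _ [_ [a ->] <-]; rewrite setTI.
  have := @caratheodory_half_plane f a f_lip.
  by congr (hausdorff1.-caratheodory _);
    apply/seteqP; split=> p /=; rewrite in_itv/= andbT.
apply: smallest_sub.
  exact: (@sigma_algebra_measurable _ (caratheodory_type hausdorff1)).
move=> _ [|] [B mB <-].
  exact: (cara_fun _ norm_fst_le).
exact: (cara_fun _ norm_snd_le).
Qed.

(* The measure m_Gamma, on the Borel sets of the plane: [measurableTypeR R] is
   R with its Borel sets, and the product carries the product sigma-algebra. *)
Definition arc_measure (Gamma : set plane) :
  set (measurableTypeR R * measurableTypeR R) -> \bar R :=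
  fun M => hausdorff1 (M `&` Gamma).

Section arc_measure.
Variable Gamma : set plane.

Let arc_measure0 : arc_measure Gamma set0 = 0.
Proof. by rewrite /arc_measure set0I; exact: hausdorff1_0. Qed.

Let arc_measure_ge0 M : 0 <= arc_measure Gamma M.
Proof. exact: hausdorff1_ge0. Qed.

Let arc_measure_sigma_additive : semi_sigma_additive (arc_measure Gamma).
Proof.
move=> A mA tA mbigcupA; set B := \bigcup_k A k.
have cA k := caratheodory_borel (mA k).
have -> : arc_measure Gamma B = \sum_(k <oo) arc_measure Gamma (A k).
  apply/eqP; rewrite eq_le; apply/andP; split.
    rewrite /arc_measure setI_bigcupl.
    exact: hausdorff1_sigma_subadditive.
  have := caratheodory_lime_le cA tA (B `&` Gamma).
  rewrite setIAC setICr set0I outer_measure0 adde0.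
  apply: le_trans; apply: lee_nneseries => [*|k _]; first exact: arc_measure_ge0.
  by apply: le_hausdorff1 => p [Akp Gp]; split=> //; split=> //; exists k.
by apply: is_cvg_nneseries => *; exact: arc_measure_ge0.
Qed.

HB.instance Definition _ := isMeasure.Build _ _ _ (arc_measure Gamma)
  arc_measure0 arc_measure_ge0 arc_measure_sigma_additive.

End arc_measure.
End Hausdorff.

Section Loop.
Context {R : realType}.
Local Notation plane := (R * R)%type.
Implicit Types (L : R) (gamma : R -> plane).

(* On each [t i, t i.+1] the derivative extends continuously to the end points,
   which (gamma being continuous) says that gamma is C^1 up to the end points;
   gamma is parametrized by arc length. *)
Definition is_loop L gamma : Prop :=
  [/\ 0 < L, gamma 0 = gamma L, {within `[0, L], continuous gamma} &
    exists (n : nat) (t : nat -> R),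
      [/\ t 0%N = 0, t n = L & forall i, (i < n)%N -> t i < t i.+1 /\
        exists d : R -> plane,
          {within `[t i, t i.+1], continuous d} /\
          forall s, s \in `]t i, t i.+1[ ->
            is_derive s (1 : R) gamma (d s) /\ enorm (d s) = 1]].

Definition loop_image L gamma : set plane := gamma @` `[0, L].

(* The distance along the loop between gamma z.1 and gamma z.2 is the length of
   the shorter of the two arcs. *)
Definition c_Gamma L gamma : R :=
  inf [set enorm (gamma z.1 - gamma z.2)
           / Num.min `|z.1 - z.2| (L - `|z.1 - z.2|) |
       z in [set z : R * R | [/\ z.1 \in `[0, L], z.2 \in `[0, L] &
                                 0 < `|z.1 - z.2| < L]]].

End Loop.

Section TestFunctions.
Context {R : realType}.
Local Notation plane := (R * R)%type.
Implicit Types (phi : plane -> R) (s : seq bool).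

Definition unit_vector (j : bool) : plane := if j then (0, 1) else (1, 0).

Definition partial (j : bool) phi : plane -> R := 'D_(unit_vector j) phi.

Definition iter_partial s phi : plane -> R := foldr partial phi s.

Definition smooth phi : Prop := forall s,
  continuous (iter_partial s phi) /\
  forall j x, derivable (iter_partial s phi) x (unit_vector j).

Definition test_function phi : Prop :=
  smooth phi /\ exists r, forall x, r < enorm x -> phi x = 0.

Definition schwartz_real phi : Prop := smooth phi /\
  forall s (k : nat), exists M, forall x,
    enorm x ^+ k * `|iter_partial s phi x| <= M.

Definition schwartz (psi : plane -> R[i]) : Prop :=
  schwartz_real (fun x => complex.Re (psi x)) /\
  schwartz_real (fun x => complex.Im (psi x)).

End TestFunctions.

(* Elements of L^2 spaces are represented by functions; equality in L^2 is
   equality almost everywhere. *)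
Section L2.
Context {R : realType}.
Local Notation plane := (R * R)%type.
Local Notation C := R[i].
Variable mu : {measure set (measurableTypeR R * measurableTypeR R) -> \bar R}.
Implicit Types f g : plane -> C.

Definition inL2 f : Prop :=
  (fun x => complex.Re (f x)) \in Lfun mu 2%:E /\
  (fun x => complex.Im (f x)) \in Lfun mu 2%:E.

Definition L2norm f : R := fine 'N[mu]_2%:E[(fun x => (Normc.normc (f x))%:E)].

Definition cintegral f : C :=
  Complex (\int[mu]_x complex.Re (f x)) (\int[mu]_x complex.Im (f x)).

Definition L2dot f g : C := cintegral (fun x => f x * (g x)^*%C).

End L2.

Section Sobolev.
Context {R : realType}.
Local Notation plane := (R * R)%type.
Local Notation C := R[i].
Implicit Types u v w : plane -> C.

Definition lebesgue2 :
  {measure set (measurableTypeR R * measurableTypeR R) -> \bar R} :=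
  (lebesgue_measure \x lebesgue_measure)%E.

Definition is_weak_partial (j : bool) u w : Prop :=
  inL2 lebesgue2 w /\ forall phi : plane -> R, test_function phi ->
    cintegral lebesgue2 (fun x => u x * (partial j phi x)%:C%C) =
    - cintegral lebesgue2 (fun x => w x * (phi x)%:C%C).

(* Weak derivatives are unique up to a null set; a representative is chosen. *)
Definition weak_partial (j : bool) u : plane -> C :=
  xget (cst 0) [set w | is_weak_partial j u w].

Definition inH1 u : Prop :=
  inL2 lebesgue2 u /\ forall j, exists w, is_weak_partial j u w.

Definition H1norm u : R :=
  Num.sqrt (L2norm lebesgue2 u ^+ 2 +
            \sum_(j : bool) L2norm lebesgue2 (weak_partial j u) ^+ 2).

End Sobolev.

Section Hamiltonian.
Context {R : realType}.
Local Notation plane := (R * R)%type.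
Local Notation C := R[i].
Variables (alpha : R) (Gamma : set plane).
Implicit Types u v f : plane -> C.

Definition is_trace (I : (plane -> C) -> (plane -> C)) : Prop :=
  [/\ forall u, inH1 u -> inL2 (arc_measure Gamma) (I u),
      forall (a : C) u v, inH1 u -> inH1 v ->
        I (fun x => a * u x + v x) = (fun x => a * I u x + I v x)
        %[ae arc_measure Gamma],
      exists M : R, forall u, inH1 u ->
        L2norm (arc_measure Gamma) (I u) <= M * H1norm u &
      forall psi, schwartz psi -> I psi = psi %[ae arc_measure Gamma]].

(* The operator I_Gamma; it is determined almost everywhere by [is_trace],
   Schwartz functions being dense in H^1. *)
Definition trace : (plane -> C) -> (plane -> C) := xget (fun f => f) is_trace.

(* The sesquilinear form whose diagonal u |-> delta_form u u is the quadratic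
   form q_{alpha, Gamma}; its domain is H^1. *)
Definition delta_form u v : C :=
  \sum_(j : bool) L2dot lebesgue2 (weak_partial j u) (weak_partial j v)
  - alpha%:C%C * L2dot (arc_measure Gamma) (trace u) (trace v).

(* Operators are given by their graphs. The operator associated with the form,
   as in Kato's first representation theorem: u is in its domain and is mapped
   to f iff u is in H^1 and q(u, v) = <f, v> for all v in H^1. *)
Definition hamiltonian u f : Prop :=
  [/\ inH1 u, inL2 lebesgue2 f &
      forall v, inH1 v -> delta_form u v = L2dot lebesgue2 f v].

End Hamiltonian.

Section Spectrum.
Context {R : realType}.
Local Notation plane := (R * R)%type.
Local Notation C := R[i].
Variable T : (plane -> C) -> (plane -> C) -> Prop.

(* T - z is onto L^2 and has a bounded inverse; the bound gives injectivity. *)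
Definition resolvent_set : set C := [set z : C |
  (forall g, inL2 lebesgue2 g -> exists u f, T u f /\
     (fun x => f x - z * u x) = g %[ae lebesgue2]) /\
  exists M : R, forall u f, T u f ->
    L2norm lebesgue2 u <= M * L2norm lebesgue2 (fun x => f x - z * u x)].

Definition spectrum : set C := ~` resolvent_set.

(* For self-adjoint T the spectrum is real, so this is its infimum; it is +oo
   for an empty spectrum and -oo for one that is unbounded from below. *)
Definition inf_spectrum : \bar R :=
  ereal_inf [set x%:E | x in [set x : R | spectrum x%:C%C]].

End Spectrum.

(* Main.v *)
(** The form shifted by a real [l < - (alpha / (2 c)) ^+ 2] is coercive on H^1, hence
    [l] is in the resolvent set by the Riesz representation theorem, because of
      [a \int_Gamma |u|^2 <= \int |grad u|^2 + (a / (2 c))^2 \int |u|^2]  for [a > 0].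
    By the definition of [c], the arc length of [Gamma] inside discs centred at a
    point of [Gamma] is at most that of a line scaled by [1 / c], so the heat kernel
    [P_s] satisfies [\int_Gamma P_s(x - y) dm(y) <= (c sqrt (4 pi s))^-1] on [Gamma],
    and the potential [phi = \int_0^oo e^(- k^2 s) P_s m ds] is at most [1 / (2 k c)]
    there. Since [- Delta phi + k^2 phi = m], the ground state representation gives
    [\int |grad u|^2 + k^2 |u|^2 >= \int |u|^2 / phi dm], the inequality with
    [k = a / (2 c)]. The representation is proved in discrete time, where it is the
    arithmetic-geometric mean inequality for the kernel [e^(- k^2 t) P_t] with the
    weight [phi], and [t] tends to 0 at the end. *)
Require Import Defs.
From HB Require Import structures.
From mathcomp Require Import all_boot all_order all_algebra.
From mathcomp Require Import complex.
From mathcomp Require Import all_classical all_reals all_analysis.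
From mathcomp Require Import measurable_realfun.
From mathcomp Require Import ring lra zify.

Set Implicit Arguments.
Unset Strict Implicit.
Unset Printing Implicit Defensive.
Import Order.TTheory GRing.Theory Num.Theory numFieldNormedType.Exports.
Local Open Scope classical_set_scope.
Local Open Scope ring_scope.

(** * Lebesgue measure on the plane *)

(** The form is built from two choice operators, [weak_partial] and [trace], so a bounded trace must
    first be shown to exist. It comes from the inequality itself: proved for bounded continuous
    functions in H^1, it extends to H^1 by density of the test functions, produces the trace as a
    closure, and shows that whatever [trace] selects agrees with that closure almost everywhere.
    Density is a Hilbert space fact here: the orthogonal complement of the test functions consists
    of weak solutions of [- Delta u + u = 0], and these vanish. Discrete time avoids giving a
    meaning to [- Delta phi + k^2 phi = m] for a singular measure [m]: finitely many smoothed copies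
    of [m] and a constant [e > 0] form a positive weight, and Tonelli is only applied to nonnegative
    integrands. The price is that [|u|] on the curve is replaced by its heat average, which
    continuity and Fatou undo. Of the Hausdorff measure of the loop only the upper bound by arc
    length enters. The strict gap below the threshold leaves room to enlarge [alpha] a little, and
    this yields coercivity in H^1 and not merely in L^2. *)

Notation mR R := (measurableTypeR R).
Notation pl R := (measurableTypeR R * measurableTypeR R)%type.

Section plane_measure.
Context {R : realType}.
Implicit Types (f g : R * R -> R).

Lemma lebesgue2X (A B : set (mR R)) : measurable A -> measurable B ->
  lebesgue2 (A `*` B) = (lebesgue_measure A * lebesgue_measure B)%E.
Proof. by move=> mA mB; rewrite /lebesgue2/= product_measure1E. Qed.

(** [lebesgue2] is declared as a plain measure; this convertible copy carries the sigma-finite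
    structure that the Fubini-Tonelli theorems demand. *)
Definition leb2 : set (pl R) -> \bar R := lebesgue2.

Let leb20 : leb2 set0 = 0%E. Proof. exact: measure0. Qed.

Let leb2_ge0 A : (0 <= leb2 A)%E. Proof. exact: measure_ge0. Qed.

Let leb2_sigma : semi_sigma_additive leb2.
Proof. exact: measure_semi_sigma_additive. Qed.

HB.instance Definition _ :=
  isMeasure.Build _ _ _ leb2 leb20 leb2_ge0 leb2_sigma.

Let leb2_sigma_finite : sigma_finite setT leb2.
Proof.
have /sigma_finiteP[F [TF ndF Foo]] := @sigma_finiteT _ _ _ (@lebesgue_measure R).
exists (fun n => F n `*` F n).
  rewrite predeqE => -[x y]; split; last by [].
  move=> _; have [n _ Fnx] : (\bigcup_i F i) x by rewrite -TF.
  have [k _ Fky] : (\bigcup_i F i) y by rewrite -TF.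
  exists (maxn n k) => //; split.
  - by move: x Fnx; exact/subsetPset/ndF/leq_maxl.
  - by move: y Fky; exact/subsetPset/ndF/leq_maxr.
move=> k; have [? ?] := Foo k.
split; first exact: measurableX.
by rewrite /leb2 lebesgue2X// lte_mul_pinfty// ge0_fin_numE.
Qed.

HB.instance Definition _ :=
  Measure_isSigmaFinite.Build _ _ _ leb2 leb2_sigma_finite.

Lemma lebesgue2_Tonelli (f : pl R -> \bar R) :
  measurable_fun [set: pl R] f ->
  (forall x, 0 <= f x)%E ->
  (\int[lebesgue2]_z f z =
   \int[lebesgue_measure]_x \int[lebesgue_measure]_y f (x, y))%E.
Proof. by move=> mf f0; rewrite -fubini_tonelli1. Qed.

(** The sigma-algebra is the product one, so an open set has to be exhibited as a countable union of
    boxes: those with rational corners contained in it. *)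
Lemma open_measurable2 (U : set (R * R)) : open U -> @measurable _ (pl R) U.
Proof.
move=> oU.
pose box (q : rat * rat * (rat * rat)) : set (pl R) :=
  `]ratr q.1.1, ratr q.1.2[ `*` `]ratr q.2.1, ratr q.2.2[.
pose B q := if `[< box q `<=` U >] then box q else set0.
have -> : U = \bigcup_q B q.
  apply/seteqP; split => [[x y] Uxy|z [q _]]; last first.
    by rewrite /B; case: asboolP => // + bz; exact.
  have /nbhs_ballP[e /= e0 eU] : nbhs (x, y) U by exact: open_nbhs_nbhs.
  have [a /andP[]] := @rat_in_itvoo R (x - e) x ltac:(lra).
  have [b /andP[]] := @rat_in_itvoo R x (x + e) ltac:(lra).
  have [c /andP[]] := @rat_in_itvoo R (y - e) y ltac:(lra).
  have [d /andP[]] := @rat_in_itvoo R y (y + e) ltac:(lra).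
  rewrite !bnd_simp => d1 d2 c1 c2 b1 b2 a1 a2.
  exists ((a, b), (c, d)) => //; rewrite /B; case: asboolP => [_|[]].
    by split; rewrite /= in_itv/=; apply/andP; split.
  move=> [x' y'] [/=]; rewrite !in_itv/= => /andP[h1 h2] /andP[h3 h4].
  apply: eU; split; rewrite /ball/= ltr_norml; apply/andP; split; lra.
apply: countable_bigcupT_measurable => [//|q]; rewrite /B; case: asboolP => // _.
by apply: measurableX; exact: measurable_itv.
Qed.

Lemma continuous_measurable2 (f : R * R -> R) : continuous f ->
  measurable_fun [set: pl R] (f : _ -> mR R).
Proof.
move=> cf; apply: (measurability _ (measurable_realfun.RGenOInfty.measurableE R)).
move=> _ [_ [a ->] <-]; rewrite setTI; apply: open_measurable2.
exact: open_comp.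
Qed.

Lemma lebesgue_measure_shift (h : R) (A : set (mR R)) : measurable A ->
  pushforward lebesgue_measure (fun x : mR R => x + h : mR R) A =
  lebesgue_measure A.
Proof.
move=> mA; apply/esym/lebesgue_measure_unique => //=.
  exact: measurable_funD.
move=> mh _ [[a b]] _ <-.
rewrite /pushforward.
rewrite (_ : _ @^-1` _ = `]a - h, b - h]%classic); last first.
  by apply/seteqP; split=> x /=; rewrite !in_itv/= ltrBlDr lerBrDr.
rewrite !lebesgue_measure_itv/= !lte_fin ltrD2r; case: ifP => // _.
by congr (_%:E); ring.
Qed.

Lemma integral_shift (h : R) (f : mR R -> \bar R) :
  measurable_fun [set: mR R] f -> (forall x, 0 <= f x)%E ->
  (\int[lebesgue_measure]_x f (x + h)%R = \int[lebesgue_measure]_x f x)%E.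
Proof.
move=> mf f0.
have mh : measurable_fun [set: mR R] (fun x : mR R => x + h : mR R).
  by apply: measurable_funD.
rewrite [RHS](@eq_measure_integral _ _ _ setT
    (pushforward lebesgue_measure (fun x : mR R => x + h : mR R))); last first.
  by move=> A mA _; exact/esym/lebesgue_measure_shift.
by rewrite ge0_integral_pushforward.
Qed.

Lemma integral_reflect (f : mR R -> \bar R) :
  measurable_fun [set: mR R] f -> (forall x, 0 <= f x)%E ->
  (\int[lebesgue_measure]_x f (- x)%R = \int[lebesgue_measure]_x f x)%E.
Proof.
move=> mf f0.
have mh : measurable_fun [set: mR R] (fun x : mR R => - x : mR R).
  exact: measurable_funN.
rewrite [RHS](@eq_measure_integral _ _ _ setT
    (pushforward lebesgue_measure (-%R : _ -> mR R))); last first.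
  by move=> A mA _; exact/esym/lebesgue_measureN.
by rewrite ge0_integral_pushforward.
Qed.

Lemma integral_shift2 (h : R * R) (f : pl R -> \bar R) :
  measurable_fun [set: pl R] f -> (forall x, 0 <= f x)%E ->
  (\int[lebesgue2]_x f (x + h)%R = \int[lebesgue2]_x f x)%E.
Proof.
move=> mf f0.
have mh : measurable_fun [set: pl R] (fun x : pl R => (x + h)%R : pl R).
  apply/measurable_fun_pairP; split.
    exact: (measurable_funD measurable_fst (measurable_cst _)).
  exact: (measurable_funD measurable_snd (measurable_cst _)).
rewrite (lebesgue2_Tonelli mf f0) lebesgue2_Tonelli; last 2 first.
- exact: (measurableT_comp mf mh).
- by move=> x; exact: f0.
rewrite -[RHS](@integral_shift h.1); last 2 first.
- exact: (@measurable_fun_fubini_tonelli_F _ _ (mR R) (mR R) R lebesgue_measure f mf f0).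
- by move=> x; exact: integral_ge0.
apply: eq_integral => x _; rewrite -[RHS](@integral_shift h.2)//.
exact: measurable_fun_pair2.
Qed.

(** Serves to cancel the mixed term of a quadratic form integrated against the heat kernel. *)
Lemma integral_reflect2 (f : pl R -> \bar R) :
  measurable_fun [set: pl R] f -> (forall x, 0 <= f x)%E ->
  (\int[lebesgue2]_x f (x.1, - x.2)%R = \int[lebesgue2]_x f x)%E.
Proof.
move=> mf f0.
have mh : measurable_fun [set: pl R] (fun x : pl R => (x.1, - x.2)%R : pl R).
  by apply: measurable_fun_pair => //; exact: (measurableT_comp _ measurable_snd).
rewrite (lebesgue2_Tonelli mf f0) lebesgue2_Tonelli; last 2 first.
- exact: (measurableT_comp mf mh).
- by move=> x; exact: f0.
apply: eq_integral => x _; rewrite -[RHS]integral_reflect//.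
exact: measurable_fun_pair2.
Qed.

End plane_measure.

(** * Riesz representation *)

Section abstract_riesz.
Context {R : realType} {T : Type}.
Local Notation V := (T -> R).
Variables (D S : V -> Prop) (B : V -> V -> R).

Definition is_subspace (W : V -> Prop) :=
  W 0 /\ forall a u v, W u -> W v -> W (a *: u + v).

(** Only semi-definite, because functions stand for their classes modulo null sets. *)
Definition semi_dot := [/\
  forall a u v w, D u -> D v -> D w -> B (a *: u + v) w = a * B u w + B v w,
  forall u v, D u -> D v -> B u v = B v u &
  forall u, D u -> 0 <= B u u].

(** Completeness is phrased with squared distances, which keeps square roots out of all later
    estimates. *)
Definition dot_complete := forall u : V^nat, (forall n, D (u n)) ->
  (forall e : R, 0 < e -> exists N, forall n m, (N <= n)%N -> (N <= m)%N ->
    B (u n - u m) (u n - u m) <= e) ->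
  exists2 l, D l & forall e : R, 0 < e -> exists N, forall n, (N <= n)%N ->
    B (u n - l) (u n - l) <= e.

Hypotheses (sD : is_subspace D) (sS : is_subspace S).
Hypothesis SD : forall u, S u -> D u.
Hypothesis dB : semi_dot.

Lemma subspaceB (W : V -> Prop) u v : is_subspace W -> W u -> W v -> W (u - v).
Proof.
by move=> [_ W1] Wu Wv; rewrite addrC -scaleN1r; apply: W1.
Qed.

Lemma subspaceZ (W : V -> Prop) a u : is_subspace W -> W u -> W (a *: u).
Proof. by move=> [W0 W1] Wu; rewrite -[_ *: _]addr0; apply: W1. Qed.

Lemma subspaceD (W : V -> Prop) u v : is_subspace W -> W u -> W v -> W (u + v).
Proof. by move=> [_ W1] Wu Wv; rewrite -[u]scale1r; apply: W1. Qed.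

Lemma dotDZ a u v : D u -> D v ->
  B (u + a *: v) (u + a *: v) = B u u + a *+ 2 * B u v + a ^+ 2 * B v v.
Proof.
case: dB => lB cB _ Du Dv.
have Dav := subspaceZ a sD Dv; have Duav := subspaceD sD Du Dav.
have E w : D w -> B (u + a *: v) w = a * B v w + B u w.
  by move=> Dw; rewrite addrC lB.
by rewrite E // (cB v) // (cB u (u + _)) // !E // (cB v u) //; ring.
Qed.

(** Expands [0 <= e * B w w] for [w = u - e^-1 *: v]. This replaces the triangle inequality
    throughout: with [v] of squared norm of order [e ^+ 2], the loss on the main term [B u u] is
    only of order [e]. *)
Lemma semi_dot_young (e : R) u v : 0 < e -> D u -> D v ->
  B (u + v) (u + v) <= (1 + e) * B u u + (1 + e^-1) * B v v.
Proof.
move=> e0 Du Dv; have [_ _ pB] := dB.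
have h1 := dotDZ 1 Du Dv; rewrite scale1r in h1.
have h2 := dotDZ (- e^-1) Du Dv; rewrite h1 expr1n !mul1r.
have Dw : D (u + - e^-1 *: v) by apply: subspaceD => //; exact: subspaceZ.
have := mulr_ge0 (ltW e0) (pB _ Dw); rewrite h2.
set a := B u u; set b := B u v; set c := B v v.
have -> : e * (a + - e^-1 *+ 2 * b + (- e^-1) ^+ 2 * c) = e * a - 2 * b + e^-1 * c.
  by field; rewrite gt_eqF.
by lra.
Qed.

Lemma dot_cauchy_schwarz u v : D u -> D v -> B u v ^+ 2 <= B u u * B v v.
Proof.
move=> Du Dv; have [_ _ pB] := dB.
have P a : 0 <= B u u + a *+ 2 * B u v + a ^+ 2 * B v v.
  by rewrite -dotDZ// pB//; apply: subspaceD => //; exact: subspaceZ.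
have := pB _ Dv; rewrite le_eqVlt => /predU1P[v0|v0]; last first.
  have := P (- (B u v / B v v)).
  have -> : B u u + - (B u v / B v v) *+ 2 * B u v +
      (- (B u v / B v v)) ^+ 2 * B v v = (B u u * B v v - B u v ^+ 2) / B v v.
    by field; rewrite gt_eqF.
  by rewrite pmulr_lge0 ?invr_gt0// subr_ge0.
rewrite -v0 mulr0; have [->|uv0] := eqVneq (B u v) 0; first by rewrite expr0n.
(* With [B v v = 0] the polynomial in [a] is affine of nonzero slope; this [a] gives it the value
   -1. *)
have := P (- (B u u + 1) / (B u v *+ 2)).
rewrite -v0 mulr0 addr0.
have -> : B u u + (- (B u u + 1) / (B u v *+ 2)) *+ 2 * B u v = -1.
  by field.
by rewrite oppr_ge0 ler10.
Qed.

(* Minimizes the quadratic functional [B v v - 2 F v] over [S]: this yields both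
   the Riesz representation (for [S = D]) and the orthogonal projection onto the
   closure of [S] (for [F = B u]). *)
Lemma riesz_approx (F : V -> R) (M : R) : dot_complete ->
  (forall a u v, S u -> S v -> F (a *: u + v) = a * F u + F v) ->
  (forall v, S v -> F v ^+ 2 <= M * B v v) ->
  exists p, [/\ D p, forall v, S v -> B p v = F v &
    forall e : R, 0 < e -> exists2 s, S s & B (p - s) (p - s) <= e].
Proof.
move=> cplt lF bF; have [lB cB pB] := dB.
have S0 : S 0 by case: sS.
have F0 : F 0 = 0 by have := lF 1 0 0 S0 S0; rewrite scaler0 addr0 mul1r; lra.
have B0 w : D w -> B 0 w = 0.
  have D0 := SD S0; move=> Dw; have := lB 1 0 0 w D0 D0 Dw.
  by rewrite scaler0 addr0 mul1r; lra.
pose M' := Num.max M 1.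
have M'0 : 0 < M' by rewrite lt_max ltr01 orbT.
have bF' v : S v -> F v ^+ 2 <= M' * B v v.
  move=> Sv; apply: le_trans (bF _ Sv) _; rewrite ler_wpM2r ?pB//; first exact: SD.
  by rewrite le_max lexx.
pose J v := B v v - 2 * F v.
have Jlb v : S v -> - M' <= J v.
  move=> Sv; rewrite /J; have := bF' _ Sv; have := pB _ (SD Sv).
  move: (B v v) (F v) => b f b0 fb.
  (* Arithmetic-geometric mean: [f ^+ 2 <= m * b <= ((m + b) / 2) ^+ 2]. *)
  suff : f <= (M' + b) / 2 by lra.
  move: M'0 fb; move: (M') => m m0 fb; rewrite leNgt; apply/negP => h.
  have : 0 < (f - (m + b) / 2) * (f + (m + b) / 2) by apply: mulr_gt0; lra.
  by have := sqr_ge0 (m - b); lra.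
pose E : set R := [set J v | v in S].
have E0 : E !=set0 by exists (J 0), 0.
have lE : has_lbound E by exists (- M') => _ [v Sv <-]; exact: Jlb.
pose m := inf E.
have mJ v : S v -> m <= J v by move=> Sv; apply: ge_inf => //; exists v.
have /choice[s sP] n : exists v, S v /\ J v <= m + n.+1%:R^-1.
  have n0 : 0 < n.+1%:R^-1 :> R by [].
  have [_ [v Sv <-] vm] := inf_adherent n0 (conj E0 lE).
  by exists v; split => //; exact: ltW.
(* Parallelogram identity: the midpoint of two almost minimizers lies in [S] and does not go below
   [m], so the two are close. A minimizing sequence is thus Cauchy. *)
have Bs n k : B (s n - s k) (s n - s k) <= 2 * (n.+1%:R^-1 + k.+1%:R^-1).
  have [[Sn Jn] [Sk Jk]] := (sP n, sP k).
  have Zn := subspaceZ 2^-1 sS Sn; have Zk := subspaceZ 2^-1 sS Sk.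
  have [[Dn Dk] DZn] := (SD Sn, SD Sk, SD Zn).
  have Sm : S (2^-1 *: s n + 2^-1 *: s k) by exact: subspaceD.
  have := mJ _ Sm; rewrite /J lF//.
  have -> : F (2^-1 *: s k) = 2^-1 * F (s k).
    by rewrite -[_ *: s k]addr0 lF// F0 addr0.
  have D0 := SD S0.
  have E1 w : D w -> B (2^-1 *: s n) w = 2^-1 * B (s n) w.
    by move=> Dw; rewrite -[_ *: s n]addr0 lB// B0// addr0.
  rewrite dotDZ// (E1 (s k))// (E1 (_ *: _))// (cB (s n) (_ *: _))// E1//.
  have -> : s n - s k = s n + (-1) *: s k by rewrite scaleN1r.
  rewrite dotDZ//; move: Jn Jk; rewrite /J; move: (n.+1%:R^-1) (k.+1%:R^-1).
  move: (B (s n) (s n)) (B (s k) (s k)) (B (s n) (s k)) (F (s n)) (F (s k)) (m).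
  by move=> ? ? ? ? ? ? ? ?; lra.
have inv_le (e : R) : 0 < e -> exists N : nat, forall n, (N <= n)%N -> n.+1%:R^-1 <= e :> R.
  move=> e0; have [N Ne] := ltr_add_invr e0.
  rewrite add0r in Ne; exists N => n Nn; apply/ltW/(le_lt_trans _ Ne).
  by rewrite lef_pV2 ?posrE// ler_nat.
have [e e0|p Dp sp] := cplt s (fun n => SD (sP n).1).
  have [|N NP] := inv_le (e / 4); first by rewrite divr_gt0.
  exists N => n k Nn Nk; apply: le_trans (Bs n k) _.
  by have := NP _ Nn; have := NP _ Nk; move: (n.+1%:R^-1) (k.+1%:R^-1) => ? ?; lra.
have psE n : B (p - s n) (p - s n) = B (s n - p) (s n - p).
  have Sn := (sP n).1.
  have Dd : D (s n - p) by apply: subspaceB => //; exact: SD.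
  have -> : p - s n = 0 + (-1) *: (s n - p) by rewrite scaleN1r add0r opprB.
  rewrite dotDZ//; last exact: SD.
  by rewrite !B0//; [ring|exact: SD].
have app (e : R) : 0 < e -> exists n, B (p - s n) (p - s n) <= e /\ n.+1%:R^-1 <= e :> R.
  move=> e0; have [N1 P1] := sp _ e0; have [N2 P2] := inv_le _ e0.
  exists (maxn N1 N2); rewrite psE; split; first by apply: P1; exact: leq_maxl.
  by apply: P2; exact: leq_maxr.
exists p; split => //; last first.
  by move=> e /app[n [pn _]]; exists (s n) => //; exact: (sP n).1.
move=> v Sv; have Dv := SD Sv.
(* First variation of an almost minimizer: moving from [s n] by [t *: v] gains at most [n.+1%:R^-1],
   so [W] is a nonnegative quadratic in [t]; its minimum at [t = - x / b] gives the estimate. *)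
have key n : (B (s n) v - F v) ^+ 2 <= n.+1%:R^-1 * (B v v).
  have [Sn Jn] := sP n.
  have W t : 0 <= n.+1%:R^-1 + 2 * t * (B (s n) v - F v) + t ^+ 2 * B v v.
    have Stv := subspaceZ t sS Sv.
    have := mJ _ (subspaceD sS Sn Stv).
    rewrite /J dotDZ//; last exact: SD.
    rewrite [X in F X]addrC lF//; move: Jn; rewrite /J.
    by move: (n.+1%:R^-1) (m) => ? ?; lra.
  move: W; move: (B (s n) v - F v) => x.
  have : 0 <= B v v by exact: pB.
  have : 0 < n.+1%:R^-1 :> R by [].
  move: (n.+1%:R^-1) (B v v) => ep b ep0; rewrite le_eqVlt => /predU1P[<-|b0] W.
    rewrite mulr0; have [->|x0] := eqVneq x 0; first by rewrite expr0n.
    have := W (- ep / x); rewrite mulr0 addr0.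
    have -> : ep + 2 * (- ep / x) * x = - ep by field.
    by lra.
  have := W (- x / b).
  have -> : ep + 2 * (- x / b) * x + (- x / b) ^+ 2 * b = (ep * b - x ^+ 2) / b.
    by field; rewrite gt_eqF.
  by rewrite pmulr_lge0 ?invr_gt0// subr_ge0.
apply/eqP; rewrite -subr_eq0 -sqrf_eq0 eq_le sqr_ge0 andbT.
apply/ler_addgt0Pl => e e0; rewrite addr0.
have b0 := pB _ Dv.
(* The constant makes each of the two squared errors, from [p] to [s n] and from [s n] to [F], at
   most [e / 4]; the final splitting of the square doubles them. *)
have [|n [pn ne]] := app (e / (4 * (B v v + 1))).
  by rewrite divr_gt0// mulr_gt0//; lra.
have Dn := SD (sP n).1.
have := dot_cauchy_schwarz (subspaceB sD Dp Dn) Dv.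
have -> : B (p - s n) v = B p v - B (s n) v.
  by rewrite addrC -scaleN1r lB//; ring.
move: (key n) pn ne b0; move: (B v v) (B p v) (B (s n) v) (F v) => b x y z.
move: (B _ _) => q; move: (n.+1%:R^-1) => r h1 h2 h3 b0 h4.
have h : e / (4 * (b + 1)) * b <= e / 4.
  have -> : e / (4 * (b + 1)) * b = e / 4 * (b / (b + 1)) by field; lra.
  rewrite ler_piMr//; first by lra.
  by rewrite ler_pdivrMr; lra.
have := ler_wpM2r b0 h2; have := ler_wpM2r b0 h3; move: h; set w := _ * b => h.
have : (x - z) ^+ 2 <= 2 * (x - y) ^+ 2 + 2 * (y - z) ^+ 2 by have := sqr_ge0 (x - y - (y - z)); lra.
lra.
Qed.

End abstract_riesz.

(** * Square integrable functions *)

HB.lock Definition dot d (T : measurableType d) (R : realType)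
  (mu : {measure set T -> \bar R}) (f g : T -> R) : R := \int[mu]_x (f x * g x).
Arguments dot {d T R} mu f g.

Lemma dot_Rintegral d (T : measurableType d) (R : realType)
    (mu : {measure set T -> \bar R}) (f g : T -> R) :
  dot mu f g = \int[mu]_x (f x * g x).
Proof. by rewrite dot.unlock. Qed.

Section L2_theory.
Context d (T : measurableType d) {R : realType}.
Variable mu : {measure set T -> \bar R}.
Local Notation dot := (@dot _ T R mu).
Implicit Types f g h : T -> R.

Definition L2 f := measurable_fun setT f /\
  (\int[mu]_x (f x ^+ 2)%:E < +oo)%E.

Lemma L2_measurable f : L2 f -> measurable_fun setT f. Proof. by case. Qed.

Lemma measurable_sqr f : measurable_fun setT f ->
  measurable_fun setT (fun x => (f x ^+ 2)%:E).
Proof. by move=> mf; apply/measurable_EFinP; exact: measurable_funX. Qed.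

Lemma Lnorm2E f : ('N[mu]_2%:E[EFin \o f] =
  (\int[mu]_x (f x ^+ 2)%:E) `^ 2^-1)%E.
Proof.
rewrite unlock /Lnorm/=; congr (_ `^ _)%E; apply: eq_integral => x _ /=.
by rewrite -[2%R]/(2%:R) powR_mulrn// real_normK// num_real.
Qed.

Lemma L2P f : f \in Lfun mu 2%:E <-> L2 f.
Proof.
split=> [fL|[mf fi]].
  have /integrableP[_ i] := Lfun2_integrable_sqr fL; split.
    by move: fL; rewrite inE => /andP[]; rewrite inE.
  apply: le_lt_trans i; rewrite le_eqVlt; apply/orP; left; apply/eqP.
  by apply: eq_integral => x _; rewrite gee0_abs// lee_fin sqr_ge0.
rewrite inE; apply/andP; split; rewrite inE//=.
by rewrite /finite_norm Lnorm2E poweR_lty.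
Qed.

Lemma L2_integrableM f g : L2 f -> L2 g ->
  mu.-integrable setT (EFin \o (fun x => f x * g x)).
Proof.
by move=> /L2P fL /L2P gL; apply/Lfun1_integrable/Lfun2_mul_Lfun1.
Qed.

Lemma dotE f : L2 f -> (dot f f)%:E = (\int[mu]_x (f x ^+ 2)%:E)%E.
Proof.
move=> [mf fi]; rewrite !dot_Rintegral /Rintegral fineK.
  by apply: eq_integral => x _; rewrite expr2.
rewrite ge0_fin_numE; last by apply: integral_ge0 => x _; rewrite lee_fin -expr2 sqr_ge0.
by under eq_integral do rewrite -expr2.
Qed.

Lemma L20 : L2 0.
Proof.
split; first exact: measurable_cst.
by under eq_integral do rewrite expr0n; rewrite integral0.
Qed.

Lemma L2_subspace : is_subspace L2.
Proof.
split; first exact: L20.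
move=> a f g [mf fi] [mg gi]; split.
  by apply: measurable_funD => //; apply: measurable_funM.
apply: (@le_lt_trans _ _ (\int[mu]_x ((2 * a ^+ 2)%:E * (f x ^+ 2)%:E + 2%:E * (g x ^+ 2)%:E))%E).
  apply: ge0_le_integral => //.
  - by move=> x _; rewrite lee_fin sqr_ge0.
  - apply: measurable_sqr; apply: measurable_funD => //.
    exact: measurable_funM.
  - apply: emeasurable_funD; apply: emeasurable_funM => //; exact: measurable_sqr.
  - move=> x _; rewrite -!EFinM -EFinD lee_fin !fctE /GRing.scale/=.
    by have := sqr_ge0 (a * f x - g x); lra.
rewrite ge0_integralD//.
- rewrite !ge0_integralZl_EFin//.
  + by apply: lte_add_pinfty; rewrite lte_mul_pinfty// lee_fin mulr_ge0//; exact: sqr_ge0.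
  + by move=> x _; rewrite lee_fin sqr_ge0.
  + exact: measurable_sqr.
  + by move=> x _; rewrite lee_fin sqr_ge0.
  + exact: measurable_sqr.
  + by rewrite mulr_ge0//; exact: sqr_ge0.
- move=> x _; rewrite -EFinM lee_fin; apply: mulr_ge0; last exact: sqr_ge0.
  by apply: mulr_ge0 => //; exact: sqr_ge0.
- apply: emeasurable_funM => //; exact: measurable_sqr.
- by move=> x _; rewrite -EFinM lee_fin; apply: mulr_ge0 => //; exact: sqr_ge0.
- apply: emeasurable_funM => //; exact: measurable_sqr.
Qed.

Lemma dotC f g : dot f g = dot g f.
Proof.
by rewrite !dot_Rintegral; apply: eq_Rintegral => x _; rewrite mulrC.
Qed.

Lemma dot_ge0 f : 0 <= dot f f.
Proof.
by rewrite dot_Rintegral; apply: Rintegral_ge0 => x _; rewrite -expr2 sqr_ge0.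
Qed.

Lemma dotDl a f g h : L2 f -> L2 g -> L2 h ->
  dot (a *: f + g) h = a * dot f h + dot g h.
Proof.
move=> Lf Lg Lh; rewrite !dot_Rintegral.
have := RintegralD measurableT (L2_integrableM (subspaceZ a L2_subspace Lf) Lh)
  (L2_integrableM Lg Lh).
rewrite -RintegralZl//; last exact: L2_integrableM.
move=> E; transitivity (\int[mu]_x ((a *: f) x * h x + g x * h x)).
  by apply: eq_Rintegral => x _; rewrite !fctE mulrDl.
rewrite E; congr (_ + _).
by apply: eq_Rintegral => x _; rewrite !fctE /GRing.scale/= mulrA.
Qed.

Lemma semi_dot_L2 : semi_dot L2 dot.
Proof.
by split=> *; [exact: dotDl|exact: dotC|exact: dot_ge0].
Qed.

Lemma dot_ae f g f' g' : L2 f -> L2 g -> L2 f' -> L2 g' ->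
  f = f' %[ae mu] -> g = g' %[ae mu] -> dot f g = dot f' g'.
Proof.
move=> Lf Lg Lf' Lg' ff gg; rewrite !dot_Rintegral /Rintegral; congr fine.
apply: ae_eq_integral => //.
- by apply/measurable_EFinP/measurable_funM; exact: L2_measurable.
- by apply/measurable_EFinP/measurable_funM; exact: L2_measurable.
- by move: ff gg; apply: filterS2 => x /= + + xT => -> // ->.
Qed.

Lemma dot0_ae f : L2 f -> dot f f = 0 -> f = cst 0 %[ae mu].
Proof.
move=> Lf f0; have := dotE Lf; rewrite f0 => /esym i0.
have mf := measurable_sqr (L2_measurable Lf).
have /(ae_eq_integral_abs _ measurableT mf) : (\int[mu]_x `|(f x ^+ 2)%:E| = 0)%E.
  by rewrite -[RHS]i0; apply: eq_integral => x _; rewrite gee0_abs// lee_fin sqr_ge0.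
by apply: filterS => x /= /[apply] -[] /eqP; rewrite sqrf_eq0 => /eqP.
Qed.

Lemma ae_dot0 f : L2 f -> f = cst 0 %[ae mu] -> dot f f = 0.
Proof.
move=> Lf f0; rewrite (dot_ae Lf Lf L20 L20)//.
by rewrite dot_Rintegral; under eq_Rintegral do rewrite mul0r; rewrite /Rintegral integral0.
Qed.

Lemma dotB_ae f g : L2 f -> L2 g -> dot (f - g) (f - g) = 0 -> f = g %[ae mu].
Proof.
move=> Lf Lg /(dot0_ae (subspaceB L2_subspace Lf Lg)).
by apply: filterS => x /= /[apply]; rewrite !fctE => /eqP; rewrite subr_eq0 => /eqP.
Qed.

End L2_theory.
Lemma fatou_le d (T : measurableType d) (R : realType)
    (mu : {measure set T -> \bar R}) (f : nat -> T -> R) (l : T -> R) (e : \bar R)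
    (N : nat) :
  (forall n, measurable_fun setT (f n)) -> (forall n x, 0 <= f n x) ->
  (forall x, f ^~ x @ \oo --> l x) ->
  (forall n, (N <= n)%N -> (\int[mu]_x (f n x)%:E <= e)%E) ->
  (\int[mu]_x (l x)%:E <= e)%E.
Proof.
move=> mf f0 fl fe.
have -> : (\int[mu]_x (l x)%:E = \int[mu]_x limn_einf (fun n => (f n x)%:E))%E.
  apply: eq_integral => x _; apply/esym.
  have h : (fun n => (f n x)%:E) @ \oo --> (l x)%:E.
    by apply: cvg_EFin; [exact: nearW|exact: fl].
  by case: (cvg_limn_einf_sup h).
apply: le_trans; first apply: fatou => //.
- by move=> n; exact/measurable_EFinP.
- by move=> n x _; rewrite lee_fin.
rewrite limn_einf_lim; apply: lime_le; first exact: is_cvg_einfs.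
apply: nearW => n; apply: (@le_trans _ _ (\int[mu]_x (f (maxn N n) x)%:E)%E).
  by apply: ereal_inf_lbound; exists (maxn N n) => //=; exact: leq_maxr.
by apply: fe; exact: leq_maxl.
Qed.

Section L2_complete.
Context d (T : measurableType d) {R : realType}.
Variable mu : {measure set T -> \bar R}.

(** Riesz-Fischer. Along a fast subsequence the weighted sum [G] of the squared increments has
    finite integral, hence is finite almost everywhere; where it is finite, the increments are
    dominated by a geometric sequence and the subsequence converges pointwise. Fatou then turns the
    Cauchy property into convergence in norm. *)
Lemma L2_complete : dot_complete (L2 mu) (dot mu).
Proof.
move=> u Lu Cu.
have r0 k : 0 < (2 ^ (k + 1))%:R^-1 / 4 ^+ k :> R.
  by rewrite divr_gt0 ?exprn_gt0// invr_gt0 ltr0n expn_gt0.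
have /choice[N NP] k := Cu _ (r0 k).
(* Partial sums make the indices nondecreasing in [k] while staying above both [N k] and [k]. *)
pose i k := (\sum_(0 <= j < k.+1) (N j + 1))%N.
have iN k : (N k <= i k)%N by rewrite /i big_nat_recr//=; lia.
have ik k : (k <= i k)%N.
  by elim: k => // k ih; move: ih; rewrite /i (@big_nat_recr _ _ _ k.+1)//=; lia.
have ile k m : (k <= m)%N -> (i k <= i m)%N.
  move=> km; rewrite /i.
  by rewrite [leqRHS](@big_cat_nat _ _ _ k.+1)//= leq_addr.
pose w k : T -> R := u (i k); pose D k : T -> R := w k.+1 - w k.
have Lw k : L2 mu (w k) by exact: Lu.
have LD k : L2 mu (D k) by apply: subspaceB => //; exact: L2_subspace.
have BD k : dot mu (D k) (D k) <= (2 ^ (k + 1))%:R^-1 / 4 ^+ k.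
  apply: NP => //; apply: leq_trans (iN _) (ile _ _ _); first exact: leqnSn.
pose G x := (\sum_(k <oo) (4 ^+ k * D k x ^+ 2)%:E)%E.
have mD k : measurable_fun setT (fun x => (4 ^+ k * D k x ^+ 2)%:E).
  apply/measurable_EFinP; apply: measurable_funM => //.
  by apply: measurable_funX; exact: L2_measurable (LD k).
have D0 k x : (0 <= (4 ^+ k * D k x ^+ 2)%:E)%E.
  by rewrite lee_fin mulr_ge0 ?sqr_ge0.
have mG : measurable_fun setT G by apply: ge0_emeasurable_sum.
have G0 x : (0 <= G x)%E by exact: nneseries_ge0.
have Goo : (\int[mu]_x G x < +oo)%E.
  rewrite integral_nneseries//.
  apply: (@le_lt_trans _ _ (\sum_(k <oo) (1 / (2 ^ (k + 1))%:R)%:E)%E).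
    apply: lee_nneseries => [k _ _|k _]; first by apply: integral_ge0 => x _.
    under eq_integral do rewrite EFinM.
    rewrite ge0_integralZl_EFin//; last 2 first.
    - by move=> x _; rewrite lee_fin sqr_ge0.
    - exact/measurable_sqr/L2_measurable/LD.
    rewrite -dotE// -EFinM lee_fin div1r mulrC -ler_pdivlMr ?exprn_gt0//.
  have := @cvg_geometric_eseries_half R 1 0.
  by move=> /cvg_lim; rewrite /eseries /= => ->//; rewrite ltry.
pose A : set T := [set x | (G x < +oo)%E].
have mA : measurable A.
  have := emeasurable_fun_infty_o measurableT mG.
  by rewrite /A => /(_ +oo%E); rewrite setTI.
have aeA : {ae mu, forall x, A x}.
  have iG : mu.-integrable setT G.
    apply/integrableP; split=> //; apply: le_lt_trans Goo.
    by apply: ge0_le_integral => //;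
      [exact: measurableT_comp|move=> x _; rewrite gee0_abs].
  have := integrable_ae measurableT iG.
  by apply: filterS => x /(_ I); rewrite ge0_fin_numE.
(* Cutting off the null set where [G] is infinite makes the sequence converge everywhere, so that
   its limit is measurable. *)
pose v k x : R := w k x * \1_A x.
have mv k : measurable_fun setT (v k).
  apply: measurable_funM; first exact: L2_measurable (Lw k).
  exact: measurable_indic.
have cv x : cvgn (v ^~ x).
  have [Ax|nAx] := pselect (A x); last first.
    rewrite (_ : v ^~ x = cst 0); first exact: is_cvg_cst.
    by apply/funext => k; rewrite /v indicE memNset// mulr0.
  rewrite (_ : v ^~ x = w ^~ x); last first.
    by apply/funext => k; rewrite /v indicE mem_set// mulr1.
  pose g := fine (G x).
  have gE : G x = g%:E by rewrite fineK// ge0_fin_numE.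
  (* From [y ^+ 2 <= g] follows [y <= 1 + g], which avoids the square root of [g]. *)
  have Dg k : `|D k x| <= geometric (1 + g) 2^-1 k.
    have : ((4 ^+ k * D k x ^+ 2)%:E <= G x)%E.
      apply: le_trans (nneseries_lim_ge k.+1 _); last by move=> *; exact: D0.
      rewrite big_nat_recr//= leeDr//; apply: sume_ge0 => j _; exact: D0.
    rewrite gE lee_fin /= exprVn => h.
    rewrite ler_pdivlMr ?exprn_gt0// mulrC.
    have g0 : 0 <= g by rewrite fine_ge0.
    have e4 : 4 ^+ k * D k x ^+ 2 = (2 ^+ k * `|D k x|) ^+ 2.
      have -> : 4 = 2 ^+ 2 :> R by ring.
      by rewrite [RHS]exprMn real_normK ?num_real// -!exprM mulnC.
    move: h; rewrite e4; set y := 2 ^+ k * _ => h.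
    rewrite leNgt; apply/negP => yg.
    have : 0 < (y - (1 + g)) * (y + (1 + g)) by apply: mulr_gt0; lra.
    by have := sqr_ge0 g; lra.
  have cs : cvgn (series (fun k => D k x)).
    apply: normed_cvg; apply: (@series_le_cvg _ _ (geometric (1 + g) 2^-1)).
    - by move=> n; exact: normr_ge0.
    - by move=> n; apply: le_trans (Dg n); exact: normr_ge0.
    - exact: Dg.
    - by apply: is_cvg_geometric_series; rewrite ger0_norm// invf_lt1// ltr1n.
  rewrite (_ : w ^~ x = fun n => w 0%N x + series (fun k => D k x) n); last first.
    apply/funext => n; have := eq_sum_telescope (w ^~ x) n => ->.
    by congr (_ + series _ _); apply/funext => k; rewrite /telescope /D !fctE.
  by apply: is_cvgD => //; exact: is_cvg_cst.
pose l x := limn (v ^~ x).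
have vl x : v ^~ x @ \oo --> l x by exact: cv.
have ml : measurable_fun setT l by apply: measurable_fun_cvg mv _ => x _; exact: vl.
have key e : 0 < e -> exists n0, forall n, (n0 <= n)%N ->
    (\int[mu]_x ((u n x - l x) ^+ 2)%:E <= e%:E)%E.
  move=> e0; have [n0 n0P] := Cu _ e0; exists n0 => n n0n.
  apply: (@fatou_le _ _ _ _ (fun k x => (u n x - v k x) ^+ 2) _ _ n0).
  - by move=> k; apply: measurable_funX; apply: measurable_funB => //; exact: L2_measurable.
  - by move=> k x; exact: sqr_ge0.
  - move=> x; apply: (@cvg_comp _ _ _ (fun k => u n x - v k x) (fun y => y ^+ 2)).
      by apply: cvgB; [exact: cvg_cst|exact: vl].
    exact: sqr_continuous.
  - move=> k nk; apply: (@le_trans _ _ (dot mu (u n - w k) (u n - w k))%:E); last first.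
      rewrite lee_fin; apply: n0P => //; apply: (leq_trans nk).
      exact: ik.
    rewrite dotE; last by apply: subspaceB => //; exact: L2_subspace.
    rewrite le_eqVlt; apply/orP; left; apply/eqP; apply: ae_eq_integral => //.
    + apply: measurable_sqr; apply: measurable_funB => //; exact: L2_measurable.
    + apply: measurable_sqr; apply: measurable_funB => //; exact: L2_measurable.
    + by move: aeA; apply: filterS => x Ax _; rewrite /v indicE mem_set// mulr1 !fctE.
have [n1 n1P] := key 1 ltr01.
have Lul n : (n1 <= n)%N -> L2 mu (u n - l).
  move=> nn; split; first by apply: measurable_funB => //; exact: L2_measurable.
  by apply: le_lt_trans (n1P _ nn) _; rewrite ltry.
have Ll : L2 mu l.
  rewrite (_ : l = u n1 - (u n1 - l)); last by rewrite opprB addrC subrK.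
  by apply: subspaceB; [exact: L2_subspace|exact: Lu|exact: Lul].
exists l => // e e0; have [n0 n0P] := key _ e0; exists n0 => n nn.
rewrite -lee_fin dotE; first exact: n0P.
by apply: subspaceB => //; exact: L2_subspace.
Qed.
End L2_complete.

(** * Smooth functions and test functions *)

Section plane_calculus.
Context {R : realType}.
Local Notation plane := (R * R)%type.
Implicit Types (phi psi : plane -> R) (x v : plane).

Lemma is_derive_lineP phi x v l :
  is_derive (0 : R) 1 (fun t : R => phi (x + t *: v)) l <-> is_derive x v phi l.
Proof.
have E : (fun h : R => h^-1 *: (((fun t : R => phi (x + t *: v)) \o shift 0) (h *: 1)
           - phi (x + 0 *: v))) =
         (fun h : R => h^-1 *: ((phi \o shift x) (h *: v) - phi x)).
  apply/funext => h /=.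
  have -> : h *: (1 : R) = h by rewrite /GRing.scale/= mulr1.
  by rewrite scale0r !addr0 [x + _]addrC.
split=> -[D1 D2]; split.
- by move: D1; rewrite /derivable E.
- by rewrite -D2 /derive E.
- by rewrite /derivable E.
- by rewrite -D2 /derive E.
Qed.

Lemma is_derive_line phi x v t : derivable phi (x + t *: v) v ->
  is_derive t 1 (fun t : R => phi (x + t *: v)) ('D_v phi (x + t *: v)).
Proof.
move=> /derivableP/is_derive_lineP h.
have h2 : is_derive t (1 : R) (fun s : R => s - t) 1.
  by apply: is_derive_eq; rewrite subr0.
have := @is_derive1_comp _ (fun s : R => phi (x + t *: v + s *: v))
  (fun s : R => s - t) t _ _ _ h2.
rewrite subrr => /(_ _ h); rewrite mulr1.
congr (is_derive _ _ _ _); apply/funext => s /=.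
by rewrite -addrA -scalerDl [t + _]addrC subrK.
Qed.

Lemma smooth_continuous phi : smooth phi -> continuous phi.
Proof. by move=> /(_ [::]) []. Qed.

Lemma smooth_derivable phi j x : smooth phi -> derivable phi x (unit_vector j).
Proof. by move=> /(_ [::]) []. Qed.

Lemma smooth_partial j phi : smooth phi -> smooth (partial j phi).
Proof. by move=> sphi s; have := sphi (rcons s j); rewrite /iter_partial foldr_rcons. Qed.

(** Spares any formula for iterated partial derivatives: a class of differentiable functions stable
    under one derivative is enough. *)
Lemma smooth_coind (K : (plane -> R) -> Prop) :
  (forall phi, K phi -> continuous phi /\
     forall j x, derivable phi x (unit_vector j)) ->
  (forall phi j, K phi -> K (partial j phi)) ->
  forall phi, K phi -> smooth phi.
Proof.
move=> Kd Kp phi Kphi s; suff /Kd : K (iter_partial s phi) by [].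
by elim: s => //= j s ih; exact: Kp.
Qed.

(** By the Leibniz rule this algebra is stable under [partial], as [smooth_coind] requires; the
    products alone would not be. *)
Inductive smooth_alg : (plane -> R) -> Prop :=
| salg_smooth phi : smooth phi -> smooth_alg phi
| salg_add phi psi : smooth_alg phi -> smooth_alg psi -> smooth_alg (phi + psi)
| salg_mul phi psi : smooth_alg phi -> smooth_alg psi -> smooth_alg (phi * psi).

Lemma smooth_algE phi : smooth_alg phi -> smooth phi.
Proof.
have D1 phi' : smooth_alg phi' ->
    continuous phi' /\ forall j x, derivable phi' x (unit_vector j).
  elim=> [f sf|f g _ [cf df] _ [cg dg]|f g _ [cf df] _ [cg dg]].
  - by split; [exact: smooth_continuous|move=> *; exact: smooth_derivable].
  - split=> [x|j x]; first by apply: continuousD; [exact: cf|exact: cg].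
    by apply: derivableD.
  - split=> [x|j x]; first by apply: continuousM; [exact: cf|exact: cg].
    by apply: derivableM.
apply: smooth_coind => // phi' j; elim=> [f sf|f g Kf Kpf Kg Kpg|f g Kf Kpf Kg Kpg].
- exact/salg_smooth/smooth_partial.
- rewrite (_ : partial _ _ = partial j f + partial j g); first exact: salg_add.
  by apply/funext => x; apply: deriveD; [exact: (D1 _ Kf).2|exact: (D1 _ Kg).2].
- rewrite (_ : partial _ _ = f * partial j g + g * partial j f).
    by apply: salg_add; apply: salg_mul.
  by apply/funext => x; apply: deriveM; [exact: (D1 _ Kf).2|exact: (D1 _ Kg).2].
Qed.

Lemma smoothD phi psi : smooth phi -> smooth psi -> smooth (phi + psi).
Proof. by move=> *; apply: smooth_algE; apply: salg_add; exact: salg_smooth. Qed.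

Lemma smoothM phi psi : smooth phi -> smooth psi -> smooth (phi * psi).
Proof. by move=> *; apply: smooth_algE; apply: salg_mul; exact: salg_smooth. Qed.

Lemma partial_cst j (c : R) : partial j (cst c) = cst 0.
Proof. by apply/funext => x; rewrite /partial derive_cst. Qed.

Lemma smooth_cst (c : R) : smooth (cst c).
Proof.
apply: (@smooth_coind (fun f => exists c, f = cst c)); last by exists c.
  by move=> _ [c' ->]; split; [move=> x; exact: cvg_cst|move=> *; exact: derivable_cst].
by move=> _ j [c' ->]; exists 0; rewrite partial_cst.
Qed.

Lemma partialM j phi psi : smooth phi -> smooth psi ->
  partial j (phi * psi) = phi * partial j psi + psi * partial j phi.
Proof.
by move=> sf sg; apply/funext => x; apply: deriveM; exact: smooth_derivable.
Qed.

Lemma smoothZ (a : R) phi : smooth phi -> smooth (a *: phi).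
Proof.
move=> sf; rewrite (_ : a *: phi = cst a * phi); last by apply/funext.
exact: smoothM (smooth_cst a) sf.
Qed.

Lemma is_derive_affine (c : R) (a x : plane) phi j : derivable phi (c *: x + a) (unit_vector j) ->
  is_derive x (unit_vector j) (fun x => phi (c *: x + a))
    (c * partial j phi (c *: x + a)).
Proof.
move=> /derivableP/is_derive_lineP h; apply/is_derive_lineP.
have h2 : is_derive (0:R) (1 : R) (fun s : R => c * s) c.
  by apply: is_derive_eq; rewrite /GRing.scale/= mulr1.
have := @is_derive1_comp _ (fun t : R => phi (c *: x + a + t *: unit_vector j))
  (fun s : R => c * s) 0 _ _ _ h2.
rewrite mulr0 => /(_ _ h); rewrite mulrC.
congr (is_derive _ _ _ _); apply/funext => s /=.
by rewrite scalerDr scalerA addrAC.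
Qed.

Lemma partial_affine (c : R) (a : plane) phi j : smooth phi ->
  partial j (fun x => phi (c *: x + a)) = fun x => c * partial j phi (c *: x + a).
Proof.
move=> sphi; apply/funext => x.
by have [] := is_derive_affine (@smooth_derivable _ j (c *: x + a) sphi).
Qed.

Lemma continuous_affine (c : R) (a : plane) phi : continuous phi ->
  continuous (fun x => phi (c *: x + a)).
Proof.
move=> cphi x; apply: (@continuous_comp _ _ _ (fun x => c *: x + a) phi); last exact: cphi.
by apply: continuousD; [exact: scaler_continuous|exact: cst_continuous].
Qed.

Lemma smooth_affine (c : R) (a : plane) phi : smooth phi ->
  smooth (fun x => phi (c *: x + a)).
Proof.
pose K f := exists b psi, smooth psi /\ f = fun x => b * psi (c *: x + a).
move=> sphi; apply: (@smooth_coind K); last first.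
- by exists 1, phi; split=> //; apply/funext => x; rewrite mul1r.
- move=> _ j [b [psi [spsi ->]]]; exists (b * c), (partial j psi); split.
    exact: smooth_partial.
  have -> : (fun x => b * psi (c *: x + a)) = b *: (fun x => psi (c *: x + a)).
    by apply/funext.
  apply/funext => x; rewrite /partial deriveZ; last first.
    by have [] := is_derive_affine (@smooth_derivable _ j (c *: x + a) spsi).
  have [_ ->] := is_derive_affine (@smooth_derivable _ j (c *: x + a) spsi).
  by rewrite /GRing.scale/= mulrA.
- move=> _ [b [psi [spsi ->]]]; split=> [x|j x].
    apply: continuousM; first exact: cst_continuous.
    exact/continuous_affine/smooth_continuous.
  apply: derivableM => //.
  by have [] := is_derive_affine (@smooth_derivable _ j (c *: x + a) spsi).
Qed.

End plane_calculus.

(** * Smooth functions of compact support *)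

Section bump.
Context {R : realType}.
Local Notation plane := (R * R)%type.
Implicit Types (phi psi : plane -> R).

(** A quadratic remainder identifies the derivative; used at the origin for [flat] and for
    convolutions, where Taylor's formula supplies the remainder. *)
Lemma is_derive_sqr (V : normedModType R) (f : V -> R) (x v : V) (l C : R) :
  (forall h : R, `|h| <= 1 -> `|f (x + h *: v) - f x - h * l| <= C * h ^+ 2) ->
  is_derive x v f l.
Proof.
move=> H.
have h : (fun h : R => h^-1 *: ((f \o shift x) (h *: v) - f x)) @ 0^' --> l.
  have c1 : 0 < `|C| + 1 by rewrite ltr_wpDl.
  apply/cvgrPdist_le => e e0; near=> h.
  have h0 : h != 0 by near: h; exact: nbhs_dnbhs_neq.
  rewrite distrC /= (_ : _ - l = h^-1 * (f (x + h *: v) - f x - h * l)); last first.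
    by rewrite [_ + x]addrC /GRing.scale/=; field.
  rewrite normrM normfV ler_pdivrMl ?normr_gt0//.
  have h1 : `|h| <= 1 by near: h; exact: dnbhs0_le.
  apply: le_trans (H h h1) _; rewrite -real_normK ?num_real// expr2 mulrA mulrC.
  rewrite ler_wpM2l//.
  have : `|h| <= e / (`|C| + 1).
    by near: h; apply: dnbhs0_le; rewrite divr_gt0.
  rewrite ler_pdivlMr// => he.
  apply: le_trans he; rewrite mulrC ler_wpM2l//.
  by rewrite (le_trans (ler_norm _))// lerDl.
by split; [apply/cvg_ex; exists l|exact: cvg_lim h].
Unshelve. all: by end_near. Qed.

(** For [n = 0] the classical function [exp(-1/t)]; the powers of [1/t] are there because
    differentiation produces them. *)
Definition flat n (t : R) : R :=
  if 0 < t then t^-1 ^+ n * expR (- t^-1) else 0.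

Lemma flat_ge0 n t : 0 <= flat n t.
Proof.
rewrite /flat; case: ifPn => // t0.
by rewrite mulr_ge0 ?expR_ge0// exprn_ge0// invr_ge0 ltW.
Qed.

(** Compares [exp(1/t)] with the term of order [n + 2] of its series. The surplus [t ^+ 2] is what
    makes the derivative at the origin vanish. *)
Lemma flat_le n t : flat n t <= (n.+2)`!%:R * t ^+ 2.
Proof.
rewrite /flat; case: ifPn => [t0|_]; last by rewrite mulr_ge0 ?sqr_ge0.
have y0 : 0 <= t^-1 by rewrite invr_ge0 ltW.
have := expR_ge1Dxn n.+1 y0; set c := (n.+2)`!%:R => h.
have c0 : 0 < c by rewrite ltr0n fact_gt0.
have {}h : t^-1 ^+ n.+2 / c <= expR t^-1 by apply: le_trans h; rewrite lerDr.
rewrite expRN ler_pdivrMr ?expR_gt0//.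
move: h; rewrite ler_pdivrMr// => h.
have -> : t^-1 ^+ n = t^-1 ^+ n.+2 * t ^+ 2.
  by rewrite !exprSr -!mulrA [t^-1 * (t^-1 * _)](_ : _ = 1) ?mulr1//; field; rewrite gt_eqF.
have t20 : 0 <= t ^+ 2 by exact: sqr_ge0.
apply: le_trans (ler_wpM2r t20 h) _.
by rewrite le_eqVlt; apply/orP; left; apply/eqP; ring.
Qed.

Lemma is_derive_flat n t :
  is_derive t (1 : R) (flat n) (flat n.+2 t - n%:R * flat n.+1 t).
Proof.
have [t0|t0|t0] := ltgtP t 0.
- have -> : flat n.+2 t - n%:R * flat n.+1 t = 0.
    by rewrite /flat ltNge (ltW t0)/= mulr0 subr0.
  apply: (near_eq_is_derive _ (is_derive_cst (0 : R) t (1 : R))).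
  near=> s; rewrite /flat ltNge ltW//=.
  by near: s; exact: lt_nbhsl.
- have t0' : t != 0 by rewrite gt_eqF.
  have dV : is_derive t (1 : R) (fun s : R => s^-1) (- t ^- 2).
    have := @is_deriveV R id t 1 1 t0' (is_derive_id _ _).
    by rewrite /GRing.scale/= mulr1.
  have dE := @is_derive1_comp R expR (fun s => - s^-1) t _ _ (is_derive_expR _)
    (is_deriveN dV).
  have h := is_deriveM (is_deriveX n dV) dE.
  apply: (near_eq_is_derive _ (is_derive_eq h _)).
    near=> s; have s0 : 0 < s by near: s; exact: lt_nbhsr.
    by rewrite /flat s0 !fctE.
  rewrite /flat t0 /GRing.scale/= !fctE.
  case: n {h} => [|n]; first by rewrite !mul0r !expr0; field.
  by rewrite /= !exprSr; field.
- rewrite t0; have -> : flat n.+2 0 - n%:R * flat n.+1 0 = 0.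
    by rewrite /flat ltxx mulr0 subr0.
  apply: (@is_derive_sqr _ _ _ _ _ (n.+2)`!%:R) => h _.
  rewrite mulr0 subr0 add0r /GRing.scale/= mulr1 {2}/flat ltxx subr0.
  by rewrite ger0_norm ?flat_ge0// flat_le.
Unshelve. all: by end_near. Qed.

Lemma continuous_flat n : continuous (flat n).
Proof.
move=> t; apply/differentiable_continuous/derivable1_diffP.
by have [] := is_derive_flat n t.
Qed.

Inductive flat_alg j (a b : R) : (plane -> R) -> Prop :=
| falg_flat n : flat_alg j a b (fun x => flat n (a * (if j then x.2 else x.1) + b))
| falg_lin c f g : flat_alg j a b f -> flat_alg j a b g ->
    flat_alg j a b (c *: f + g)
| falg_zero : flat_alg j a b (cst 0).

Lemma is_derive_flat_coord j (a b : R) n i (x : plane) :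
  is_derive x (unit_vector i) (fun x : plane => flat n (a * (if j then x.2 else x.1) + b))
   (if i == j then a * (flat n.+2 (a * (if j then x.2 else x.1) + b)
       - n%:R * flat n.+1 (a * (if j then x.2 else x.1) + b)) else 0).
Proof.
apply/is_derive_lineP.
set y := if j then x.2 else x.1.
case: ifPn => [/eqP ->|ij].
  have -> : (fun t : R => flat n (a * (if j then (x + t *: unit_vector j).2
      else (x + t *: unit_vector j).1) + b)) = flat n \o (fun t => a * t + (a * y + b)).
    apply/funext => t /=; congr (flat n _); rewrite /y /unit_vector.
    by case: j {y} => /=; rewrite /GRing.scale/= mulr1; ring.
  have h2 : is_derive (0:R) (1 : R) (fun s : R => a * s + (a * y + b)) a.
    by apply: is_derive_eq; rewrite /GRing.scale/= mulr1 addr0.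
  have := @is_derive1_comp _ (flat n) _ 0 _ _ (is_derive_flat n _) h2.
  by rewrite mulr0 add0r [_ * a]mulrC.
have -> : (fun t : R => flat n (a * (if j then (x + t *: unit_vector i).2
      else (x + t *: unit_vector i).1) + b)) = cst (flat n (a * y + b)).
  apply/funext => t /=; congr (flat n _); rewrite /y /unit_vector.
  by move: ij; case: j {y}; case: i => //= _; rewrite /GRing.scale/= mulr0 addr0.
exact: is_derive_cst.
Qed.

Lemma smooth_flat j (a b : R) n :
  smooth (fun x : plane => flat n (a * (if j then x.2 else x.1) + b)).
Proof.
have D1 f : flat_alg j a b f -> continuous f /\ forall i x, derivable f x (unit_vector i).
  elim=> [m|c g h _ [cg dg] _ [ch dh]|].
  - split=> [x|i x]; last by have [] := is_derive_flat_coord j a b m i x.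
    apply: (@continuous_comp _ _ _ (fun x : plane => a * (if j then x.2 else x.1) + b)).
      apply: continuousD; last exact: cst_continuous.
      apply: continuousM; first exact: cst_continuous.
      by case: j; [exact: cvg_snd|exact: cvg_fst].
    exact: continuous_flat.
  - split=> [x|i x]; last by apply: derivableD => //; exact: derivableZ.
    apply: continuousD; last exact: ch.
    rewrite (_ : c *: g = cst c * g); last by apply/funext.
    by apply: continuousM; [exact: cst_continuous|exact: cg].
  - by split; [move=> x; exact: cst_continuous|move=> *; exact: derivable_cst].
apply: (@smooth_coind _ (flat_alg j a b)) => [//|f i|]; last exact: falg_flat.
elim=> [m|c g h Kg Kpg Kh Kph|].
- rewrite (_ : partial _ _ = fun x : plane => if i == j then
   a * (flat m.+2 (a * (if j then x.2 else x.1) + b)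
       - m%:R * flat m.+1 (a * (if j then x.2 else x.1) + b)) else 0); last first.
    by apply/funext => x; have [_] := is_derive_flat_coord j a b m i x.
  case: (i == j); last exact: falg_zero.
  rewrite [X in flat_alg _ _ _ X](_ : _ = a *: (fun x : plane => flat m.+2 (a * (if j then x.2 else x.1) + b)) +
    ((- a * m%:R) *: (fun x : plane => flat m.+1 (a * (if j then x.2 else x.1) + b)) + cst 0)).
    by apply: falg_lin; [|apply: falg_lin]; (exact: falg_flat || exact: falg_zero).
  by apply/funext => x; rewrite !fctE /GRing.scale/=; ring.
- rewrite (_ : partial _ _ = c *: partial i g + partial i h); first exact: falg_lin.
  apply/funext => x; rewrite /partial deriveD; [|apply: derivableZ|]; last 2 first.
    exact: (D1 _ Kg).2.
    exact: (D1 _ Kh).2.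
  by rewrite deriveZ//; exact: (D1 _ Kg).2.
- by rewrite partial_cst; exact: falg_zero.
Qed.

End bump.

Section test_functions.
Context {R : realType}.
Local Notation plane := (R * R)%type.
Implicit Types (phi psi : plane -> R) (x h : plane).

(** Supports are measured in the maximum norm, whose balls are the boxes of the product measure; by
    equivalence of the norms this changes only the radius in [test_function]. *)
Definition vanishes_off r phi := forall x, r < `|x| -> phi x = 0.

Lemma norm_le_enorm x : `|x| <= enorm x.
Proof.
rewrite prod_normE ge_max; apply/andP; split.
  by have := @norm_fst_le R x 0; rewrite !subr0.
by have := @norm_snd_le R x 0; rewrite !subr0.
Qed.

Lemma norm_fst x : `|x.1| <= `|x|.
Proof. by rewrite prod_normE le_max lexx. Qed.

Lemma norm_snd x : `|x.2| <= `|x|.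
Proof. by rewrite prod_normE le_max lexx orbT. Qed.

Lemma enorm_le_norm x : enorm x <= 2 * `|x|.
Proof.
have n0 : 0 <= 2 * `|x| by rewrite mulr_ge0.
rewrite -(ger0_norm n0) -sqrtr_sqr ler_wsqrtr//.
have := norm_fst x; have := norm_snd x.
rewrite -[x.1 ^+ 2]real_normK ?num_real// -[x.2 ^+ 2]real_normK ?num_real//.
have := normr_ge0 x.1; have := normr_ge0 x.2.
move: `|x.1| `|x.2| `|x| => a b c; nra.
Qed.

Lemma test_functionP phi :
  test_function phi <-> smooth phi /\ exists r, vanishes_off r phi.
Proof.
split=> -[sphi [r rphi]]; split=> //.
  by exists r => x rx; apply: rphi; apply: lt_le_trans rx (norm_le_enorm x).
exists (2 * r) => x rx; apply: rphi.
by have := lt_le_trans rx (enorm_le_norm x); rewrite ltr_pM2l.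
Qed.

Lemma test_smooth phi : test_function phi -> smooth phi. Proof. by case. Qed.

Lemma testM phi psi : test_function phi -> smooth psi -> test_function (phi * psi).
Proof.
move=> [sphi [r rphi]] spsi; split; first exact: smoothM.
by exists r => x /rphi; rewrite !fctE => ->; rewrite mul0r.
Qed.

Lemma test0 : test_function (0 : plane -> R).
Proof. by split; [exact: smooth_cst|exists 0]. Qed.

Lemma test_subspace : is_subspace (@test_function R).
Proof.
split; first exact: test0.
move=> a f g [sf [r rf]] [sg [r' rg]]; split; first exact/smoothD/sg/smoothZ.
exists (Num.max r r') => x; rewrite gt_max => /andP[/rf f0 /rg g0].
by rewrite !fctE f0 g0 scaler0 addr0.
Qed.

Lemma vanishes_off_partial r j phi : vanishes_off r phi ->
  vanishes_off r (partial j phi).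
Proof.
move=> rphi x rx; have h : \forall y \near x, (cst 0 : plane -> R) y = phi y.
  near=> y; rewrite rphi//; near: y.
  apply: (@open_nbhs_nbhs _ x [set y : plane | r < `|y|]); split=> //.
  apply: (@open_comp _ _ (fun y : plane => `|y|) [set y | r < y]).
    by move=> y _; exact: norm_continuous.
  exact: open_gt.
by have [_] := near_eq_is_derive h (is_derive_cst (0 : R) x (unit_vector j)).
Unshelve. all: by end_near. Qed.

Lemma test_partial j phi : test_function phi -> test_function (partial j phi).
Proof.
move=> /test_functionP[sphi [r rphi]]; apply/test_functionP; split.
  exact: smooth_partial.
by exists r; exact: vanishes_off_partial.
Qed.

Lemma test_affine (c : R) (a : plane) phi : c != 0 -> test_function phi ->
  test_function (fun x => phi (c *: x + a)).
Proof.
move=> c0 /test_functionP[sphi [r rphi]]; apply/test_functionP; split.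
  exact: smooth_affine.
exists ((r + `|a|) / `|c|) => x.
rewrite ltr_pdivrMr ?normr_gt0// => rx; apply: rphi.
have := lerB_normD (c *: x) a; rewrite normrZ; move: rx; rewrite mulrC.
by move: (`|c| * `|x|) `|a| `|_ + a| => ? ? ?; lra.
Qed.

Lemma vanishes_bounded r phi : continuous phi -> vanishes_off r phi ->
  exists2 M, 0 < M & forall x, `|phi x| <= M.
Proof.
move=> cphi rphi; pose K : set plane := `[- r, r] `*` `[- r, r].
have cK : compact K by apply: compact_setX; exact: segment_compact.
have : compact (phi @` K).
  by apply: continuous_compact => //; exact: continuous_subspaceT.
move=> /compact_bounded[M [_ MP]].
have M1 : M < `|M| + 1 by rewrite (le_lt_trans (ler_norm _))// ltrDl.
exists (`|M| + 1); first by rewrite ltr_wpDl.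
move=> x; have [rx|xr] := ltP r `|x|.
  by rewrite rphi// normr0 addr_ge0.
apply: (MP _ M1); exists x => //; split; rewrite /= in_itv/= -ler_norml.
  exact: le_trans (norm_fst x) xr.
exact: le_trans (norm_snd x) xr.
Qed.

Lemma test_bounded phi : test_function phi ->
  exists2 M, 0 < M & forall x, `|phi x| <= M.
Proof.
move=> /test_functionP[/smooth_continuous cphi [r rphi]].
exact: vanishes_bounded rphi.
Qed.

Lemma smooth_mvt j phi x (t : R) : smooth phi ->
  exists2 s : R, `|s| <= `|t| & phi (x + t *: unit_vector j) - phi x =
    t * partial j phi (x + s *: unit_vector j).
Proof.
move=> sphi; set e := unit_vector j.
pose g (s : R) := phi (x + s *: e).
have dg s : is_derive s (1 : R) g (partial j phi (x + s *: e)).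
  by apply: is_derive_line; exact: smooth_derivable.
have cg : continuous g.
  move=> s; apply/differentiable_continuous/derivable1_diffP.
  by have [] := dg s.
have -> : phi x = g 0 by rewrite /g scale0r addr0.
have [t0|/ltW t0] := leP 0 t.
  have [s s0 sE] := MVT_segment t0 (fun s _ => dg s) (continuous_subspaceT cg).
  exists s; last by rewrite -/(g t) sE subr0 mulrC.
  by move: s0; rewrite in_itv/= => /andP[s0 st]; rewrite !ger0_norm.
have [s s0 sE] := MVT_segment t0 (fun s _ => dg s) (continuous_subspaceT cg).
exists s; last by rewrite -/(g t) -opprB sE sub0r mulrN opprK mulrC.
by move: s0; rewrite in_itv/= => /andP[ts s0]; rewrite !ler0_norm// lerN2.
Qed.

Lemma plane_decomp h : h = h.1 *: unit_vector false + h.2 *: unit_vector true.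
Proof.
by case: h => a b; rewrite /unit_vector; congr pair; rewrite /= /GRing.scale/=;
  rewrite ?mulr1 ?mulr0 ?addr0 ?add0r.
Qed.

Lemma norm_unit_vector (s : R) j : `|s *: unit_vector j : plane| = `|s|.
Proof.
rewrite normrZ (_ : `|unit_vector j : plane| = 1) ?mulr1//.
rewrite prod_normE /unit_vector; case: j => /=; rewrite normr0 normr1.
  by apply/max_idPr.
by apply/max_idPl.
Qed.

(** Mean value theorem on the two legs of an axis-parallel path, since smoothness is only given
    through partial derivatives. *)
Lemma smooth_increment phi x h : smooth phi -> exists s1 s2 : R,
  [/\ `|s1| <= `|h|, `|s2| <= `|h| & phi (x + h) - phi x =
    h.1 * partial false phi (x + s1 *: unit_vector false) +
    h.2 * partial true phi (x + h.1 *: unit_vector false + s2 *: unit_vector true)].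
Proof.
move=> sphi.
have [s1 h1 E1] := smooth_mvt false x h.1 sphi.
have [s2 h2 E2] := smooth_mvt true (x + h.1 *: unit_vector false) h.2 sphi.
exists s1, s2; split; [exact: le_trans h1 (norm_fst h)|exact: le_trans h2 (norm_snd h)|].
by rewrite -E1 -E2 -[x + _ + _]addrA -plane_decomp; ring.
Qed.

Lemma test_lipschitz phi : test_function phi ->
  exists2 C, 0 < C & forall x y, `|phi x - phi y| <= C * `|x - y|.
Proof.
move=> tphi; have [M1 M10 M1P] := test_bounded (test_partial false tphi).
have [M2 M20 M2P] := test_bounded (test_partial true tphi).
exists (M1 + M2); first exact: addr_gt0.
move=> x y; have [s1 [s2 [_ _]]] := smooth_increment y (x - y) (test_smooth tphi).
rewrite [y + _]addrC subrK => ->.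
rewrite (le_trans (ler_normD _ _))// !normrM mulrDl mulrC; apply: lerD.
  by apply: ler_pM => //; exact: norm_fst.
by rewrite mulrC; apply: ler_pM => //; exact: norm_snd.
Qed.

Lemma test_taylor phi : test_function phi -> exists2 C, 0 < C & forall x h,
  `|phi (x + h) - phi x - (h.1 * partial false phi x + h.2 * partial true phi x)|
    <= C * `|h| ^+ 2.
Proof.
move=> tphi; have [C1 C10 C1P] := test_lipschitz (test_partial false tphi).
have [C2 C20 C2P] := test_lipschitz (test_partial true tphi).
exists (C1 + C2 *+ 2); first by rewrite addr_gt0// mulrn_wgt0.
move=> x h; have [s1 [s2 [h1 h2 ->]]] := smooth_increment x h (test_smooth tphi).
set a := partial false phi (x + _); set b := partial true phi (x + _ + _).
have -> : h.1 * a + h.2 * b - (h.1 * partial false phi x + h.2 * partial true phi x) =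
  h.1 * (a - partial false phi x) + h.2 * (b - partial true phi x) by ring.
have la : `|a - partial false phi x| <= C1 * `|h|.
  apply: le_trans (C1P _ _) _; rewrite [x + _]addrC addrK norm_unit_vector.
  by rewrite ler_wpM2l// ltW.
(* The second leg starts at the end of the first, so its intermediate point may be as far as [2 |h|]
   from [x]. *)
have lb : `|b - partial true phi x| <= C2 * (`|h| *+ 2).
  apply: le_trans (C2P _ _) _; rewrite (_ : _ - x =
    h.1 *: unit_vector false + s2 *: unit_vector true); last first.
    by rewrite addrC -addrA addKr.
  rewrite ler_wpM2l ?(ltW C20)// (le_trans (ler_normD _ _))// !norm_unit_vector.
  by rewrite mulr2n lerD// norm_fst.
rewrite (le_trans (ler_normD _ _))// !normrM.
apply: le_trans (lerD (ler_pM _ _ (norm_fst h) la) (ler_pM _ _ (norm_snd h) lb)) _ => //.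
by rewrite le_eqVlt; apply/orP; left; apply/eqP; ring.
Qed.

(** Each factor is [exp(-1/(k s))], with [s] the signed distance to one side of the box, and 0 for
    [s <= 0]. It tends to 1 for [s > 0], so the indicator of the open box is a pointwise limit of
    test functions supported in its closure. *)
Definition box_bump (a b c d : R) (k : nat) : plane -> R := fun x =>
  flat 0 (k%:R * x.1 + - (k%:R * a)) * flat 0 (- k%:R * x.1 + k%:R * b) *
  (flat 0 (k%:R * x.2 + - (k%:R * c)) * flat 0 (- k%:R * x.2 + k%:R * d)).

Let scaled_diff1 (k y u : R) : k * y - k * u = k * (y - u).
Proof. by rewrite mulrBr. Qed.

Let scaled_diff2 (k y u : R) : - k * y + k * u = k * (u - y).
Proof. by rewrite mulrBr mulNr addrC. Qed.

Lemma test_box_bump a b c d k : (0 < k)%N -> test_function (box_bump a b c d k).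
Proof.
move=> k0; have kR : 0 < k%:R :> R by rewrite ltr0n.
apply/test_functionP; split.
  apply: smoothM; apply: smoothM; [exact: (smooth_flat false)|exact: (smooth_flat false)
    |exact: (smooth_flat true)|exact: (smooth_flat true)].
have key (u v y : R) : `|u| + `|v| < `|y| ->
    flat 0 (k%:R * y + - (k%:R * u)) * flat 0 (- k%:R * y + k%:R * v) = 0.
  move=> uvy; rewrite scaled_diff1 scaled_diff2 /flat.
  rewrite [0 < _ * (y - u)]pmulr_rgt0// [0 < _ * (v - y)]pmulr_rgt0// !subr_gt0.
  have [uy|] := ltP u y; last by rewrite mul0r.
  have [yv|] := ltP y v; last by rewrite mulr0.
  exfalso; move: uvy; rewrite ltNge => /negP; apply.
  have := ler_norm (- u); have := ler_norm v; have := normr_ge0 u; have := normr_ge0 v.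
  by rewrite normrN => *; rewrite ler_norml; apply/andP; split; lra.
exists (`|a| + `|b| + (`|c| + `|d|)) => x.
have [n1 n2] : 0 <= `|a| + `|b| /\ 0 <= `|c| + `|d| by split; exact: addr_ge0.
rewrite prod_normE lt_max => /orP[h|h]; rewrite /box_bump.
  by rewrite key ?mul0r//; lra.
by rewrite mulrC key ?mul0r//; lra.
Qed.

Lemma flat0_le1 (t : R) : flat 0 t <= 1.
Proof.
rewrite /flat; case: ifPn => // t0; rewrite expr0 mul1r expR_le1 oppr_le0 invr_ge0.
exact: ltW.
Qed.

Lemma box_bump_itv a b c d k x : 0 <= box_bump a b c d k x <= 1.
Proof.
by rewrite /box_bump !mulr_ge0 ?flat_ge0//= !mulr_ile1 ?mulr_ge0 ?flat_ge0 ?flat0_le1.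
Qed.

Lemma cvg_flat0 (s : R) : (fun k : nat => flat 0 (k%:R * s)) @ \oo --> ((0 < s)%R%:R : R).
Proof.
have [s0|s0] := ltP 0 s; last first.
  rewrite (_ : (fun _ => _) = cst 0); first exact: cvg_cst.
  by apply/funext => k; rewrite /flat ltNge mulr_ge0_le0.
apply: (@cvg_trans _ ((fun k : nat => expR (- (k%:R * s)^-1)) @ \oo)).
  apply: near_eq_cvg; near=> k; rewrite /flat ifT ?expr0 ?mul1r//.
  by rewrite mulr_gt0// ltr0n; near: k; exact: nbhs_infty_gt.
have h : (fun k : nat => - (k%:R * s)^-1) @ \oo --> (0 : R).
  rewrite (_ : 0 = - (0 * s^-1)); last by rewrite mul0r oppr0.
  under eq_fun do rewrite invfM.
  apply: cvgN; apply: cvgM; last exact: cvg_cst.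
  by rewrite -cvg_shiftS; exact: cvg_harmonic.
have := @cvg_comp _ _ _ _ expR _ _ _ h (@continuous_expR R 0).
by rewrite expR0.
Unshelve. all: by end_near. Qed.

Lemma cvg_box_bump a b c d x :
  (fun k => box_bump a b c d k x) @ \oo --> (\1_(`]a, b[ `*` `]c, d[) x : R).
Proof.
have -> : \1_(`]a, b[ `*` `]c, d[) x = (0 < x.1 - a)%R%:R * (0 < b - x.1)%R%:R *
    ((0 < x.2 - c)%R%:R * (0 < d - x.2)%R%:R) :> R.
  rewrite indicE !subr_gt0 -!natrM; congr (_%:R); rewrite !mulnb; congr (nat_of_bool _).
  by apply/idP/idP => [/set_mem[]/=|h]; rewrite ?in_itv/=; [move=> -> ->|
    apply/mem_set; split; rewrite /= in_itv/=; case/andP: h].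
rewrite /box_bump.
under eq_fun do rewrite !scaled_diff1 !scaled_diff2.
by apply: cvgM; apply: cvgM; exact: cvg_flat0.
Qed.

Lemma box_bump_out a b c d k x : ~ (`]a, b[ `*` `]c, d[) x ->
  box_bump a b c d k x = 0.
Proof.
have neg (s : R) : s <= 0 -> flat 0 (k%:R * s) = 0.
  by move=> s0; rewrite /flat ltNge mulr_ge0_le0.
rewrite /box_bump /setX/= !in_itv/= !scaled_diff1 !scaled_diff2 => nx.
have [ax|xa] := ltP a x.1; last by rewrite neg ?mul0r// subr_le0.
have [xb|bx] := ltP x.1 b; last first.
  by rewrite [X in _ * X * _]neg ?mulr0 ?mul0r// subr_le0.
have [cx|xc] := ltP c x.2; last first.
  by rewrite [X in _ * (X * _)]neg ?mul0r ?mulr0// subr_le0.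
have [xd|dx] := ltP x.2 d; last first.
  by rewrite [X in _ * (_ * X)]neg ?mulr0// subr_le0.
by exfalso; apply: nx; rewrite ax xb cx xd.
Qed.

End test_functions.

(** * Integration of test functions *)

Section plane_integration.
Context {R : realType}.
Local Notation plane := (R * R)%type.
Local Notation mu := (@lebesgue2 R).
Implicit Types (phi psi f g : plane -> R) (x h : plane).

Definition box (r : R) : set (pl R) := `[- r, r] `*` `[- r, r].

Lemma in_box r x : box r x <-> `|x| <= r.
Proof.
rewrite prod_normE ge_max /box /setX/= !in_itv/= -!ler_norml.
by split=> [[-> ->]|/andP].
Qed.

Lemma measurable_box r : measurable (box r).
Proof. by apply: measurableX; exact: measurable_itv. Qed.

Lemma lebesgue2_box_fin r : (mu (box r) < +oo)%E.
Proof.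
rewrite lebesgue2X; [|exact: measurable_itv|exact: measurable_itv].
rewrite lebesgue_measure_itv/=; case: ifP => _; first by rewrite -EFinB -EFinM ltry.
by rewrite mule0 ltry.
Qed.

Definition box_area r : R := fine (mu (box r)).

Lemma box_areaE r : (box_area r)%:E = mu (box r).
Proof. by rewrite fineK// ge0_fin_numE// lebesgue2_box_fin. Qed.

Lemma vanishes_integral_le r f (M : R) : measurable_fun [set: pl R] f -> 0 <= M ->
  (forall x, `|f x| <= M) -> vanishes_off r f ->
  (\int[mu]_x `|(f x)%:E| <= (M * box_area r)%:E)%E.
Proof.
move=> mf M0 fM rf.
apply: (@le_trans _ _ (\int[mu]_x (M%:E * (\1_(box r) x)%:E))%E).
  apply: ge0_le_integral => //.
  - exact/measurableT_comp/measurable_EFinP.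
  - apply: emeasurable_funM => //; apply/measurable_EFinP.
    by apply: measurable_indic; exact: measurable_box.
  - move=> x _; rewrite -EFinM lee_fin indicE.
    have [xr|rx] := leP `|x| r.
      by rewrite mem_set ?mulr1//; exact/in_box.
    by rewrite rf// normr0 mulr_ge0.
rewrite ge0_integralZl_EFin//; last first.
  by apply/measurable_EFinP; apply: measurable_indic; exact: measurable_box.
by rewrite integral_indic// ?setIT ?EFinM ?box_areaE//; exact: measurable_box.
Qed.

Lemma vanishes_integrable r f (M : R) : measurable_fun [set: pl R] f ->
  (forall x, `|f x| <= M) -> vanishes_off r f ->
  mu.-integrable setT (EFin \o f).
Proof.
move=> mf fM rf; apply/integrableP; split; first exact/measurable_EFinP.
have M0 : 0 <= M by apply: le_trans (fM 0).
apply: le_lt_trans (vanishes_integral_le mf M0 fM rf) _.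
by rewrite ltry.
Qed.

Lemma vanishes_L2 r f (M : R) : measurable_fun [set: pl R] f ->
  (forall x, `|f x| <= M) -> vanishes_off r f -> L2 mu f.
Proof.
move=> mf fM rf; split=> //.
have : mu.-integrable setT (EFin \o (fun x => f x ^+ 2)).
  apply: (@vanishes_integrable r _ (M ^+ 2)).
  - exact: measurable_funX.
  - move=> x; rewrite normrX lerXn2r ?nnegrE//.
    exact: le_trans (fM x).
  - by move=> x /rf ->; rewrite expr0n.
move=> /integrableP[_]; apply: le_lt_trans; rewrite le_eqVlt; apply/orP; left.
by apply/eqP/eq_integral => x _; rewrite /= ger0_norm// sqr_ge0.
Qed.

Lemma test_measurable phi : test_function phi -> measurable_fun [set: pl R] phi.
Proof. by case=> /smooth_continuous/continuous_measurable2. Qed.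

Lemma test_L2 phi : test_function phi -> L2 mu phi.
Proof.
move=> tphi; have [M _ MP] := test_bounded tphi.
have /test_functionP[_ [r rphi]] := tphi.
exact: vanishes_L2 (test_measurable tphi) MP rphi.
Qed.

Lemma test_integrable phi : test_function phi -> mu.-integrable setT (EFin \o phi).
Proof.
move=> tphi; have [M _ MP] := test_bounded tphi.
have /test_functionP[_ [r rphi]] := tphi.
exact: vanishes_integrable (test_measurable tphi) MP rphi.
Qed.

Lemma measurable_translate h : measurable_fun [set: pl R] (fun x : pl R => (x + h)%R : pl R).
Proof.
apply/measurable_fun_pairP; split.
  exact: (measurable_funD measurable_fst (measurable_cst _)).
exact: (measurable_funD measurable_snd (measurable_cst _)).
Qed.

Lemma Rintegral_shift2 h f : measurable_fun [set: pl R] f ->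
  \int[mu]_x f (x + h) = \int[mu]_x f x.
Proof.
move=> mf; rewrite /Rintegral; congr fine; rewrite [LHS]integralE [RHS]integralE.
have mE : measurable_fun [set: pl R] (EFin \o f) by exact/measurable_EFinP.
congr (_ - _)%E.
  have E := @integral_shift2 R h _ (measurable_funepos mE) (funepos_ge0 _).
  by rewrite -[RHS]E; apply: eq_integral => x _; rewrite !funeposE.
have E := @integral_shift2 R h _ (measurable_funeneg mE) (funeneg_ge0 _).
by rewrite -[RHS]E; apply: eq_integral => x _; rewrite !funenegE.
Qed.

Lemma test_translate h phi : test_function phi -> test_function (fun x => phi (x + h)).
Proof.
move=> tphi; have := test_affine h (oner_neq0 R) tphi.
by under eq_fun do rewrite scale1r.
Qed.

(* The difference quotients of [phi] integrate to 0 by translation invariance and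
   converge uniformly to the derivative. *)
Lemma integral_partial j phi : test_function phi ->
  \int[mu]_x partial j phi x = 0.
Proof.
move=> tphi; pose e := @unit_vector R j.
have [C C0 CP] := test_taylor tphi.
have /test_functionP[_ [r rphi]] := tphi.
pose I := \int[mu]_x partial j phi x.
have tp := test_partial j tphi.
pose K := C * box_area (r + 1).
have key (t : R) : 0 < t -> t <= 1 -> `|I| <= K * t.
  move=> t0 t1.
  pose D x := phi (x + t *: e) - phi x - t * partial j phi x.
  have tt := test_translate (t *: e) tphi.
  have tD : test_function D.
    have -> : D = (- t) *: partial j phi + ((-1) *: phi + (fun x => phi (x + t *: e))).
      by apply/funext => x; rewrite /D !fctE /GRing.scale/=; ring.
    apply: (test_subspace.2) => //; exact: test_subspace.2.
  have DI : \int[mu]_x D x = - (t * I).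
    rewrite /D RintegralB//; last 2 first.
    - apply: (eq_integrable measurableT) (test_integrable (test_subspace.2 (-1) _ _ tphi tt)) => //.
      by move=> x _ /=; congr (_%:E); rewrite !fctE /GRing.scale/=; ring.
    - exact: (test_integrable (subspaceZ t test_subspace tp)).
    rewrite RintegralB//; [|exact: test_integrable|exact: test_integrable].
    rewrite (Rintegral_shift2 _ (test_measurable tphi)) subrr sub0r.
    by rewrite RintegralZl//; exact: test_integrable.
  have DC x : `|D x| <= C * t ^+ 2.
    have := CP x (t *: e); rewrite norm_unit_vector real_normK ?num_real//.
    congr (`|_ - _| <= _); rewrite /e /unit_vector; case: (j) => /=;
      by rewrite /GRing.scale/= mulr1 mulr0 mul0r ?addr0 ?add0r.
  have Dr : vanishes_off (r + 1) D.
    move=> x rx; rewrite /D rphi; last first.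
      have := lerB_normD x (t *: e); rewrite norm_unit_vector gtr0_norm// => h.
      by move: h rx t1; move: `|x| `|_ + _| => ? ? ? ? ?; lra.
    rewrite rphi ?(vanishes_off_partial _ rphi) ?mulr0 ?subrr//; lra.
  have := vanishes_integral_le (test_measurable tD) _ DC Dr.
  rewrite mulr_ge0 ?(ltW C0) ?sqr_ge0// => /(_ isT) h.
  have : `|\int[mu]_x D x| <= C * t ^+ 2 * box_area (r + 1).
    apply: le_trans (le_normr_Rintegral measurableT (test_integrable tD)) _.
    by rewrite /Rintegral -lee_fin fineK// ge0_fin_numE ?(le_lt_trans h) ?ltry// integral_ge0.
  rewrite DI normrN normrM (gtr0_norm t0) => {}h; rewrite -(ler_pM2l t0).
  by rewrite (le_trans h)// (_ : _ * (K * t) = C * t ^+ 2 * box_area (r + 1))// /K; ring.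
apply/eqP; rewrite -normr_le0; apply/ler_addgt0Pl => ep ep0; rewrite addr0.
have K0 : 0 <= K by rewrite mulr_ge0 ?(ltW C0)// fine_ge0.
have K1 : 0 < K + 1 by rewrite ltr_wpDl.
have m0 : 0 < Num.min 1 (ep / (K + 1)) by rewrite lt_min ltr01 divr_gt0.
apply: le_trans (key _ m0 _) _; first by rewrite ge_min lexx.
apply: (@le_trans _ _ (K * (ep / (K + 1)))).
  by rewrite ler_wpM2l// ge_min lexx orbT.
rewrite mulrA ler_pdivrMr// mulrC ler_wpM2l ?ltW//; lra.
Qed.

Lemma integral_by_parts j phi psi : test_function phi -> smooth psi ->
  \int[mu]_x (psi x * partial j phi x) = - \int[mu]_x (partial j psi x * phi x).
Proof.
move=> tphi spsi; have tM := testM tphi spsi.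
have := integral_partial j tM; rewrite (partialM j (test_smooth tphi) spsi).
have t1 := testM tphi (smooth_partial j spsi).
have t2 : test_function (psi * partial j phi).
  by rewrite mulrC; exact: testM (test_partial j tphi) spsi.
have := RintegralD measurableT (test_integrable t1) (test_integrable t2).
rewrite [LHS](_ : _ = \int[mu]_x (phi * partial j psi + psi * partial j phi) x)// => -> /eqP.
rewrite addr_eq0 => /eqP h.
have -> : \int[mu]_x (partial j psi x * phi x) = \int[mu]_x (phi * partial j psi) x.
  by apply: eq_Rintegral => x _; rewrite fctE mulrC.
by rewrite h opprK.
Qed.

End plane_integration.

(** * Weak derivatives *)

Section du_bois_reymond.
Context {R : realType}.
Local Notation plane := (R * R)%type.
Local Notation mu := (@lebesgue2 R).
Implicit Types (phi psi f g : plane -> R) (x h : plane).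

Definition obox (a b c d : R) : set (pl R) := `]a, b[ `*` `]c, d[.

(** A pi-system generating the Borel sets, used for uniqueness of measures. The boxes are open
    because the bumps converge to indicators of open boxes. *)
Definition oboxes : set (set (pl R)) := [set A | exists a b c d, A = obox a b c d].

Lemma measurable_obox a b c d : measurable (obox a b c d).
Proof. by apply: measurableX; exact: measurable_itv. Qed.

Lemma oboxesI : setI_closed oboxes.
Proof.
move=> _ _ [a [b [c [d ->]]]] [a' [b' [c' [d' ->]]]].
exists (Num.max a a'), (Num.min b b'), (Num.max c c'), (Num.min d d').
apply/seteqP; split=> -[x y]; rewrite /obox /setI /setX/= !in_itv/= !gt_max !lt_min.
  by move=> [[/andP[-> ->] /andP[-> ->]] [/andP[-> ->] /andP[-> ->]]].
by move=> [/andP[/andP[-> ->] /andP[-> ->]] /andP[/andP[-> ->] /andP[-> ->]]].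
Qed.

Lemma bigcup_obox (P : set (pl R)) (F : nat -> set (pl R)) :
  (forall n, oboxes (F n)) -> P = \bigcup_n F n -> <<s oboxes >> P.
Proof.
move=> FB ->.
have := @bigcupT_measurable _ (g_sigma_algebraType oboxes) F; apply=> n.
exact: sub_sigma_algebra.
Qed.

Lemma abs_lt_nat (a : R) : exists n : nat, - n%:R < a /\ a < n%:R.
Proof.
have h0 : 0 <= `|a| by [].
exists (Num.truncn `|a|).+1.
by have /ltr_normlP[h1 h2] := truncnS_gt `|a|; split=> //; rewrite ltrNl.
Qed.

Lemma plane_cover (x : plane) : exists n : nat, obox (- n%:R) n%:R (- n%:R) n%:R x.
Proof.
  have [n [n1 n2]] := abs_lt_nat x.1; have [m [m1 m2]] := abs_lt_nat x.2.
  have le1 : n%:R <= (maxn n m)%:R :> R by rewrite ler_nat leq_maxl.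
  have le2 : m%:R <= (maxn n m)%:R :> R by rewrite ler_nat leq_maxr.
  by exists (maxn n m); split; rewrite /= in_itv/=; apply/andP; split; lra.
Qed.

Lemma oboxes_generate : @measurable _ (pl R) = <<s oboxes >>.
Proof.
apply/seteqP; split; last first.
  apply: smallest_sub; first exact: sigma_algebra_measurable.
  by move=> _ [a [b [c [d ->]]]]; exact: measurable_obox.
apply: smallest_sub.
  exact: (@sigma_algebra_measurable _ (g_sigma_algebraType oboxes)).
have mfst : measurable_fun [set: g_sigma_algebraType oboxes] (fst : _ -> mR R).
  apply: (measurability _ (measurable_realfun.RGenOInfty.measurableE R)).
  move=> _ [_ [a ->] <-]; rewrite setTI.
  apply: (@bigcup_obox _ (fun n => obox a n%:R (- n%:R) n%:R)).
    by move=> n; exists a, n%:R, (- n%:R), n%:R.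
  apply/seteqP; split=> x /=; rewrite in_itv/= andbT.
    move=> ax; have [n [/=]] := plane_cover x; rewrite !in_itv/= => /andP[h1 h2] h3.
    by exists n => //; split; rewrite //= in_itv/= ax.
  by move=> [n _ [/=]]; rewrite in_itv/= => /andP[].
have msnd : measurable_fun [set: g_sigma_algebraType oboxes] (snd : _ -> mR R).
  apply: (measurability _ (measurable_realfun.RGenOInfty.measurableE R)).
  move=> _ [_ [a ->] <-]; rewrite setTI.
  apply: (@bigcup_obox _ (fun n => obox (- n%:R) n%:R a n%:R)).
    by move=> n; exists (- n%:R), n%:R, a, n%:R.
  apply/seteqP; split=> x /=; rewrite in_itv/= andbT.
    move=> ax; have [n [/=]] := plane_cover x; rewrite !in_itv/= => h3 /andP[h1 h2].
    by exists n => //; split; rewrite //= in_itv/= ax.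
  by move=> [n _ [/= _]]; rewrite in_itv/= => /andP[].
move=> _ [|] [B mB <-].
  exact: (mfst measurableT _ mB).
exact: (msnd measurableT _ mB).
Qed.

Section induced.
Variable f : pl R -> \bar R.
Hypotheses (mf : measurable_fun [set: pl R] f) (f0 : forall x, (0 <= f x)%E).

Definition induced (A : set (pl R)) : \bar R := (\int[mu]_(x in A) f x)%E.

Let induced0 : induced set0 = 0%E. Proof. exact: integral_set0. Qed.

Let induced_ge0 A : (0 <= induced A)%E.
Proof. by apply: integral_ge0 => x _; exact: f0. Qed.

Let induced_sigma : semi_sigma_additive induced.
Proof. exact: semi_sigma_additive_nng_induced. Qed.

HB.instance Definition _ :=
  isMeasure.Build _ _ _ induced induced0 induced_ge0 induced_sigma.

Definition induced_measure : {measure set (pl R) -> \bar R} := induced.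

End induced.

(** Bumps converge to the indicator of a box under a fixed majorant, so [f] has integral 0 over
    every open box. The measures with densities the positive and negative parts of [f] then agree on
    a pi-system, hence on all Borel sets; evaluated on the sets where [f >= 0] and where [f <= 0],
    both parts integrate to 0. *)
Lemma du_bois_reymond f : L2 mu f ->
  (forall phi, test_function phi -> dot mu f phi = 0) -> f = cst 0 %[ae mu].
Proof.
move=> Lf f0; have mf := L2_measurable Lf.
have mE : measurable_fun [set: pl R] (EFin \o f) by exact/measurable_EFinP.
have Lbox a b c d : L2 mu (\1_(obox a b c d) : plane -> R).
  split; first by apply: measurable_indic; exact: measurable_obox.
  have E x : \1_(obox a b c d) x ^+ 2 = \1_(obox a b c d) x :> R.
    by rewrite indicE; case: (_ \in _); rewrite ?expr1n ?expr0n.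
  under eq_integral do rewrite E.
  rewrite integral_indic ?setIT//; last exact: measurable_obox.
  rewrite lebesgue2X; [|exact: measurable_itv..].
  rewrite !lebesgue_measure_itv/=; do 2?case: ifP => _;
    by rewrite ?mule0 ?mul0e -?EFinB -?EFinM ltry.
have fI a b c d := L2_integrableM Lf (Lbox a b c d).
have fIE a b c d : (EFin \o f) \_ (obox a b c d) =
    EFin \o (fun x => f x * \1_(obox a b c d) x).
  apply/funext => x; rewrite patchE /= indicE; case: ifPn => _ /=.
    by rewrite mulr1.
  by rewrite mulr0.
have ibox a b c d : mu.-integrable (obox a b c d) (EFin \o f).
  by apply/(integrable_mkcond _ (measurable_obox _ _ _ _)); rewrite fIE.
have key a b c d : (\int[mu]_(x in obox a b c d) (f x)%:E = 0)%E.
  rewrite integral_mkcond (fIE a b c d).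
  pose F (n : nat) x := (f x * box_bump a b c d n.+1 x)%:E.
  have tB n : test_function (box_bump a b c d n.+1) by exact: test_box_bump.
  have iF n : mu.-integrable setT (F n) by exact: (L2_integrableM Lf (test_L2 (tB n))).
  have F0 n : (\int[mu]_x F n x = 0)%E.
    have := f0 _ (tB n); rewrite dot_Rintegral /Rintegral => h.
    by rewrite -[LHS]fineK ?h//; exact: integrable_fin_num.
  have [||_ _ h] := @dominated_convergence _ _ _ mu setT measurableT F
    (EFin \o (fun x => f x * \1_(obox a b c d) x))
    (fun x => `|(f x * \1_(obox a b c d) x)%:E|)%E
    (fun n => measurable_int _ (iF n)) (measurable_int _ (fI a b c d))
    _ (integrable_abse (fI a b c d)) _.
  - apply: aeW => x _; apply: cvg_EFin; first exact: nearW.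
    apply: cvgM; first exact: cvg_cst.
    by have := @cvg_box_bump R a b c d x; rewrite -cvg_shiftS.
  - apply: aeW => x n _; rewrite lee_fin normrM [leRHS]normrM ler_wpM2l//.
    have /andP[B0 B1] := box_bump_itv a b c d n.+1 x.
    rewrite ger0_norm// indicE; case: (boolP (x \in _)) => [_|/negP xn].
      by rewrite normr1.
    by rewrite box_bump_out ?normr0// => /mem_set.
  rewrite -(cvg_lim _ h)//.
  rewrite (_ : [sequence _]_n = cst 0%E); first exact: lim_cst.
  by apply/funext => n; exact: F0.
have pn A : oboxes A ->
    induced_measure (measurable_funepos mE) (funepos_ge0 _) A =
    induced_measure (measurable_funeneg mE) (funeneg_ge0 _) A.
  move=> [a [b [c [d ->]]]].
  have P := integrable_pos_fin_num (measurable_obox _ _ _ _) (ibox a b c d).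
  have N := integrable_neg_fin_num (measurable_obox _ _ _ _) (ibox a b c d).
  have := key a b c d; rewrite integralE /= /induced -[X in (X - _)%E](fineK P).
  rewrite -[X in (_ - X)%E](fineK N) -EFinB => -[/eqP]; rewrite subr_eq0 => /eqP E.
  by rewrite -(fineK P) E fineK.
have h A : measurable A -> (\int[mu]_(x in A) (EFin \o f)^\+ x =
    \int[mu]_(x in A) (EFin \o f)^\- x)%E.
  move=> mA.
  apply: (@measure_unique _ R (pl R) oboxes
    (fun n => obox (- n%:R) n%:R (- n%:R) n%:R) oboxes_generate oboxesI _ _
    (induced_measure (measurable_funepos mE) (funepos_ge0 _))
    (induced_measure (measurable_funeneg mE) (funeneg_ge0 _)) pn _ A mA).
  - by move=> n; exists (- n%:R), n%:R, (- n%:R), n%:R.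
  - apply/seteqP; split=> // x _; have [n nx] := plane_cover x; by exists n.
  - move=> n; have := integrable_pos_fin_num (measurable_obox (- n%:R) n%:R (- n%:R) n%:R) (ibox _ _ _ _).
    by rewrite ge0_fin_numE// ; apply: integral_ge0 => x _; exact: funepos_ge0.
have mA : measurable [set x : pl R | (0 <= (f x)%:E)%E].
  by have := emeasurable_fun_c_infty measurableT mE 0%E; rewrite setTI.
have fp0 : (\int[mu]_x (EFin \o f)^\+ x = 0)%E.
  rewrite -[RHS](_ : (\int[mu]_(x in [set x | (0 <= (f x)%:E)%E]) (EFin \o f)^\- x)%E = 0%E).
    rewrite -h// [RHS]integral_mkcond; apply: eq_integral => x _; rewrite patchE.
    case: ifPn => // /negP nx; rewrite funeposE; apply/max_idPr; rewrite leNgt.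
    by apply/negP => fx; apply: nx; rewrite inE/= ltW.
  apply: integral0_eq => x /= fx; rewrite funenegE; apply/max_idPr.
  by rewrite oppe_le0.
have mB : measurable [set x : pl R | ((f x)%:E <= 0)%E].
  by have := emeasurable_fun_infty_c measurableT mE 0%E; rewrite setTI.
have fn0 : (\int[mu]_x (EFin \o f)^\- x = 0)%E.
  rewrite -[RHS](_ : (\int[mu]_(x in [set x | ((f x)%:E <= 0)%E]) (EFin \o f)^\+ x)%E = 0%E).
    rewrite h// [RHS]integral_mkcond; apply: eq_integral => x _; rewrite patchE.
    case: ifPn => // /negP nx; rewrite funenegE; apply/max_idPr; rewrite leeNl oppe0 leNgt.
    by apply/negP => fx; apply: nx; rewrite inE/= ltW.
  by apply: integral0_eq => x /= fx; rewrite funeposE; apply/max_idPr.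
have : (\int[mu]_x `|(EFin \o f) x| = 0)%E.
  rewrite -[LHS]/(\int[mu]_x (abse \o (EFin \o f)) x)%E fune_abse.
  rewrite ge0_integralD// ?fp0 ?fn0 ?adde0//.
  - exact: measurable_funepos.
  - exact: measurable_funeneg.
move=> /(ae_eq_integral_abs _ measurableT mE); apply: filterS => x /= /[apply].
by case.
Qed.

End du_bois_reymond.

#[global] Instance ae_plane_filter {R : realType}
  (nu : {measure set (pl R) -> \bar R}) : Filter (nbhs (almost_everywhere nu)).
Proof. exact: ae_filter_ringOfSetsType. Qed.

Definition wpartial {R : realType} j (u w : R * R -> R) := L2 lebesgue2 w /\
  forall phi, test_function phi ->
    dot lebesgue2 u (partial j phi) = - dot lebesgue2 w phi.

HB.lock Definition wderiv (R : realType) (j : bool) (u : R * R -> R) : R * R -> R :=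
  xget 0 [set w | wpartial j u w].
Arguments wderiv {R} j u.

(** * The real Sobolev space *)

Section H1_real.
Context {R : realType}.
Local Notation plane := (R * R)%type.
Local Notation mu := (@lebesgue2 R).
Implicit Types (phi psi f g u v w : plane -> R) (x h : plane).

Definition H1 u := L2 mu u /\ forall j, exists w, wpartial j u w.

Definition grad_dot u v :=
  dot mu (wderiv false u) (wderiv false v) + dot mu (wderiv true u) (wderiv true v).

Definition h1_dot u v := dot mu u v + grad_dot u v.

Lemma wderivP j u : H1 u -> wpartial j u (wderiv j u).
Proof. by move=> [_ /(_ j)[w wP]]; rewrite wderiv.unlock; apply: xgetPex; exists w. Qed.

Lemma wderiv_L2 j u : H1 u -> L2 mu (wderiv j u).
Proof. by move=> /(wderivP j)[]. Qed.

Lemma L2_plane_subspace : is_subspace (L2 mu : (plane -> R) -> Prop).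
Proof. exact: L2_subspace. Qed.

Lemma dot_plane_semi_dot : semi_dot (L2 mu : (plane -> R) -> Prop) (dot mu).
Proof. exact: (@semi_dot_L2 _ _ R mu). Qed.

Lemma wpartial_unique j u w w' : wpartial j u w -> wpartial j u w' ->
  w = w' %[ae mu].
Proof.
move=> [Lw wP] [Lw' wP']; have Lww : L2 mu (w - w').
  exact: subspaceB L2_plane_subspace Lw Lw'.
have h phi : test_function phi -> dot mu (w - w') phi = 0.
  move=> tphi; have [lB cB _] := dot_plane_semi_dot; have Lp := test_L2 tphi.
  rewrite addrC -scaleN1r lB// mulN1r; apply/eqP; rewrite addrC subr_eq0.
  by rewrite -eqr_opp -wP// wP'.
have := du_bois_reymond Lww h; apply: filterS => x /= /[apply]; rewrite !fctE => /eqP.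
by rewrite subr_eq0 => /eqP.
Qed.

Lemma wpartialDZ j a u v w z : L2 mu u -> L2 mu v -> wpartial j u w -> wpartial j v z ->
  wpartial j (a *: u + v) (a *: w + z).
Proof.
move=> Lu Lv [Lw wP] [Lz zP]; split; first exact: L2_plane_subspace.2.
move=> phi tphi; have [lB _ _] := dot_plane_semi_dot.
rewrite lB//; last exact/test_L2/test_partial.
by rewrite lB ?wP ?zP//; [ring|exact: test_L2].
Qed.

Lemma L2_H1 u : H1 u -> L2 mu u. Proof. by case. Qed.

Lemma H1_subspace : is_subspace H1.
Proof.
split.
  split; first exact: L20.
  move=> j; exists 0; split; first exact: L20.
  move=> phi tphi.
  have [lB _ _] := dot_plane_semi_dot.
  have z g : L2 mu g -> dot mu (0 : plane -> R) g = 0.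
    move=> Lg; have := lB 1 0 0 g (L20 _) (L20 _) Lg.
    by rewrite scaler0 addr0 mul1r; lra.
  by rewrite (z _ (test_L2 tphi)) (z _ (test_L2 (test_partial j tphi))) oppr0.
move=> a u v Hu Hv; split; first exact: L2_plane_subspace.2 (L2_H1 Hu) (L2_H1 Hv).
move=> j; exists (a *: wderiv j u + wderiv j v).
by apply: wpartialDZ; [exact: L2_H1|exact: L2_H1|exact: wderivP|exact: wderivP].
Qed.

Lemma wderivDZ j a u v : H1 u -> H1 v ->
  wderiv j (a *: u + v) = a *: wderiv j u + wderiv j v %[ae mu].
Proof.
move=> Hu Hv; apply: (@wpartial_unique j (a *: u + v)).
  by apply: wderivP; exact: H1_subspace.2.
by apply: wpartialDZ; [exact: L2_H1|exact: L2_H1|exact: wderivP|exact: wderivP].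
Qed.

Lemma dot_wderivDZ j a u v w : H1 u -> H1 v -> H1 w ->
  dot mu (wderiv j (a *: u + v)) (wderiv j w) =
  a * dot mu (wderiv j u) (wderiv j w) + dot mu (wderiv j v) (wderiv j w).
Proof.
move=> Hu Hv Hw; have [lB _ _] := dot_plane_semi_dot.
have [Lu [Lv Lw]] := (wderiv_L2 j Hu, (wderiv_L2 j Hv, wderiv_L2 j Hw)).
rewrite -(lB a _ _ _ Lu Lv Lw).
have L1 := wderiv_L2 j (H1_subspace.2 a _ _ Hu Hv).
have Er : wderiv j w = wderiv j w %[ae mu] by exact: nearW.
exact: (dot_ae L1 Lw (L2_plane_subspace.2 a _ _ Lu Lv) Lw (wderivDZ j a Hu Hv) Er).
Qed.

Lemma grad_semi_dot : semi_dot H1 grad_dot.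
Proof.
split=> [a u v w Hu Hv Hw|u v _ _|u _].
- rewrite /grad_dot (dot_wderivDZ false a Hu Hv Hw) (dot_wderivDZ true a Hu Hv Hw).
  by rewrite mulrDr addrACA.
- by rewrite /grad_dot ![dot mu (wderiv _ u) _]dotC.
- exact: addr_ge0 (dot_ge0 _ _) (dot_ge0 _ _).
Qed.

Lemma h1_semi_dot : semi_dot H1 h1_dot.
Proof.
have [l1 c1 p1] := dot_plane_semi_dot; have [l2 c2 p2] := grad_semi_dot.
split=> [a u v w Hu Hv Hw|u v Hu Hv|u Hu]; rewrite /h1_dot.
- rewrite (l1 a _ _ _ (L2_H1 Hu) (L2_H1 Hv) (L2_H1 Hw)) (l2 a _ _ _ Hu Hv Hw).
  by rewrite addrACA -mulrDr.
- by rewrite (c1 _ _ (L2_H1 Hu) (L2_H1 Hv)) (c2 _ _ Hu Hv).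
- exact: addr_ge0 (dot_ge0 _ _) (p2 _ Hu).
Qed.

Lemma dot_le_h1 u : H1 u -> dot mu u u <= h1_dot u u.
Proof. by move=> Hu; rewrite lerDl; have [_ _] := grad_semi_dot; apply. Qed.

Lemma dot_wderiv_le_h1 j u : dot mu (wderiv j u) (wderiv j u) <= h1_dot u u.
Proof.
rewrite /h1_dot /grad_dot; have := dot_ge0 mu u.
have := dot_ge0 mu (wderiv false u); have := dot_ge0 mu (wderiv true u).
by case: j => *; lra.
Qed.

Lemma dot_wderivB j u v : H1 u -> H1 v ->
  dot mu (wderiv j u - wderiv j v) (wderiv j u - wderiv j v) =
  dot mu (wderiv j (u - v)) (wderiv j (u - v)).
Proof.
move=> Hu Hv; have Huv := subspaceB H1_subspace Hu Hv.
have L := subspaceB L2_plane_subspace (wderiv_L2 j Hu) (wderiv_L2 j Hv).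
have L' := wderiv_L2 j Huv.
have E : wderiv j u - wderiv j v = wderiv j (u - v) %[ae mu].
  have := @wderivDZ j (-1) v u Hv Hu.
  rewrite !scaleN1r [- v + _]addrC [- wderiv _ _ + _]addrC.
  by apply: filterS => x /= /[apply] ->.
exact: (dot_ae L L L' L' E E).
Qed.

(** The functions and their weak derivatives converge separately in L^2, and the identity defining a
    weak derivative is stable under such limits. *)
Lemma h1_complete : dot_complete H1 h1_dot.
Proof.
move=> u Hu Cu.
have Lu n := L2_H1 (Hu n).
have Ld j n := wderiv_L2 j (Hu n).
have [e e0|l Ll lP] := @L2_complete _ _ R mu u Lu.
  have [N NP] := Cu e e0; exists N => n m Nn Nm; apply: le_trans (NP n m Nn Nm).
  by apply: dot_le_h1; exact: subspaceB H1_subspace (Hu n) (Hu m).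
have gP j : exists2 g, L2 mu g & forall e : R, 0 < e -> exists N, forall n, (N <= n)%N ->
    dot mu (wderiv j (u n) - g) (wderiv j (u n) - g) <= e.
  apply: (@L2_complete _ _ R mu (fun n => wderiv j (u n)) (Ld j)) => e e0.
  have [N NP] := Cu e e0; exists N => n m Nn Nm; apply: le_trans (NP n m Nn Nm).
  by rewrite dot_wderivB//; exact: dot_wderiv_le_h1.
have wg j g : L2 mu g -> (forall e : R, 0 < e -> exists N, forall n, (N <= n)%N ->
    dot mu (wderiv j (u n) - g) (wderiv j (u n) - g) <= e) -> wpartial j l g.
  move=> Lg gc; split=> // phi tphi; have [lB cB _] := dot_plane_semi_dot.
  have Lp := test_L2 tphi; have Lpp := test_L2 (test_partial j tphi).
  apply/eqP; rewrite -addr_eq0 -sqrf_eq0 eq_le sqr_ge0 andbT.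
  apply/ler_addgt0Pl => e e0; rewrite addr0.
  pose A := dot mu phi phi; pose B := dot mu (partial j phi) (partial j phi).
  have A0 : 0 <= A := dot_ge0 _ _; have B0 : 0 <= B := dot_ge0 _ _.
  (* The sum [dot l (partial j phi) + dot g phi] is split at the [n]-th term of the sequence; by
     Cauchy-Schwarz its square is at most [2 c (A + B)], where [c] is this constant, hence at most
     [e]. *)
  have e'0 : 0 < e / (2 * (A + B + 1)) by rewrite divr_gt0// mulr_gt0//; lra.
  have [N1 P1] := lP _ e'0; have [N2 P2] := gc _ e'0.
  pose n := maxn N1 N2.
  have Q1 := P1 n (leq_maxl _ _); have Q2 := P2 n (leq_maxr _ _).
  have [_ /(_ _ tphi) wn] := wderivP j (Hu n).
  have Lun := subspaceB L2_plane_subspace (Lu n) Ll.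
  have Lgn := subspaceB L2_plane_subspace (Ld j n) Lg.
  have K1 := dot_cauchy_schwarz L2_plane_subspace dot_plane_semi_dot Lun Lpp.
  have K2 := dot_cauchy_schwarz L2_plane_subspace dot_plane_semi_dot Lgn Lp.
  have E1 : dot mu (u n - l) (partial j phi) = dot mu (u n) (partial j phi) - dot mu l (partial j phi).
    by rewrite addrC -scaleN1r lB//; ring.
  have E2 : dot mu (wderiv j (u n) - g) phi = dot mu (wderiv j (u n)) phi - dot mu g phi.
    by rewrite addrC -scaleN1r lB//; ring.
  move: K1 K2; rewrite E1 E2 wn; set a := dot mu (wderiv j (u n)) phi.
  rewrite -/A -/B; move: (dot mu l _) (dot mu g _) (dot mu (_ - l) _) (dot mu (_ - g) _) Q1 Q2.
  move=> x y q r Q1 Q2 K1 K2.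
  have h1 : q * B <= e / (2 * (A + B + 1)) * B by rewrite ler_wpM2r.
  have h2 : r * A <= e / (2 * (A + B + 1)) * A by rewrite ler_wpM2r.
  have h3 : e / (2 * (A + B + 1)) * (A + B) <= e / 2.
    have -> : e / (2 * (A + B + 1)) * (A + B) = e / 2 * ((A + B) / (A + B + 1)).
      by field; lra.
    by rewrite ler_piMr// ?ler_pdivrMr; lra.
  have := sqr_ge0 ((- a - x) - (a - y)).
  move: h1 h2 h3 K1 K2; move: (e / (2 * _)) => c h1 h2 h3 K1 K2.
  clear -h1 h2 h3 K1 K2; clearbody a A B; lra.
have [gf Lgf gfP] := gP false; have [gt Lgt gtP] := gP true.
have wf := wg _ _ Lgf gfP; have wt := wg _ _ Lgt gtP.
have Hl : H1 l by split=> // -[]; [exists gt|exists gf].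
exists l => // e e0.
have e3 : 0 < e / 3 by rewrite divr_gt0.
have [N1 P1] := lP _ e3; have [N2 P2] := gfP _ e3; have [N3 P3] := gtP _ e3.
exists (maxn N1 (maxn N2 N3)) => n; rewrite !geq_max => /and3P[n1 n2 n3].
rewrite /h1_dot /grad_dot -!dot_wderivB//.
have R1 : dot mu (wderiv false (u n) - wderiv false l) (wderiv false (u n) - wderiv false l) <= e / 3.
  rewrite [leLHS](_ : _ = dot mu (wderiv false (u n) - gf) (wderiv false (u n) - gf)); first exact: P2.
  have E : wderiv false (u n) - wderiv false l = wderiv false (u n) - gf %[ae mu].
    have := wpartial_unique (wderivP false Hl) wf.
    by apply: filterS => x /= /[apply]; rewrite !fctE => ->.
  have M1 := subspaceB L2_plane_subspace (Ld false n) (wderiv_L2 false Hl).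
  have M2 := subspaceB L2_plane_subspace (Ld false n) Lgf.
  exact: (dot_ae M1 M1 M2 M2 E E).
have R2 : dot mu (wderiv true (u n) - wderiv true l) (wderiv true (u n) - wderiv true l) <= e / 3.
  rewrite [leLHS](_ : _ = dot mu (wderiv true (u n) - gt) (wderiv true (u n) - gt)); first exact: P3.
  have E : wderiv true (u n) - wderiv true l = wderiv true (u n) - gt %[ae mu].
    have := wpartial_unique (wderivP true Hl) wt.
    by apply: filterS => x /= /[apply]; rewrite !fctE => ->.
  have M1 := subspaceB L2_plane_subspace (Ld true n) (wderiv_L2 true Hl).
  have M2 := subspaceB L2_plane_subspace (Ld true n) Lgt.
  exact: (dot_ae M1 M1 M2 M2 E E).
by have := P1 _ n1; lra.
Qed.

Lemma test_wpartial j phi : test_function phi -> wpartial j phi (partial j phi).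
Proof.
move=> tphi; split; first exact/test_L2/test_partial.
by move=> psi tpsi; rewrite !dot_Rintegral integral_by_parts//; exact: test_smooth.
Qed.

Lemma test_H1 phi : test_function phi -> H1 phi.
Proof.
move=> tphi; split; first exact: test_L2.
by move=> j; exists (partial j phi); exact: test_wpartial.
Qed.

Lemma wderiv_test j phi : test_function phi -> wderiv j phi = partial j phi %[ae mu].
Proof.
move=> tphi; apply: (@wpartial_unique j phi); first exact/wderivP/test_H1.
exact: test_wpartial.
Qed.

End H1_real.

(** * Density of the test functions *)

Section convolution.
Context {R : realType}.
Local Notation plane := (R * R)%type.
Local Notation mu := (@lebesgue2 R).
Implicit Types (phi psi rho f g u v w : plane -> R) (x y h : plane).

Lemma dot_vanishes_le r f (M : R) : measurable_fun [set: pl R] f ->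
  (forall x, `|f x| <= M) -> vanishes_off r f -> dot mu f f <= M ^+ 2 * box_area r.
Proof.
move=> mf fM rf; rewrite -lee_fin dotE; last exact: vanishes_L2 mf fM rf.
have h := @vanishes_integral_le R r (fun x => f x ^+ 2) (M ^+ 2).
apply: le_trans (h _ _ _ _).
- rewrite le_eqVlt; apply/orP; left; apply/eqP/eq_integral => x _.
  by rewrite gee0_abs// lee_fin sqr_ge0.
- exact: measurable_funX.
- exact: sqr_ge0.
- by move=> x; rewrite normrX lerXn2r ?nnegrE// (le_trans _ (fM x)).
- by move=> x /rf ->; rewrite expr0n.
Qed.

Lemma dot_translate h f : measurable_fun [set: pl R] f ->
  dot mu (fun y => f (y + h)) (fun y => f (y + h)) = dot mu f f.
Proof.
move=> mf; rewrite !dot_Rintegral.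
by rewrite (Rintegral_shift2 h (measurable_funM mf mf)).
Qed.

(** A correlation rather than a convolution: its value at 0 is [dot mu rho w], and a derivative in
    [x] falls on [rho] with a minus sign, which the definition of the weak derivative of [w]
    absorbs. *)
Definition cconv rho w x : R := dot mu (fun y => rho (y - x)) w.

(** Cauchy-Schwarz and translation invariance give a bound uniform in [x], which turns pointwise
    estimates of [rho] into estimates of [cconv]. *)
Lemma cconv_bound (C : R) w : L2 mu w -> exists2 K, 0 <= K & forall r (c : R) g x,
  r <= C -> 0 <= c -> measurable_fun [set: pl R] g -> (forall y, `|g y| <= c) ->
  vanishes_off r g -> `|dot mu (fun y => g (y - x)) w| <= c * K.
Proof.
move=> Lw; set W := dot mu w w; pose A := box_area C.
have W0 : 0 <= W := dot_ge0 _ _.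
have A0 : 0 <= A by rewrite fine_ge0.
(* Cauchy-Schwarz bounds the square by [c ^+ 2 * (A * W)]; [A * W + 1] dominates the square root of
   [A * W]. *)
exists (A * W + 1); first by rewrite addr_ge0// mulr_ge0.
move=> r c g x rC c0 mg gc rg.
have Cg : vanishes_off C g by move=> y Cy; apply: rg; exact: le_lt_trans rC Cy.
have Lg := vanishes_L2 mg gc Cg.
have Lgx : L2 mu (fun y => g (y - x)).
  split; first exact: measurableT_comp mg (measurable_translate (- x)).
  have -> : (\int[mu]_y (g (y - x) ^+ 2)%:E = \int[mu]_y (g y ^+ 2)%:E)%E.
    apply: (@integral_shift2 _ (- x) (fun y => (g y ^+ 2)%:E)).
      exact: measurable_sqr.
    by move=> y; rewrite lee_fin sqr_ge0.
  by case: Lg.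
have := dot_cauchy_schwarz L2_plane_subspace dot_plane_semi_dot Lgx Lw.
rewrite (dot_translate (- x) mg) -/W.
have := dot_vanishes_le mg gc Cg; rewrite -/A.
move: (dot mu g g) (dot mu _ w) => a b h1 h2.
have h3 : b ^+ 2 <= c ^+ 2 * (A * W).
  by apply: le_trans h2 _; rewrite mulrA ler_wpM2r.
have k0 : 0 <= A * W by rewrite mulr_ge0.
have : b ^+ 2 <= (c * (A * W + 1)) ^+ 2.
  apply: le_trans h3 _; rewrite exprMn ler_wpM2l ?sqr_ge0//.
  by move: k0; move: (A * W) => k k0; nra.
rewrite -ler_sqrt ?sqr_ge0// !sqrtr_sqr [X in _ <= X]ger0_norm//.
by rewrite mulr_ge0// addr_ge0.
Qed.

Lemma translate_L2 x f : L2 mu f -> L2 mu (fun y => f (y - x)).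
Proof.
move=> [mf fi]; split; first exact: measurableT_comp mf (measurable_translate (- x)).
have -> : (\int[mu]_y (f (y - x) ^+ 2)%:E = \int[mu]_y (f y ^+ 2)%:E)%E => //.
apply: (@integral_shift2 _ (- x) (fun y => (f y ^+ 2)%:E)).
  exact: measurable_sqr.
by move=> y; rewrite lee_fin sqr_ge0.
Qed.

Lemma cconvB rho1 rho2 w x : L2 mu w -> L2 mu rho1 -> L2 mu rho2 ->
  dot mu (fun y => rho1 (y - x) - rho2 (y - x)) w = cconv rho1 w x - cconv rho2 w x.
Proof.
move=> Lw L1 L2'; have [lB _ _] := @dot_plane_semi_dot R.
have := lB (-1) _ _ _ (translate_L2 x L2') (translate_L2 x L1) Lw.
rewrite mulN1r [- _ + _]addrC => E; rewrite /cconv -[RHS]E; congr dot; apply/funext => y.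
by rewrite !fctE scaleN1r addrC.
Qed.

Lemma cconv_continuous rho w : test_function rho -> L2 mu w ->
  continuous (cconv rho w).
Proof.
move=> trho Lw x; have [C C0 CP] := test_lipschitz trho.
have /test_functionP[srho [r rrho]] := trho.
have [K K0 KP] := cconv_bound (r + 1) Lw.
have key h : `|h| <= 1 -> `|cconv rho w (x + h) - cconv rho w x| <= C * `|h| * K.
  move=> h1; pose g y := rho (y - h) - rho y.
  have tg : test_function (fun y => rho (y - h)) := test_translate (- h) trho.
  have -> : cconv rho w (x + h) - cconv rho w x = dot mu (fun y => g (y - x)) w.
    rewrite (cconvB x Lw (test_L2 tg) (test_L2 trho)); congr (_ - _).
    by rewrite /cconv; congr dot; apply/funext => y; rewrite opprD addrA.
  apply: (KP (r + 1)) => //.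
  - by rewrite mulr_ge0// ltW.
  - exact: measurable_funB (test_measurable tg) (test_measurable trho).
  - move=> y; rewrite /g; apply: le_trans (CP _ _) _.
    by rewrite [y - h]addrC addrK normrN.
  - move=> y ry; rewrite /g !rrho ?subrr//; first lra.
    have := lerB_normD y (- h); rewrite normrN.
    by move: h1 ry; move: `|h| `|y| `|_ - _| => *; lra.
apply/cvgrPdist_le => e e0.
have CK : 0 < C * K + 1 by rewrite ltr_wpDl// mulr_ge0// ltW.
have m0 : 0 < Num.min 1 (e / (C * K + 1)) by rewrite lt_min ltr01 divr_gt0.
near=> y.
have : `|x - y| <= Num.min 1 (e / (C * K + 1)).
  by near: y; apply: cvgr_dist_le => //; exact: cvg_id.
rewrite le_min => /andP[xy1 xye].
have := key (y - x); rewrite [x + _]addrC subrK => {}key.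
rewrite distrC; apply: le_trans (key _) _; first by rewrite distrC.
move: xye; rewrite ler_pdivlMr// distrC => h; apply: le_trans h.
rewrite mulrAC mulrC ler_wpM2l//.
by rewrite lerDl.
Unshelve. all: by end_near. Qed.

(** Taylor's remainder for [rho] is of second order uniformly, and for steps of length at most 1 its
    support stays in the box of radius [r + 1], so [cconv_bound] applies with one constant. *)
Lemma is_derive_cconv rho w j x : test_function rho -> L2 mu w ->
  is_derive x (unit_vector j) (cconv rho w) (- cconv (partial j rho) w x).
Proof.
move=> trho Lw; have [C C0 CP] := test_taylor trho.
have /test_functionP[srho [r rrho]] := trho.
have [K K0 KP] := cconv_bound (r + 1) Lw.
have tp := test_partial j trho.
apply: (@is_derive_sqr _ _ _ _ _ _ (C * K)) => t t1.
pose e := @unit_vector R j.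
have tg : test_function (fun y => rho (y - t *: e)) := test_translate (- (t *: e)) trho.
pose g y := rho (y - t *: e) - (rho y - t * partial j rho y).
have -> : cconv rho w (x + t *: e) - cconv rho w x - t * - cconv (partial j rho) w x =
    dot mu (fun y => g (y - x)) w.
  have Lt : L2 mu (fun y => rho y - t * partial j rho y).
    have := L2_plane_subspace.2 (- t) _ _ (test_L2 tp) (test_L2 trho).
    by congr (L2 mu _); apply/funext => y; rewrite !fctE /GRing.scale/=; ring.
  rewrite (cconvB x Lw (test_L2 tg) Lt) -addrA; congr (_ + _).
    by rewrite /cconv; congr dot; apply/funext => y; rewrite opprD addrA.
  have [lB _ _] := @dot_plane_semi_dot R.
  rewrite -opprD; congr (- _).
  have := lB (- t) _ _ _ (translate_L2 x (test_L2 tp)) (translate_L2 x (test_L2 trho)) Lw.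
  move=> E; rewrite /cconv mulrN -mulNr addrC -E; congr dot; apply/funext => y.
  by rewrite !fctE /GRing.scale/=; ring.
rewrite -mulrAC; apply: (KP (r + 1)) => //.
- by rewrite mulr_ge0 ?sqr_ge0// ltW.
- apply: measurable_funB (test_measurable tg) _.
  apply: measurable_funB (test_measurable trho) _.
  by apply: measurable_funM => //; exact: test_measurable.
- move=> y; have := CP y (- (t *: e)); rewrite normrN norm_unit_vector real_normK ?num_real//.
  congr (`|_| <= _); rewrite /g /e /unit_vector; case: (j) => /=;
    by rewrite /GRing.scale/= mulr1 mulr0 oppr0 mul0r ?addr0 ?add0r; ring.
- move=> y ry; rewrite /g; have h : r < `|y - t *: e|.
    have := lerB_normD y (- (t *: e)); rewrite normrN norm_unit_vector.
    by move: t1 ry; move: `|t| `|y| `|_ - _| => *; lra.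
  rewrite (rrho _ h) rrho ?(vanishes_off_partial _ rrho) ?mulr0 ?subrr//; lra.
Qed.

Lemma partial_cconv rho w j : test_function rho -> L2 mu w ->
  partial j (cconv rho w) = - cconv (partial j rho) w.
Proof.
by move=> trho Lw; apply/funext => x; have [_] := is_derive_cconv j x trho Lw.
Qed.

Lemma test_opp rho : test_function rho -> test_function (- rho).
Proof. by move=> t; rewrite -scaleN1r; exact: subspaceZ _ test_subspace t. Qed.

Lemma cconvN rho w : L2 mu w -> L2 mu rho -> - cconv rho w = cconv (- rho) w.
Proof.
move=> Lw Lr; apply/funext => x; have := cconvB x Lw (L20 _) Lr.
rewrite /cconv !fctE => h.
have z : dot mu (fun=> 0) w = 0.
  by rewrite dot_Rintegral; under eq_Rintegral do rewrite mul0r; rewrite /Rintegral integral0.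
move: h; rewrite /= z sub0r => <-; congr dot.
by apply/funext => y; rewrite sub0r.
Qed.

Lemma cconv_smooth rho w : test_function rho -> L2 mu w -> smooth (cconv rho w).
Proof.
move=> trho Lw; apply: (@smooth_coind _
  (fun f => exists2 r, test_function r & f = cconv r w)); last by exists rho.
- move=> _ [r tr ->]; split; first exact: cconv_continuous.
  by move=> j x; have [] := is_derive_cconv j x tr Lw.
- move=> _ j [r tr ->]; exists (- partial j r); first exact/test_opp/test_partial.
  by rewrite partial_cconv// cconvN//; exact/test_L2/test_partial.
Qed.

Lemma measurable_sub2 :
  measurable_fun [set: pl R * pl R] (fun z : pl R * pl R => (z.2 - z.1)%R : pl R).
Proof.
have m1 := @measurable_fst _ _ (pl R) (pl R); have m2 := @measurable_snd _ _ (pl R) (pl R).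
apply: measurable_fun_pair.
  exact: measurable_funB (measurableT_comp measurable_fst m2) (measurableT_comp measurable_fst m1).
exact: measurable_funB (measurableT_comp measurable_snd m2) (measurableT_comp measurable_snd m1).
Qed.

Lemma fubini_lebesgue2 (F : pl R * pl R -> \bar R) :
  measurable_fun [set: pl R * pl R] F -> (forall z, 0 <= F z)%E ->
  (\int[mu]_x \int[mu]_y F (x, y) = \int[mu]_y \int[mu]_x F (x, y))%E.
Proof.
move=> mF F0.
have := @fubini_tonelli _ _ _ _ _ (@leb2 R) (@leb2 R) F mF F0.
by [].
Qed.

(** As [rho] vanishes off a box, Cauchy-Schwarz bounds the square at [x] by a constant times the
    integral of [w ^+ 2] over the box around [x]; Tonelli integrates this in [x]. *)
Lemma cconv_L2 rho w : test_function rho -> L2 mu w -> L2 mu (cconv rho w).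
Proof.
move=> trho Lw; have /test_functionP[srho [r rrho]] := trho.
split; first by apply: continuous_measurable2; exact: cconv_continuous.
pose k y : R := \1_(box r) y; pose P := dot mu rho rho.
have mk : measurable_fun [set: pl R] k by apply: measurable_indic; exact: measurable_box.
have mw := L2_measurable Lw.
pose F (z : pl R * pl R) := (P * (k (z.2 - z.1) * w z.2 ^+ 2))%:E.
have mF : measurable_fun [set: pl R * pl R] F.
  apply/measurable_EFinP; apply: measurable_funM => //; apply: measurable_funM.
    exact: measurableT_comp mk measurable_sub2.
  by apply: measurable_funX; exact: measurableT_comp mw measurable_snd.
have P0 : 0 <= P := dot_ge0 _ _.
have k0 y : 0 <= k y by rewrite /k indicE.
have F0 z : (0 <= F z)%E.
  rewrite lee_fin; apply: mulr_ge0 => //.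
  by apply: mulr_ge0; [exact: k0|exact: sqr_ge0].
have step x : ((cconv rho w x ^+ 2)%:E <= \int[mu]_y F (x, y))%E.
  pose g y := k (y - x) * w y.
  have mkx : measurable_fun [set: pl R] (fun y => k (y - x)).
    exact: measurableT_comp mk (measurable_translate (- x)).
  have kk y : k y ^+ 2 = k y.
    by rewrite /k indicE; case: (_ \in _); rewrite ?expr1n ?expr0n.
  have Lg : L2 mu g.
    split; first exact: measurable_funM.
    apply: le_lt_trans Lw.2; apply: ge0_le_integral => //.
    - by move=> y _; rewrite lee_fin sqr_ge0.
    - by apply: measurable_sqr; exact: measurable_funM.
    - exact: measurable_sqr.
    - move=> y _; rewrite lee_fin /g exprMn kk ler_piMl ?sqr_ge0//.
      by rewrite /k indicE; case: (_ \in _).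
  have E : cconv rho w x = dot mu (fun y => rho (y - x)) g.
    rewrite /cconv !dot_Rintegral; apply: eq_Rintegral => y _; rewrite /g /k indicE.
    case: (boolP (_ \in _)) => [_|/negP ny]; first by rewrite mul1r.
     rewrite rrho ?mul0r// ltNge; apply/negP => h; apply: ny.
    by apply/mem_set/in_box.
  have := dot_cauchy_schwarz L2_plane_subspace dot_plane_semi_dot
     (translate_L2 x (test_L2 trho)) Lg.
  rewrite -E (dot_translate (- x) (test_measurable trho)) -/P -lee_fin => /le_trans; apply.
  rewrite EFinM (dotE Lg) -ge0_integralZl_EFin//.
  - rewrite le_eqVlt; apply/orP; left; apply/eqP/eq_integral => y _.
    by rewrite /F /g /= -EFinM exprMn kk.
  - by move=> y _; rewrite lee_fin sqr_ge0.
  - by apply: measurable_sqr; exact: measurable_funM.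
apply: (@le_lt_trans _ _ (\int[mu]_x \int[mu]_y F (x, y))%E).
  apply: ge0_le_integral => //.
  - by move=> x _; rewrite lee_fin sqr_ge0.
  - by apply: measurable_sqr; apply: continuous_measurable2; exact: cconv_continuous.
  - by have := @measurable_fun_fubini_tonelli_F _ _ _ _ _ (@leb2 R) F mF F0.
rewrite fubini_lebesgue2//.
have EF y : (\int[mu]_x F (x, y) = (P * box_area r)%:E * (w y ^+ 2)%:E)%E.
  have kE x : F (x, y) = ((P * w y ^+ 2)%:E * (k (x - y))%:E)%E.
    have ks : k (y - x) = k (x - y).
      rewrite /k !indicE; congr (nat_of_bool _)%:R.
      by apply/idP/idP => /set_mem/in_box h; apply/mem_set/in_box; rewrite distrC.
    by rewrite /F /= ks -EFinM; congr (_%:E); ring.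
  under eq_integral do rewrite kE.
  rewrite ge0_integralZl_EFin//; last 3 first.
  - by move=> x _; rewrite lee_fin; exact: k0.
  - apply/measurable_EFinP; exact: measurableT_comp mk (measurable_translate (- y)).
  - by rewrite mulr_ge0 ?sqr_ge0.
  rewrite (@integral_shift2 _ (- y) (fun x => (k x)%:E)); last 2 first.
  - exact/measurable_EFinP.
  - by move=> z; rewrite lee_fin.
  rewrite integral_indic//; last exact: measurable_box.
  by rewrite setIT -box_areaE -!EFinM; congr (_%:E); ring.
under eq_integral do rewrite EF.
rewrite ge0_integralZl_EFin//.
- by rewrite lte_mul_pinfty// ?lee_fin ?mulr_ge0// ?fine_ge0//; exact: Lw.2.
- by move=> y _; rewrite lee_fin sqr_ge0.
- exact: measurable_sqr.
- by rewrite mulr_ge0// fine_ge0.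
Qed.

End convolution.

Section density.
Context {R : realType}.
Local Notation plane := (R * R)%type.
Local Notation mu := (@lebesgue2 R).
Implicit Types (phi psi rho chi f g u v w : plane -> R) (x y h : plane).

Lemma cconv_wpartial j rho u w x : test_function rho -> L2 mu u -> wpartial j u w ->
  partial j (cconv rho u) x = cconv rho w x.
Proof.
move=> trho Lu [Lw wP]; rewrite partial_cconv// !fctE /cconv.
have E : (fun y => partial j rho (y - x)) = partial j (fun y => rho (y - x)).
  have := @partial_affine R 1 (- x) rho j (test_smooth trho).
  under eq_fun do rewrite scale1r.
  by move=> ->; apply/funext => y; rewrite mul1r scale1r.
rewrite E (dotC mu _ u) wP ?opprK 1?dotC//.
exact: (test_translate (- x) trho).
Qed.

Lemma test_energy chi v (z : bool -> plane -> R) : test_function chi ->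
  smooth v -> (forall j, smooth (z j)) ->
  test_function (fun x => chi x * (v x ^+ 2 + z false x ^+ 2 + z true x ^+ 2)).
Proof.
move=> tchi sv sz.
exact: (testM tchi (smoothD (smoothD (smoothM sv sv) (smoothM (sz false) (sz false)))
    (smoothM (sz true) (sz true)))).
Qed.

Lemma test_flux chi v (z : bool -> plane -> R) : test_function chi ->
  smooth v -> (forall j, smooth (z j)) ->
  test_function (fun x =>
    v x * (partial false chi x * z false x + partial true chi x * z true x)).
Proof.
move=> tchi sv sz; have := subspaceD test_subspace
  (testM (test_partial false tchi) (smoothM sv (sz false)))
  (testM (test_partial true tchi) (smoothM sv (sz true))).
congr test_function; apply/funext => x; rewrite !fctE.
by rewrite mulrDr !(mulrCA (v x)).
Qed.

(* Caccioppoli: [v] and [z] solve [v = div z], [z = grad v], so testing with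
   [chi * v] leaves only the term with the gradient of [chi]. *)
Lemma energy_identity chi v (z : bool -> plane -> R) : test_function chi ->
  smooth v -> (forall j, smooth (z j)) ->
  (forall j, partial j v = z j) ->
  (forall x, v x = partial false (z false) x + partial true (z true) x) ->
  \int[mu]_x (chi x * (v x ^+ 2 + z false x ^+ 2 + z true x ^+ 2)) =
  - \int[mu]_x (v x * (partial false chi x * z false x + partial true chi x * z true x)).
Proof.
move=> tchi sv sz dv div.
have schi := test_smooth tchi.
pose P j := partial j (chi * (v * z j)).
have tM j : test_function (chi * (v * z j)) by exact: (testM tchi (smoothM sv (sz j))).
have PE j x : P j x = chi x * (v x * partial j (z j) x + z j x ^+ 2)
    + v x * z j x * partial j chi x.
  rewrite /P (partialM j schi (smoothM sv (sz j))) (partialM j sv (sz j)) dv.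
  by rewrite !fctE; ring.
have tP j : test_function (P j) by exact: test_partial.
have I0 : \int[mu]_x (P false x + P true x) = 0.
  have := RintegralD measurableT (test_integrable (tP false)) (test_integrable (tP true)).
  by rewrite /P !(integral_partial _ (tM _)) addr0.
pose A : plane -> R := fun x => chi x * (v x ^+ 2 + z false x ^+ 2 + z true x ^+ 2).
pose B : plane -> R := fun x => v x * (partial false chi x * z false x + partial true chi x * z true x).
have tA : test_function A by exact: test_energy.
have tB : test_function B by exact: test_flux.
have := RintegralD measurableT (test_integrable tA) (test_integrable tB).
rewrite (_ : \int[mu]_x (A x + B x) = 0); last first.
  rewrite -I0; apply: eq_Rintegral => x _.
  rewrite !PE /A /B.
  have -> : partial true (z true) x = v x - partial false (z false) x.
    by rewrite div; ring.
  by ring.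
by rewrite -/A -/B => /esym/eqP; rewrite addr_eq0 => /eqP.
Qed.

Lemma box_measure_gt0 (r : R) : 0 < r -> 0 < box_area r.
Proof.
move=> r0; rewrite -lte_fin box_areaE lebesgue2X; [|exact: measurable_itv..].
rewrite lebesgue_measure_itv/= lte_fin; rewrite ifT; last by lra.
by rewrite -EFinB -EFinM lte_fin mulr_gt0//; lra.
Qed.

Lemma continuous_ae0 v : continuous v -> v = cst 0 %[ae mu] -> v 0 = 0.
Proof.
move=> cv v0; apply/eqP; apply: contrapT => /negP vn0.
have : \forall x \near (0 : plane), v x != 0.
  have := @open_nbhs_nbhs _ (0 : plane) [set x | v x != 0]; apply; split=> //.
  apply: (@open_comp _ _ v [set y | y != 0]); first by move=> x _; exact: cv.
  exact: open_neq.
move=> /nbhs_ballP[e /= e0 ev].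
have [N [mN N0 NP]] := v0.
have sub : box (e / 2) `<=` N.
  move=> x /in_box xe; apply: NP => /= /(_ I) vx.
  have : ball 0 e x.
    rewrite -ball_normE /ball_/= sub0r normrN; apply: le_lt_trans xe _; lra.
  by move=> /ev; rewrite vx eqxx.
have : (mu (box (e / 2)) <= mu N)%E.
  by apply: le_measure sub; rewrite inE//; exact: measurable_box.
rewrite [X in (_ <= X)%E](N0 : _ = 0%E) leNgt => /negP; apply.
by rewrite -box_areaE lte_fin box_measure_gt0// divr_gt0.
Qed.

Lemma cvg_scale0 x : (fun n : nat => n.+1%:R^-1 *: x + 0) @ \oo --> (0 : plane).
Proof.
have h : (fun n : nat => n.+1%:R^-1 *: x + 0) @ \oo --> 0 *: x + 0.
  by apply: cvgD; [apply: cvgZr_tmp; exact: cvg_harmonic|exact: cvg_cst].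
by rewrite scale0r addr0 in h.
Qed.

(** Here [u] is a weak solution of [- Delta u + u = 0]. Its regularizations [v] are smooth, square
    integrable and solve the equation classically, so [energy_identity] with ever wider cut-offs
    forces [v = 0]. As [v 0 = dot mu rho u], the function [u] is orthogonal to all test
    functions. *)
Lemma weak_solution_eq0 u : H1 u ->
  (forall phi, test_function phi -> h1_dot u phi = 0) -> h1_dot u u = 0.
Proof.
move=> Hu u0.
pose w j := wderiv j u.
have Lu := L2_H1 Hu; have Lw j : L2 mu (w j) := wderiv_L2 j Hu.
have orth rho : test_function rho -> dot mu rho u = 0.
  move=> trho.
  pose v := cconv rho u; pose z j := cconv rho (w j).
  have sv : smooth v by exact: cconv_smooth.
  have sz j : smooth (z j) by exact: cconv_smooth.
  have dv j : partial j v = z j.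
    by apply/funext => x; rewrite /v /z (cconv_wpartial x trho Lu (wderivP j Hu)).
  have Lv : L2 mu v by exact: cconv_L2.
  have Lz j : L2 mu (z j) by exact: cconv_L2.
  (* The weak equation tested with the translate of [rho] by [x]. *)
  have div x : v x = partial false (z false) x + partial true (z true) x.
    have tr := test_translate (- x) trho.
    have := u0 _ tr; rewrite /h1_dot /grad_dot (dotC mu u).
    have E j : dot mu (wderiv j u) (wderiv j (fun y => rho (y + - x))) =
        - partial j (z j) x.
      rewrite /z partial_cconv// !fctE opprK /cconv dotC.
      have E : wderiv j (fun y => rho (y + - x)) = (fun y => partial j rho (y - x)) %[ae mu].
        have := wderiv_test j tr.
        have := @partial_affine R 1 (- x) rho j (test_smooth trho).
        under eq_fun do rewrite scale1r.
        move=> ->; apply: filterS => y /= /[apply] ->.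
        by rewrite mul1r scale1r.
      have Er : w j = w j %[ae mu] by exact: nearW.
      exact: (dot_ae (wderiv_L2 j (test_H1 tr)) (Lw j)
        (translate_L2 x (test_L2 (test_partial j trho))) (Lw j) E Er).
    rewrite !E -opprD => /eqP; rewrite subr_eq0 => /eqP h.
    exact: h.
  pose B := box_bump (-1) 1 (-1) 1 1 : plane -> R.
  have tB : test_function B by exact: test_box_bump.
  have [M1 M10 M1P] := test_bounded (test_partial false tB).
  have [M2 M20 M2P] := test_bounded (test_partial true tB).
  (* Dilation makes the gradient of the cut-off of order [1 / (n + 1)] while [chi n] tends pointwise
     to the constant [B 0]. The summand 0 matches the form of [test_affine]. *)
  pose chi (n : nat) x := B (n.+1%:R^-1 *: x + 0).
  have tchi n : test_function (chi n) by apply: test_affine.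
  have dchi n j x : partial j (chi n) x = n.+1%:R^-1 * partial j B (n.+1%:R^-1 *: x + 0).
    by rewrite /chi (partial_affine _ _ _ (test_smooth tB)).
  pose K := (M1 + M2) * (dot mu v v + dot mu (z false) (z false) + dot mu (z true) (z true)).
  have est n : \int[mu]_x (chi n x * v x ^+ 2) <= n.+1%:R^-1 * K.
    have nn : 0 <= n.+1%:R^-1 :> R by [].
    have C0 y : 0 <= chi n y by rewrite /chi; have /andP[] := box_bump_itv (-1 : R) 1 (-1) 1 1 (n.+1%:R^-1 *: y + 0).
    have En := energy_identity (tchi n) sv sz dv div.
    have tA := test_energy (tchi n) sv sz.
    have tB' := test_flux (tchi n) sv sz.
    apply: (@le_trans _ _ (\int[mu]_x (chi n x * (v x ^+ 2 + z false x ^+ 2 + z true x ^+ 2)))).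
      apply: le_Rintegral => //.
      - exact: (test_integrable (testM (tchi n) (smoothM sv sv))).
      - exact: test_integrable.
      - move=> x _; rewrite ler_wpM2l//.
        by rewrite -addrA lerDl addr_ge0// sqr_ge0.
    rewrite En -mulN1r -RintegralZl//; last exact: test_integrable.
    have iS g : L2 mu g -> mu.-integrable setT (EFin \o (fun x => g x * g x)).
      by move=> Lg; exact: L2_integrableM.
    have iVZ : mu.-integrable setT (EFin \o (fun x => v x * v x + z false x * z false x)).
      exact: (integrableD measurableT (iS _ Lv) (iS _ (Lz false))).
    have iVZZ : mu.-integrable setT
        (EFin \o (fun x => v x * v x + z false x * z false x + z true x * z true x)).
      exact: (integrableD measurableT iVZ (iS _ (Lz true))).
    have -> : n.+1%:R^-1 * K = \int[mu]_x (n.+1%:R^-1 * (M1 + M2) *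
        (v x * v x + z false x * z false x + z true x * z true x)).
      rewrite RintegralZl// /K mulrA; congr (_ * _).
      rewrite !dot_Rintegral (RintegralD measurableT iVZ (iS _ (Lz true))).
      by rewrite (RintegralD measurableT (iS _ Lv) (iS _ (Lz false))).
    apply: le_Rintegral => //.
    - exact: (test_integrable (subspaceZ (-1) test_subspace tB')).
    - by have := integrableZl measurableT (n.+1%:R^-1 * (M1 + M2)) iVZZ.
    - move=> x _; rewrite !dchi.
      set y := _ *: x + 0; move: (M1P y) (M2P y).
      move: (partial false B y) (partial true B y) (v x) (z false x) (z true x).
      move: nn; move: (n.+1%:R^-1) => q q0 a b p r s ha hb.
      have h1 : `|a * p * r| <= M1 * (p ^+ 2 + r ^+ 2).
        rewrite -mulrA normrM; apply: ler_pM => //.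
        rewrite ler_norml; apply/andP; split.
          by have := sqr_ge0 (p + r); have := sqr_ge0 p; have := sqr_ge0 r; lra.
        by have := sqr_ge0 (p - r); have := sqr_ge0 p; have := sqr_ge0 r; lra.
      have h2 : `|b * p * s| <= M2 * (p ^+ 2 + s ^+ 2).
        rewrite -mulrA normrM; apply: ler_pM => //.
        rewrite ler_norml; apply/andP; split.
          by have := sqr_ge0 (p + s); have := sqr_ge0 p; have := sqr_ge0 s; lra.
        by have := sqr_ge0 (p - s); have := sqr_ge0 p; have := sqr_ge0 s; lra.
      have -> : -1 * (p * (q * a * r + q * b * s)) = q * (- (a * p * r) - b * p * s) by ring.
      rewrite -[leRHS]mulrA ler_wpM2l//.
      have := ler_norm (- (a * p * r)); have := ler_norm (- (b * p * s)).
      rewrite !normrN => k1 k2.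
      have : 0 <= M2 * r ^+ 2 by rewrite mulr_ge0 ?sqr_ge0// ltW.
      have : 0 <= M1 * s ^+ 2 by rewrite mulr_ge0 ?sqr_ge0// ltW.
      by lra.
  have v0 : v = cst 0 %[ae mu].
    (* The bump does not reach 1 at the origin, so the limit of the cut-off integrals is [B 0] times
       the squared norm of [v]; positivity of this factor suffices. *)
    have B0 : 0 < B 0.
      by rewrite /B /box_bump/= !mulr0 !add0r !mul1r !opprK /flat ltr01 expr0 mul1r !mulr_gt0 ?expR_gt0.
    apply: dot0_ae => //; apply/eqP; rewrite eq_le dot_ge0 andbT.
    rewrite -(pmulr_rle0 _ B0); apply/ler_addgt0Pl => e e0; rewrite addr0.
    have K0 : 0 <= K.
      by rewrite /K mulr_ge0 ?addr_ge0 ?dot_ge0 ?(ltW M10) ?(ltW M20).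
    have [N Ne] : exists N : nat, forall n, (N <= n)%N -> n.+1%:R^-1 * K <= e.
      have eK : 0 < e / (K + 1) by rewrite divr_gt0// ltr_wpDl.
      have [N] := ltr_add_invr eK; rewrite add0r => Ne; exists N => n Nn.
      have h : n.+1%:R^-1 <= e / (K + 1).
        by apply/ltW/(le_lt_trans _ Ne); rewrite lef_pV2 ?posrE// ler_nat.
      apply: le_trans (ler_wpM2r K0 h) _.
      rewrite mulrAC ler_pdivrMr ?ltr_wpDl//; rewrite ler_wpM2l ?ltW//; lra.
    rewrite -lee_fin EFinM dotE// -ge0_integralZl_EFin//; last 3 first.
    - by move=> x _; rewrite lee_fin sqr_ge0.
    - exact: (measurable_sqr (L2_measurable Lv)).
    - exact: ltW.
    apply: (@fatou_le _ _ _ mu (fun n x => chi n x * v x ^+ 2) (fun x => B 0 * v x ^+ 2) _ N).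
    - move=> n; apply: measurable_funM; first exact: (test_measurable (tchi n)).
      exact: (measurable_funX _ (L2_measurable Lv)).
    - move=> n x; apply: mulr_ge0; last exact: sqr_ge0.
      by have /andP[] := box_bump_itv (-1 : R) 1 (-1) 1 1 (n.+1%:R^-1 *: x + 0).
    - move=> x; apply: cvgM; last exact: cvg_cst.
      rewrite /chi; have cB := smooth_continuous (test_smooth tB).
      apply: (@cvg_comp _ _ _ (fun n : nat => n.+1%:R^-1 *: x + 0) B); last exact: cB.
      exact: cvg_scale0.
    - move=> n Nn; have ti := test_integrable (testM (tchi n) (smoothM sv sv)).
      apply: (@le_trans _ _ (\int[mu]_x (chi n x * v x ^+ 2))%:E).
        by rewrite /Rintegral fineK//; exact: (integrable_fin_num measurableT ti).
      by rewrite lee_fin (le_trans (est n))// Ne.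
  have := continuous_ae0 (smooth_continuous sv) v0; rewrite /v /cconv.
  by under eq_fun do rewrite subr0.
have uae : u = cst 0 %[ae mu].
  by apply: (du_bois_reymond Lu) => phi tphi; rewrite dotC orth.
have w0 j : w j = cst 0 %[ae mu].
  apply: (@wpartial_unique _ j u); first exact: wderivP.
  split; first exact: L20.
  move=> phi tphi; have Lp := test_L2 tphi; have Lpp := test_L2 (test_partial j tphi).
  rewrite dotC orth; last exact: test_partial.
  rewrite dot_Rintegral; under eq_Rintegral do rewrite mul0r.
  by rewrite /Rintegral integral0 oppr0.
by rewrite /h1_dot /grad_dot (ae_dot0 Lu uae) !(ae_dot0 (Lw _) (w0 _)) !addr0.
Qed.

(** Let [p] be the projection of [u] on the closure of the test functions. Then [u - p] is
    orthogonal to all of them, so it is null by [weak_solution_eq0], and the approximants of [p]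
    approximate [u]. *)
Lemma test_dense u (e : R) : H1 u -> 0 < e ->
  exists2 phi, test_function phi & h1_dot (u - phi) (u - phi) <= e.
Proof.
move=> Hu e0; have [lB cB pB] := @h1_semi_dot R.
have sub phi : test_function phi -> H1 phi := @test_H1 R phi.
have [||p [Hp pE papp]] := @riesz_approx R plane H1 (@test_function R) h1_dot
  H1_subspace test_subspace sub h1_semi_dot (h1_dot u) (h1_dot u u) h1_complete.
- move=> a f g tf tg; rewrite cB//; last exact/sub/test_subspace.2.
  by rewrite lB ?(cB f) ?(cB g)//; exact: sub.
- by move=> f tf; exact: (dot_cauchy_schwarz H1_subspace h1_semi_dot Hu (sub f tf)).
have Hup := subspaceB H1_subspace Hu Hp.
have up0 : h1_dot (u - p) (u - p) = 0.
  apply: weak_solution_eq0 => // phi tphi.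
  by rewrite addrC -scaleN1r lB ?pE//; [ring|exact: sub].
have [|phi tphi pphi] := papp (e / 2); first by rewrite divr_gt0.
exists phi => //; have Hpphi := subspaceB H1_subspace Hp (sub _ tphi).
have -> : u - phi = (u - p) + 1 *: (p - phi) by rewrite scale1r addrA subrK.
rewrite (dotDZ H1_subspace h1_semi_dot)// up0 add0r.
have := dot_cauchy_schwarz H1_subspace h1_semi_dot Hup Hpphi.
rewrite up0 mul0r => h; have -> : h1_dot (u - p) (p - phi) = 0.
  by apply/eqP; rewrite -sqrf_eq0 eq_le h sqr_ge0.
by rewrite mulr0 add0r expr1n mul1r; lra.
Qed.

End density.

(** * The heat kernel *)

Section heat_kernel.
Context {R : realType}.
Local Notation lam := (@lebesgue_measure R).
Implicit Types (s t c k r x y : R) (z : R * R).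

(** The fundamental solution of [u_s = u_xx], that is, the normal density of variance [2 s]. *)
Definition heat1 s x : R := (Num.sqrt (4 * pi * s))^-1 * expR (- (x ^+ 2 / (4 * s))).

Lemma heat1_ge0 s x : 0 <= heat1 s x.
Proof. by rewrite mulr_ge0 ?expR_ge0// invr_ge0 sqrtr_ge0. Qed.

Lemma sqrt_4pi_gt0 s : 0 < s -> 0 < Num.sqrt (4 * pi * s).
Proof. by move=> s0; rewrite sqrtr_gt0 !mulr_gt0 ?pi_gt0. Qed.

Lemma heat1N s x : heat1 s (- x) = heat1 s x.
Proof. by rewrite /heat1 sqrrN. Qed.

Lemma measurable_heat1 s : measurable_fun [set: mR R] (heat1 s : mR R -> mR R).
Proof.
apply: measurable_funM => //; apply: measurableT_comp => //.
by apply: measurableT_comp => //; apply: measurable_funM => //; exact: measurable_funX.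
Qed.

Lemma heat1_normal s : 0 < s -> heat1 s = normal_pdf 0 (Num.sqrt (2 * s)).
Proof.
move=> s0; have s2 : 0 <= 2 * s by rewrite mulr_ge0// ltW.
have sn : Num.sqrt (2 * s) != 0 by rewrite gt_eqF// sqrtr_gt0 mulr_gt0.
apply/funext => x; rewrite normal_pdfE// /normal_peak /normal_fun sqr_sqrtr// subr0.
rewrite /heat1; congr ((Num.sqrt _)^-1 * expR _); first by ring.
by rewrite mulNr; congr (- (_ / _)); ring.
Qed.

Lemma integral_heat1 s : 0 < s -> (\int[lam]_x (heat1 s x)%:E = 1)%E.
Proof. by move=> s0; rewrite heat1_normal// integral_normal_pdf. Qed.

Lemma integral_heat1_shift s y : 0 < s -> (\int[lam]_x (heat1 s (x - y))%:E = 1)%E.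
Proof.
move=> s0; rewrite -(integral_heat1 s0).
apply: (@integral_shift _ (- y) (fun x => (heat1 s x)%:E)).
- by apply/measurable_EFinP; exact: measurable_heat1.
- by move=> x; rewrite lee_fin heat1_ge0.
Qed.

Lemma heat1_scale s k x : 0 < k -> heat1 s (k * x) = k^-1 * heat1 (s / k ^+ 2) x.
Proof.
move=> k0; rewrite /heat1 [RHS]mulrA; congr (_ * expR _); last first.
  by rewrite mulrA invf_div exprMn; ring.
rewrite -invfM; congr (_^-1).
rewrite (_ : 4 * pi * s = k ^+ 2 * (4 * pi * (s / k ^+ 2))); last first.
  by field; rewrite gt_eqF.
by rewrite sqrtrM ?sqr_ge0// sqrtr_sqr gtr0_norm// mulrCA.
Qed.

(* Completing the square. *)
Lemma heat1_mul s t x y : 0 < s -> 0 < t ->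
  heat1 s (x - y) * heat1 t y =
  heat1 (s + t) x * heat1 (s * t / (s + t)) (y - t * x / (s + t)).
Proof.
move=> s0 t0; have st0 : 0 < s + t by rewrite addr_gt0.
have p0 := @pi_gt0 R.
rewrite /heat1 mulrACA [RHS]mulrACA -!invfM -!expRD; congr (_^-1 * expR _).
  rewrite -!sqrtrM ?mulr_ge0 ?ltW//; congr Num.sqrt.
  by field; rewrite gt_eqF.
by field; rewrite !gt_eqF.
Qed.

Lemma heat1_semigroup s t x : 0 < s -> 0 < t ->
  (\int[lam]_y (heat1 s (x - y) * heat1 t y)%:E = (heat1 (s + t) x)%:E)%E.
Proof.
move=> s0 t0; under eq_integral do rewrite heat1_mul// EFinM.
have st : 0 < s * t / (s + t) by rewrite divr_gt0 ?mulr_gt0 ?addr_gt0.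
rewrite ge0_integralZl_EFin//; last 3 first.
- by move=> y _; rewrite lee_fin heat1_ge0.
- apply/measurable_EFinP.
  apply: (@measurableT_comp _ _ _ _ _ _ (heat1 (s * t / (s + t)) : mR R -> mR R)).
    exact: measurable_heat1.
  exact: measurable_funB.
- exact: heat1_ge0.
by rewrite integral_heat1_shift// mule1.
Qed.

Let sqr_heat1_le s r x : 0 < s -> 0 < r < 1 ->
  (1 - r ^+ 2) / (4 * s) * (heat1 s x * x ^+ 2) + heat1 s x <= r^-1 * heat1 (s / r ^+ 2) x.
Proof.
move=> s0 /andP[r0 r1].
rewrite -heat1_scale// /heat1.
set q := (Num.sqrt _)^-1; have q0 : 0 <= q by rewrite invr_ge0 sqrtr_ge0.
have -> : - ((r * x) ^+ 2 / (4 * s)) =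
    - (x ^+ 2 / (4 * s)) + (1 - r ^+ 2) / (4 * s) * x ^+ 2.
  by field; rewrite gt_eqF.
rewrite expRD; set E := expR (- _); set w := _ / (4 * s) * x ^+ 2.
have -> : (1 - r ^+ 2) / (4 * s) * (q * E * x ^+ 2) + q * E = q * (E * (1 + w)).
  by rewrite /w; ring.
by rewrite ler_wpM2l// ler_wpM2l ?expR_ge0// expR_ge1Dx.
Qed.

(** By [1 + w <= exp w] with [w = (1 - r^2) x^2 / (4 s)], the density times [1 + w] lies below a
    dilated Gaussian of total mass [1 / r]. This bounds the moment for each [r < 1], and [r] tending
    to 1 gives [2 s]. *)
Lemma second_moment_heat1 s : 0 < s ->
  (\int[lam]_x (heat1 s x * x ^+ 2)%:E <= (2 * s)%:E)%E.
Proof.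
move=> s0; have mh := measurable_heat1.
have mE r : measurable_fun [set: mR R] (fun x : mR R => (heat1 r x)%:E).
  by apply/measurable_EFinP; exact: mh.
have mM : measurable_fun [set: mR R] (fun x : mR R => heat1 s x * x ^+ 2 : mR R).
  by apply: measurable_funM; [exact: mh|exact: measurable_funX].
have M0 x : 0 <= heat1 s x * x ^+ 2 by rewrite mulr_ge0 ?sqr_ge0 ?heat1_ge0.
set M := (\int[lam]_x _)%E.
have M_ge0 : (0 <= M)%E by apply: integral_ge0 => x _; rewrite lee_fin.
have Mr r : 0 < r < 1 -> (((1 - r ^+ 2) / (4 * s))%:E * M + 1 <= r^-1%:E)%E.
  move=> rr; have /andP[r0 r1] := rr.
  have r2 : r ^+ 2 <= 1 by rewrite expr_le1// ltW.
  have sr : 0 < s / r ^+ 2 by rewrite divr_gt0 ?exprn_gt0.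
  have c0 : 0 <= (1 - r ^+ 2) / (4 * s).
    by rewrite divr_ge0 ?subr_ge0// mulr_ge0// ltW.
  rewrite -{1}(integral_heat1 s0) -ge0_integralZl_EFin//; last 2 first.
  - by move=> x _; rewrite lee_fin.
  - exact/measurable_EFinP.
  rewrite -ge0_integralD//; last 3 first.
  - by move=> x _; rewrite -EFinM lee_fin mulr_ge0.
  - by apply/measurable_EFinP; exact: measurable_funM.
  - by move=> x _; rewrite lee_fin heat1_ge0.
  rewrite -[leRHS]mule1 -(integral_heat1 sr) -ge0_integralZl_EFin//; last 2 first.
  - by move=> x _; rewrite lee_fin heat1_ge0.
  - by rewrite invr_ge0 ltW.
  apply: ge0_le_integral => //.
  - move=> x _; rewrite -EFinM -EFinD lee_fin.
    by apply: addr_ge0; [exact: mulr_ge0|exact: heat1_ge0].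
  - apply/measurable_EFinP; apply: measurable_funD; last exact: mh.
    by apply: measurable_funM.
  - by apply/measurable_EFinP; apply: measurable_funM; last exact: mh.
  - by move=> x _; rewrite -EFinM lee_fin; exact: sqr_heat1_le.
(* Any [r] strictly between 0 and 1 excludes an infinite moment, since the right-hand side [1 / r]
   is finite. *)
have Mfin : M \is a fin_num.
  rewrite ge0_fin_numE// ltNge leye_eq; apply/negP => /eqP Moo.
  have := Mr (1 / 2); rewrite Moo gt0_muley ?lte_fin; last first.
    by apply: divr_gt0; [lra|rewrite mulr_gt0].
  have h : 0 < (1 / 2 : R) < 1 by lra.
  by move=> /(_ h); rewrite addye// leye_eq.
rewrite -(fineK Mfin) lee_fin; move: Mr; rewrite -(fineK Mfin).
have := fine_ge0 M_ge0; move: (fine M) => m m0 Mr.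
have {}Mr r : 0 < r < 1 -> m * (r * (1 + r)) <= 4 * s.
  move=> rr; have := Mr r rr; have /andP[r0 r1] := rr; rewrite -EFinM -EFinD lee_fin.
  have -> : (1 - r ^+ 2) / (4 * s) * m = (1 - r) * ((1 + r) * m / (4 * s)).
    by field; rewrite gt_eqF.
  set w := _ / (4 * s) => h.
  have : r * w <= 1.
    have r1' : 0 < 1 - r by lra.
    rewrite -(ler_pM2l r1') mulr1.
    have := ler_wpM2l (ltW r0) h; rewrite divff ?gt_eqF//; lra.
  rewrite /w mulrA ler_pdivrMr ?mulr_gt0// mul1r; lra.
rewrite leNgt; apply/negP => /= sm.
(* At [r = 1 - e] the inequality [m r (1 + r) <= 4 s] reads [m + 2 s + e^2 m <= 4 s], which
   contradicts [2 s < m]. *)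
pose e := (m - 2 * s) / (3 * m).
have m_gt0 : 0 < m by lra.
have em : e * m = (m - 2 * s) / 3 by rewrite /e; field; rewrite gt_eqF.
have e0 : 0 < e by rewrite divr_gt0 ?mulr_gt0//; lra.
have e1 : e < 1 by rewrite /e ltr_pdivrMr ?mulr_gt0//; lra.
have /Mr : 0 < 1 - e < 1 by lra.
have -> : m * ((1 - e) * (1 + (1 - e))) = 2 * m - 3 * (e * m) + e * e * m by ring.
have : 0 <= e * e * m by apply: mulr_ge0 => //; apply: mulr_ge0; apply: ltW.
rewrite em; lra.
Qed.

Lemma half_heat1 s : 0 < s ->
  (\int[lam]_(x in `]0%R, +oo[) (heat1 s x)%:E <= (2^-1)%:E)%E.
Proof.
move=> s0; have mh := @measurable_heat1 s.
have mE : measurable_fun [set: mR R] (fun x : mR R => (heat1 s x)%:E) by exact/measurable_EFinP.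
have h0 x : (0 <= (heat1 s x)%:E)%E by rewrite lee_fin heat1_ge0.
pose I := (\int[lam]_(x in `]0%R, +oo[) (heat1 s x)%:E)%E.
have I0 : (0 <= I)%E by apply: integral_ge0.
have E : I = (\int[lam]_(x in `]-oo, 0%R[) (heat1 s x)%:E)%E.
  rewrite /I integral_mkcond -integral_reflect.
  - rewrite [RHS]integral_mkcond; apply: eq_integral => x _.
    rewrite !patchE; congr (if _ then _ else _); last by rewrite heat1N.
    by apply/idP/idP => /set_mem; rewrite /= in_itv/= ?andbT => h; apply/mem_set;
      rewrite /= in_itv/= ?andbT; move: h; rewrite oppr_gt0.
  - by apply/measurable_restrict => //; exact: measurable_funS mE.
  - by move=> x; rewrite patchE; case: ifP.
have : (I + I <= 1)%E.
  rewrite {2}E -(integral_heat1 s0) -ge0_integral_setU//.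
  - by apply: ge0_subset_integral => //; exact: measurableU.
  - exact: measurable_funS mE.
  - rewrite disj_set2E; apply/eqP/seteqP; split => // x [/=].
    by rewrite !in_itv/= andbT => h1 h2; lra.
rewrite -/I; case: (I) I0 => [i|//|//]; rewrite !lee_fin => i0.
  by lra.
Qed.

(* The substitution [tau = r ^+ 2] in
   [\int_0^oo e^(-k^2 tau) (4 pi tau)^(-1/2) dtau = 1 / (2 k)]. *)
Lemma heat_sum_le k t (N : nat) : 0 < k -> 0 < t ->
  t * \sum_(n < N) expR (- (k ^+ 2 * t)) ^+ n.+1 * (Num.sqrt (4 * pi * (n.+1%:R * t)))^-1
  <= (2 * k)^-1.
Proof.
(* With this [s] the density is [k / sqrt pi * exp(- k^2 x^2)], the integrand after the
   substitution; [a n] are the images of the nodes [n t]. *)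
move=> k0 t0; pose s := (4 * k ^+ 2)^-1.
have s0 : 0 < s by rewrite invr_gt0 mulr_gt0 ?exprn_gt0.
pose a (n : nat) := Num.sqrt (n%:R * t).
have a0 n : 0 <= a n by exact: sqrtr_ge0.
have aS n : a n <= a n.+1 by apply: ler_wsqrtr; rewrite ler_wpM2r ?ler_nat// ltW.
have mE : measurable_fun [set: mR R] (fun x : mR R => (heat1 s x)%:E).
  by apply/measurable_EFinP; exact: measurable_heat1.
have h0 x : (0 <= (heat1 s x)%:E)%E by rewrite lee_fin heat1_ge0.
(* The Gaussian decreases on the half-line, so each term, formed at the right end of its interval,
   is at most the integral over that interval. *)
have step n : ((k * (t * (expR (- (k ^+ 2 * t)) ^+ n.+1 *
    (Num.sqrt (4 * pi * (n.+1%:R * t)))^-1)))%:E <=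
    \int[lam]_(x in `]a n, a n.+1]) (heat1 s x)%:E)%E.
  have nt : 0 < n.+1%:R * t by rewrite mulr_gt0.
  have nt0 : 0 <= n%:R * t by rewrite mulr_ge0// ltW.
  have an : 0 < a n.+1 by rewrite sqrtr_gt0.
  apply: (@le_trans _ _ (\int[lam]_(x in `]a n, a n.+1]) (heat1 s (a n.+1))%:E)%E); last first.
    apply: ge0_le_integral => //.
    - exact: measurable_funS mE.
    - move=> x /=; rewrite in_itv/= => /andP[anx xan].
      have x0 : 0 <= x by apply: le_trans (ltW anx).
      rewrite lee_fin ler_wpM2l ?invr_ge0 ?sqrtr_ge0// ler_expR lerN2.
      rewrite ler_wpM2r// ?invr_ge0 ?mulr_ge0 ?(ltW s0)//.
      by rewrite lerXn2r ?nnegrE.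
  have -> : (\int[lam]_(_ in `]a n, a n.+1]) (heat1 s (a n.+1))%:E)%E =
      ((heat1 s (a n.+1))%:E * lam `]a n, a n.+1])%E.
    by apply: integral_cst; exact: measurable_itv.
  rewrite lebesgue_measure_itv/= lte_fin.
  have an2 : a n.+1 ^+ 2 = n.+1%:R * t by rewrite sqr_sqrtr// ltW.
  have an2' : a n ^+ 2 = n%:R * t by rewrite sqr_sqrtr.
  have lt_a : a n < a n.+1.
    by rewrite /a ltr_sqrt// ltr_pM2r// ltr_nat.
  rewrite lt_a -EFinB -EFinM lee_fin /heat1 an2.
  have -> : - (n.+1%:R * t / (4 * s)) = n.+1%:R * (- (k ^+ 2 * t)).
    by rewrite /s; field; rewrite gt_eqF.
  rewrite expRM_natl; set q := expR _ ^+ _; have q0 : 0 <= q by rewrite exprn_ge0// expR_ge0.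
  have -> : Num.sqrt (4 * pi * s) = Num.sqrt pi / k.
    have -> : 4 * pi * s = pi * (k^-1) ^+ 2 by rewrite /s; field; rewrite gt_eqF.
    by rewrite sqrtrM ?ltW ?pi_gt0// sqrtr_sqr gtr0_norm// invr_gt0.
  have -> : Num.sqrt (4 * pi * (n.+1%:R * t)) = 2 * Num.sqrt pi * a n.+1.
    rewrite -mulrA sqrtrM// (_ : 4 = 2 ^+ 2 :> R); last by ring.
    by rewrite sqrtr_sqr gtr0_norm// sqrtrM ?ltW ?pi_gt0// mulrA.
  have sp0 : 0 < Num.sqrt (pi : R) by rewrite sqrtr_gt0 pi_gt0.
  have -> : k * (t * (q * (2 * Num.sqrt pi * a n.+1)^-1)) =
      k / Num.sqrt pi * q * (t / (2 * a n.+1)).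
    by field; rewrite !gt_eqF.
  have -> : (Num.sqrt pi / k)^-1 * q = k / Num.sqrt pi * q.
    by field; rewrite !gt_eqF.
  rewrite ler_wpM2l ?mulr_ge0 ?invr_ge0 ?(ltW k0) ?(ltW sp0)//.
  rewrite ler_pdivrMr ?mulr_gt0//.
  (* What remains is [y^2 - x^2 <= 2 y (y - x)], that is, [0 <= (y - x)^2]. *)
  have -> : t = a n.+1 ^+ 2 - a n ^+ 2 by rewrite an2 an2' -natr1; ring.
  by move: (a n) (a n.+1) lt_a => x y xy; have := sqr_ge0 (y - x); lra.
have sum_le : ((k * (t * \sum_(n < N) expR (- (k ^+ 2 * t)) ^+ n.+1 *
    (Num.sqrt (4 * pi * (n.+1%:R * t)))^-1))%:E <=
    \int[lam]_(x in `]0%R, a N]) (heat1 s x)%:E)%E.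
  elim: N => [|N ih].
    by rewrite big_ord0 !mulr0; apply: integral_ge0.
  rewrite big_ord_recr (mulrDr t) (mulrDr k) EFinD.
  rewrite (@itv_bndbnd_setU _ _ (BRight 0) (BRight (a N)) (BRight (a N.+1)))//.
  rewrite ge0_integral_setU//.
  - exact: leeD ih (step N).
  - exact: measurable_funS mE.
  - rewrite disj_set2E; apply/eqP/seteqP; split => // x [/=].
    by rewrite !in_itv/= => /andP[_ h1] /andP[h2 _]; lra.
  - by rewrite bnd_simp.
  - by rewrite bnd_simp.
have : (\int[lam]_(x in `]0%R, a N]) (heat1 s x)%:E <= (2^-1)%:E)%E.
  apply: le_trans (half_heat1 s0); apply: ge0_subset_integral => //.
  - exact: measurable_funS mE.
  - by move=> x /=; rewrite !in_itv/= andbT => /andP[].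
move=> /(le_trans sum_le); rewrite lee_fin => h.
by rewrite invfM ler_pdivlMr// mulrC.
Qed.

End heat_kernel.

(** * The heat kernel of the plane *)

Section plane_heat_kernel.
Context {R : realType}.
Local Notation plane := (R * R)%type.
Local Notation lam := (@lebesgue_measure R).
Local Notation mu := (@lebesgue2 R).
Implicit Types (s t c k r : R) (x y z h : plane).

Lemma integral_tensor (f g : mR R -> \bar R) :
  measurable_fun [set: mR R] f -> measurable_fun [set: mR R] g ->
  (forall a : R, 0 <= f a)%E -> (forall a : R, 0 <= g a)%E ->
  (\int[mu]_z (f z.1 * g z.2) = (\int[lam]_a f a) * \int[lam]_a g a)%E.
Proof.
move=> mf mg f0 g0; rewrite (@lebesgue2_Tonelli R (fun z => f z.1 * g z.2)%E); last 2 first.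
- apply: emeasurable_funM; first exact: (measurableT_comp mf measurable_fst).
  exact: (measurableT_comp mg measurable_snd).
- by move=> x; exact: mule_ge0.
have E (a : R) : (\int[lam]_b (f (a, b).1 * g (a, b).2) = f a * \int[lam]_b g b)%E.
  exact: (ge0_integralZl _ measurableT mg (fun b _ => g0 b) (f0 a)).
under eq_integral do rewrite E.
by rewrite ge0_integralZr//; exact: integral_ge0.
Qed.

Definition heat t z : R := heat1 t z.1 * heat1 t z.2.

Lemma heat_ge0 t z : 0 <= heat t z.
Proof. by rewrite mulr_ge0 ?heat1_ge0. Qed.

Lemma heat_subC t x y : heat t (x - y) = heat t (y - x).
Proof. by rewrite /heat/= -heat1N opprB -(heat1N _ (x.2 - y.2)) opprB. Qed.

Lemma measurable_heat t : measurable_fun [set: pl R] (heat t : pl R -> mR R).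
Proof.
have mh := measurable_heat1 t; apply: measurable_funM.
  exact: (measurableT_comp mh measurable_fst).
exact: (measurableT_comp mh measurable_snd).
Qed.

Lemma measurable_heat_sub t :
  measurable_fun [set: pl R * pl R] (fun p : pl R * pl R => heat t (p.2 - p.1) : mR R).
Proof. exact: (measurableT_comp (measurable_heat t) measurable_sub2). Qed.

Lemma measurable_heat_shift t y : measurable_fun [set: pl R] (fun x : pl R => heat t (x - y) : mR R).
Proof. exact: (measurableT_comp (measurable_heat t) (measurable_translate (- y))). Qed.

Lemma integral_heat t y : 0 < t -> (\int[mu]_x (heat t (x - y))%:E = 1)%E.
Proof.
move=> t0; have mE := measurable_heat1 t.
have mE' : measurable_fun [set: mR R] (fun x : mR R => (heat1 t x)%:E) by exact/measurable_EFinP.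
rewrite (@integral_shift2 R (- y) (fun x => (heat t x)%:E)); last 2 first.
- by apply/measurable_EFinP; exact: measurable_heat.
- by move=> x; rewrite lee_fin heat_ge0.
under eq_integral do rewrite EFinM.
rewrite (@integral_tensor (fun x : R => (heat1 t x)%:E) (fun x : R => (heat1 t x)%:E))//.
- by rewrite !integral_heat1// mule1.
- by move=> x; rewrite lee_fin heat1_ge0.
- by move=> x; rewrite lee_fin heat1_ge0.
Qed.

Lemma heat_semigroup s t x z : 0 < s -> 0 < t ->
  (\int[mu]_y (heat s (x - y) * heat t (y - z))%:E = (heat (s + t) (x - z))%:E)%E.
Proof.
move=> s0 t0.
pose F (j : bool) (a : R) : \bar R := let p := if j then (x - z).1 else (x - z).2 in
  (heat1 s (p - a) * heat1 t a)%:E.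
have mF j : measurable_fun [set: mR R] (F j : mR R -> \bar R).
  apply/measurable_EFinP; apply: measurable_funM; last exact: measurable_heat1.
  apply: (measurableT_comp (measurable_heat1 s)).
  exact: (measurable_funB (measurable_cst _) (@measurable_id _ _ _)).
have F0 j a : (0 <= F j a)%E by rewrite lee_fin mulr_ge0 ?heat1_ge0.
have E y : (heat s (x - y) * heat t (y - z))%:E =
    (fun y : pl R => F true y.1 * F false y.2)%E (y - z).
  rewrite /F/heat/= -EFinM; congr (_%:E).
  have -> : x.1 - z.1 - (y.1 - z.1) = x.1 - y.1 by ring.
  have -> : x.2 - z.2 - (y.2 - z.2) = x.2 - y.2 by ring.
  by ring.
under eq_integral do rewrite E.
rewrite (@integral_shift2 R (- z) (fun y => F true y.1 * F false y.2)%E); last 2 first.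
- apply: emeasurable_funM; first exact: (measurableT_comp (mF true) measurable_fst).
  exact: (measurableT_comp (mF false) measurable_snd).
- by move=> y; rewrite mule_ge0.
by rewrite integral_tensor// /F !heat1_semigroup// -EFinM.
Qed.

(** Intended for a chord [z] whose ends are at distance [r] along the loop: the planar kernel
    becomes a one-dimensional kernel in arc length at time [t / c^2], with one factor
    [1 / sqrt(4 pi t)] left over and [1 / c] from the scaling. *)
Lemma heat_le t c r z : 0 < t -> 0 < c -> 0 <= r -> c * r <= enorm z ->
  heat t z <= (c * Num.sqrt (4 * pi * t))^-1 * heat1 (t / c ^+ 2) r.
Proof.
move=> t0 c0 r0 crz; have st := sqrt_4pi_gt0 t0.
have -> : (c * Num.sqrt (4 * pi * t))^-1 * heat1 (t / c ^+ 2) r =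
    (Num.sqrt (4 * pi * t))^-1 * heat1 t (c * r).
  by rewrite heat1_scale// invfM; ring.
rewrite /heat /heat1 mulrACA -expRD -mulrA ler_wpM2l ?invr_ge0 ?sqrtr_ge0//.
rewrite ler_wpM2l ?invr_ge0 ?sqrtr_ge0// ler_expR -opprD lerN2 -mulrDl.
apply: ler_wpM2r; first by rewrite invr_ge0 mulr_ge0// ltW.
have -> : z.1 ^+ 2 + z.2 ^+ 2 = enorm z ^+ 2 by rewrite sqr_sqrtr ?addr_ge0 ?sqr_ge0.
by rewrite lerXn2r ?nnegrE ?sqrtr_ge0// mulr_ge0// ltW.
Qed.

Lemma heat_max t z : 0 < t -> heat t z <= (4 * pi * t)^-1.
Proof.
move=> t0; have h (x : R) : heat1 t x <= (Num.sqrt (4 * pi * t))^-1.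
  rewrite ler_piMr ?invr_ge0 ?sqrtr_ge0//.
  by rewrite -[leRHS]expR0 ler_expR oppr_le0 divr_ge0 ?sqr_ge0// mulr_ge0// ltW.
apply: (le_trans (ler_pM (heat1_ge0 _ _) (heat1_ge0 _ _) (h _) (h _))).
by rewrite -invfM -expr2 sqr_sqrtr// !mulr_ge0 ?pi_ge0// ltW.
Qed.

(** Adding the reflected integral removes the mixed term before anything is split, so all integrands
    stay nonnegative and only the two second moments remain. *)
Lemma heat_quadratic_le t (A B C : R) : 0 < t ->
  (forall h, 0 <= A * h.1 ^+ 2 + 2 * B * (h.1 * h.2) + C * h.2 ^+ 2) ->
  (\int[mu]_h (heat t h * (A * h.1 ^+ 2 + 2 * B * (h.1 * h.2) + C * h.2 ^+ 2))%:E
    <= (2 * t * (A + C))%:E)%E.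
Proof.
move=> t0 Q0; pose Q h := A * h.1 ^+ 2 + 2 * B * (h.1 * h.2) + C * h.2 ^+ 2.
have A0 : 0 <= A by have := Q0 (1, 0); rewrite /= !(expr1n, mulr1, mulr0, expr0n, addr0).
have C0 : 0 <= C by have := Q0 (0, 1); rewrite /= !(expr1n, mulr1, mulr0, mul0r, expr0n, addr0, add0r).
have m1 : measurable_fun [set: pl R] (fst : pl R -> mR R) := measurable_fst.
have m2 : measurable_fun [set: pl R] (snd : pl R -> mR R) := measurable_snd.
have mQ : measurable_fun [set: pl R] (Q : pl R -> mR R).
  apply: measurable_funD; last first.
    by apply: measurable_funM => //; exact: measurable_funX.
  apply: measurable_funD; first by apply: measurable_funM => //; exact: measurable_funX.
  by apply: measurable_funM => //; exact: measurable_funM.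
have mh := @measurable_heat t.
have mE := measurable_heat1 t.
have mHQ : measurable_fun [set: pl R] (fun h : pl R => (heat t h * Q h)%:E).
  by apply/measurable_EFinP; apply: measurable_funM.
have HQ0 (h : plane) : (0 <= (heat t h * Q h)%:E)%E.
  by rewrite lee_fin; apply: mulr_ge0; [exact: heat_ge0|exact: Q0].
pose I := (\int[mu]_h (heat t h * Q h)%:E)%E.
have -> : (\int[mu]_h (heat t h * (A * h.1 ^+ 2 + 2 * B * (h.1 * h.2) + C * h.2 ^+ 2))%:E)%E = I by [].
have I0 : (0 <= I)%E by exact: integral_ge0.
have mE' : measurable_fun [set: mR R] (fun x : mR R => (heat1 t x)%:E) by exact/measurable_EFinP.
have mM : measurable_fun [set: mR R] (fun x : mR R => (heat1 t x * x ^+ 2)%:E).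
  by apply/measurable_EFinP; apply: measurable_funM => //; exact: measurable_funX.
have E0 (x : R) : (0 <= (heat1 t x)%:E)%E by rewrite lee_fin heat1_ge0.
have M0 (x : R) : (0 <= (heat1 t x * x ^+ 2)%:E)%E by rewrite lee_fin mulr_ge0 ?heat1_ge0 ?sqr_ge0.
have m11 : (\int[mu]_h (heat t h * h.1 ^+ 2)%:E <= (2 * t)%:E)%E.
  have E h : (heat t h * h.1 ^+ 2)%:E = ((heat1 t h.1 * h.1 ^+ 2)%:E * (heat1 t h.2)%:E)%E.
    by rewrite -EFinM /heat; congr (_%:E); ring.
  under eq_integral do rewrite E.
  rewrite (@integral_tensor (fun x : R => (heat1 t x * x ^+ 2)%:E) (fun x : R => (heat1 t x)%:E))//.
  by rewrite integral_heat1// mule1; exact: second_moment_heat1.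
have m22 : (\int[mu]_h (heat t h * h.2 ^+ 2)%:E <= (2 * t)%:E)%E.
  have E h : (heat t h * h.2 ^+ 2)%:E = ((heat1 t h.1)%:E * (heat1 t h.2 * h.2 ^+ 2)%:E)%E.
    by rewrite -EFinM /heat; congr (_%:E); ring.
  under eq_integral do rewrite E.
  rewrite (@integral_tensor (fun x : R => (heat1 t x)%:E) (fun x : R => (heat1 t x * x ^+ 2)%:E))//.
  by rewrite integral_heat1// mul1e; exact: second_moment_heat1.
have II : (I + I <= (2 * A * (2 * t) + 2 * C * (2 * t))%:E)%E.
  have mr : measurable_fun [set: pl R] (fun h : pl R => (h.1, - h.2) : pl R).
    by apply: measurable_fun_pair => //; exact: measurable_funN.
  have {2}-> : I = (\int[mu]_h (heat t (h.1, - h.2)%R * Q (h.1, - h.2)%R)%:E)%E.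
    rewrite (@integral_reflect2 R (fun h => (heat t h * Q h)%:E)); [by []| |by []].
    exact: mHQ.
  rewrite -ge0_integralD//; last exact: (measurableT_comp mHQ mr).
  have E (h : plane) : ((heat t h * Q h)%:E + (heat t (h.1, - h.2)%R * Q (h.1, - h.2)%R)%:E =
      (2 * A)%:E * (heat t h * h.1 ^+ 2)%:E + (2 * C)%:E * (heat t h * h.2 ^+ 2)%:E)%E.
    by rewrite -!EFinM -!EFinD /heat /Q /= heat1N; congr (_%:E); ring.
  under eq_integral do rewrite E.
  have mq (f : pl R -> mR R) : measurable_fun [set: pl R] f ->
      measurable_fun [set: pl R] (fun h : pl R => (heat t h * f h ^+ 2)%:E).
    move=> mf; apply/measurable_EFinP; apply: measurable_funM; first exact: mh.
    exact: measurable_funX.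
  have q0 (a b : R) : (0 <= (a * b ^+ 2)%:E)%E = (0 <= a * b ^+ 2) by rewrite lee_fin.
  have c0 (h : plane) (b : R) : (0 <= (heat t h * b ^+ 2)%:E)%E.
    by rewrite lee_fin mulr_ge0 ?heat_ge0 ?sqr_ge0.
  have A2 : 0 <= 2 * A by lra.
  have C2 : 0 <= 2 * C by lra.
  rewrite ge0_integralD//; last 4 first.
  - by move=> h _; apply: mule_ge0 => //; rewrite lee_fin.
  - by apply: emeasurable_funM => //; exact: (mq fst).
  - by move=> h _; apply: mule_ge0 => //; rewrite lee_fin.
  - by apply: emeasurable_funM => //; exact: (mq snd).
  rewrite !ge0_integralZl_EFin//; last 2 first.
  - exact: (mq snd).
  - exact: (mq fst).
  by rewrite EFinD !(EFinM (_ * _)); apply: leeD; apply: lee_wpmul2l.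
case: (I) I0 II => [i|//|//]; rewrite -EFinD !lee_fin => i0 ii; lra.
Qed.

End plane_heat_kernel.

(** * Translates of H^1 functions *)

Section translation_bound.
Context {R : realType}.
Local Notation plane := (R * R)%type.
Local Notation mu := (@lebesgue2 R).
Implicit Types (phi f g u v w : plane -> R) (x y h : plane).

Lemma le_limit (a b K : R) : (forall e : R, 0 < e <= 1 -> a <= b + e * K) -> a <= b.
Proof.
move=> h; apply/ler_addgt0Pl => e e0; rewrite addrC.
pose r := Num.min 1 (e / (`|K| + 1)).
have K1 : 0 < `|K| + 1 by rewrite ltr_wpDl.
have r0 : 0 < r by rewrite lt_min ltr01 divr_gt0.
apply: le_trans (h r _) _; first by rewrite r0 ge_min lexx.
rewrite lerD2l; apply: le_trans (ler_wpM2l (ltW r0) (ler_norm K)) _.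
apply: (@le_trans _ _ (e / (`|K| + 1) * `|K|)).
  by rewrite ler_wpM2r// ge_min lexx orbT.
rewrite mulrAC ler_pdivrMr//; apply: ler_wpM2l; [exact: ltW|lra].
Qed.

Lemma dot_young (e : R) f g : 0 < e -> L2 mu f -> L2 mu g ->
  dot mu (f + g) (f + g) <= (1 + e) * dot mu f f + (1 + e^-1) * dot mu g g.
Proof. exact: (semi_dot_young (@L2_plane_subspace R) (@dot_plane_semi_dot R)). Qed.

Lemma dotZZ (a : R) f : L2 mu f -> dot mu (a *: f) (a *: f) = a ^+ 2 * dot mu f f.
Proof.
move=> Lf; rewrite !dot_Rintegral -RintegralZl//; last exact: L2_integrableM.
apply: eq_Rintegral => x _; have -> : (a *: f) x = a * f x by [].
by ring.
Qed.

Lemma translateD_L2 h f : L2 mu f -> L2 mu (fun x => f (x + h)).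
Proof. by move=> Lf; have := translate_L2 (- h) Lf; rewrite opprK. Qed.

Definition increment h f : plane -> R := (fun x => f (x + h)) - f.

Lemma increment_L2 h f : L2 mu f -> L2 mu (increment h f).
Proof.
move=> Lf; exact: (subspaceB (@L2_plane_subspace R) (translateD_L2 h Lf) Lf).
Qed.

Lemma dot_increment_le h f : L2 mu f ->
  dot mu (increment h f) (increment h f) <= 4 * dot mu f f.
Proof.
move=> Lf; have L' := subspaceZ (-1) (@L2_plane_subspace R) Lf.
have := dot_young ltr01 (translateD_L2 h Lf) L'.
rewrite (dot_translate h (L2_measurable Lf)) scaleN1r.
have -> : dot mu (- f) (- f) = dot mu f f.
  by rewrite !dot_Rintegral; under eq_Rintegral do rewrite !fctE mulrNN.
rewrite invr1; have -> : (fun x => f (x + h)) + - f = increment h f by [].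
by lra.
Qed.

(** An increment by [2 h] is the sum of two translates of the increment by [h]. Hence the squared
    norm of the difference quotient can only grow when the step is halved. *)
Lemma dot_increment_double h f : L2 mu f ->
  dot mu (increment (2 *: h) f) (increment (2 *: h) f) <=
  4 * dot mu (increment h f) (increment h f).
Proof.
move=> Lf; have Li := increment_L2 h Lf.
have -> : increment (2 *: h) f = (fun x => increment h f (x + h)) + increment h f.
  apply/funext => x; rewrite /increment !fctE.
  have -> : x + 2 *: h = x + h + h by rewrite -addrA scaler_nat mulr2n.
  by ring.
apply: le_trans (dot_young ltr01 (translateD_L2 h Li) Li) _.
by rewrite (dot_translate h (L2_measurable Li)) invr1; lra.
Qed.

Definition directional (w : bool -> plane -> R) h : plane -> R :=
  h.1 *: w false + h.2 *: w true.

Lemma directional_L2 (w : bool -> plane -> R) h : (forall j, L2 mu (w j)) -> L2 mu (directional w h).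
Proof.
move=> Lw; have sD := @L2_plane_subspace R.
exact: (subspaceD sD (subspaceZ _ sD (Lw _)) (subspaceZ _ sD (Lw _))).
Qed.

(** Instead of integrating the gradient along the segment, the step is halved repeatedly: the
    quotient does not decrease, and by Taylor's formula its norm tends to that of the directional
    derivative. *)
Lemma test_increment_le h phi : test_function phi ->
  dot mu (increment h phi) (increment h phi) <=
  dot mu (directional (partial^~ phi) h) (directional (partial^~ phi) h).
Proof.
move=> tphi; have Lphi := test_L2 tphi.
pose p := directional (partial^~ phi) h.
have Lp : L2 mu p by apply: directional_L2 => j; exact: (test_L2 (test_partial j tphi)).
have /test_functionP[sphi [rho vphi]] := tphi.
have [C C0 taylor] := test_taylor tphi.
pose D k := dot mu (increment k phi) (increment k phi).
have halving n : D h <= 4 ^+ n * D ((2^-1) ^+ n *: h).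
  elim: n => [|n ih]; first by rewrite !expr0 mul1r scale1r.
  apply: le_trans ih _; rewrite exprSr -mulrA; apply: ler_wpM2l; first exact: exprn_ge0.
  have := dot_increment_double ((2^-1) ^+ n.+1 *: h) Lphi.
  by rewrite scalerA exprS mulrA divff ?pnatr_eq0// mul1r.
(* The squared Taylor remainder of the quotient over [r ^+ 2], integrated over a box containing the
   supports for all steps [r *: h] with [r <= 1]. *)
pose K := (C * `|h| ^+ 2) ^+ 2 * box_area (rho + `|h|).
have small (r : R) : 0 < r <= 1 -> r^-1 ^+ 2 * D (r *: h) <= dot mu p p + r * (dot mu p p + 2 * K).
  move=> /andP[r0 r1].
  pose E := r^-1 *: increment (r *: h) phi - p.
  have Li := increment_L2 (r *: h) Lphi.
  have sD := @L2_plane_subspace R.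
  have LE : L2 mu E by exact: (subspaceB sD (subspaceZ _ sD Li) Lp).
  have EE : dot mu E E <= r ^+ 2 * K.
    apply: (@le_trans _ _ ((C * r * `|h| ^+ 2) ^+ 2 * box_area (rho + `|h|))); last first.
      by rewrite /K !exprMn; lra.
    apply: dot_vanishes_le; first exact: (L2_measurable LE).
      move=> x; rewrite /E /increment /p /directional !fctE.
      have := taylor x (r *: h); rewrite normrZ (gtr0_norm r0) => tx.
      rewrite -(ler_pM2l r0) -{1}(gtr0_norm r0) -normrM.
      apply: le_trans (le_trans tx _); last by rewrite exprMn; lra.
      rewrite le_eqVlt; apply/orP; left; apply/eqP; congr `|_|.
      by rewrite /= /GRing.scale/=; field; rewrite gt_eqF.
    move=> x xr; have h0 : 0 <= `|h| by [].
    have x0 : phi x = 0 by apply: vphi; lra.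
    have vp j : partial j phi x = 0 by apply: (@vanishes_off_partial R rho j phi vphi x); lra.
    have xh : phi (x + r *: h) = 0.
      apply: vphi; have := ler_normB (x + r *: h) (r *: h); rewrite addrK normrZ gtr0_norm//.
      have := ler_piMl h0 r1; lra.
    by rewrite /E /increment /p /directional !fctE x0 xh !vp !(scaler0, subr0, addr0).
  have -> : r^-1 ^+ 2 * D (r *: h) = dot mu (p + E) (p + E).
    rewrite (_ : p + E = r^-1 *: increment (r *: h) phi); last by rewrite /E addrC subrK.
    by rewrite (dotZZ _ Li).
  apply: le_trans (dot_young r0 Lp LE) _.
  have rK : (1 + r^-1) * dot mu E E <= (1 + r^-1) * (r ^+ 2 * K).
    by apply: ler_wpM2l EE; rewrite addr_ge0// invr_ge0 ltW.
  have K0 : 0 <= K by rewrite mulr_ge0 ?sqr_ge0// fine_ge0.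
  have : (1 + r^-1) * (r ^+ 2 * K) <= r * (2 * K).
    have -> : (1 + r^-1) * (r ^+ 2 * K) = (1 + r) * (r * K) by field; rewrite gt_eqF.
    by have := ler_wpM2r (mulr_ge0 (ltW r0) K0) r1; lra.
  by lra.
apply: (@le_limit _ _ (dot mu p p + 2 * K)) => e /andP[e0 e1].
have [n ne] : exists n : nat, (2^-1 : R) ^+ n <= e.
  have half1 : `|2^-1 : R| < 1 by rewrite ger0_norm// invf_lt1// ltr1n.
  have /cvgrPdist_le/(_ e e0)[n _ /(_ n (leqnn n))] := cvg_expr half1.
  by rewrite /= sub0r normrN ger0_norm ?exprn_ge0//; exists n.
have r0 : 0 < (2^-1 : R) ^+ n by rewrite exprn_gt0.
have r1 : (2^-1 : R) ^+ n <= 1 by rewrite exprn_ile1// invf_le1 ?ler1n.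
have four : (4 : R) ^+ n = ((2^-1 : R) ^+ n)^-1 ^+ 2.
  by rewrite -exprVn invrK -exprM mulnC exprM; congr (_ ^+ n); ring.
apply: le_trans (halving n) _; rewrite four; move: ((2^-1 : R) ^+ n) ne r0 r1 => r re r0 r1.
apply: le_trans (small r _) _; first by rewrite r0.
rewrite lerD2l; apply: ler_wpM2r => //; rewrite addr_ge0 ?dot_ge0// mulr_ge0//.
by rewrite mulr_ge0 ?sqr_ge0// fine_ge0.
Qed.

Lemma dot_directionalE (w : bool -> plane -> R) h : (forall j, L2 mu (w j)) ->
  dot mu (directional w h) (directional w h) =
  dot mu (w false) (w false) * h.1 ^+ 2 + 2 * dot mu (w false) (w true) * (h.1 * h.2)
  + dot mu (w true) (w true) * h.2 ^+ 2.
Proof.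
move=> Lw; have sD := @L2_plane_subspace R; have dB := @dot_plane_semi_dot R.
have L1 := subspaceZ h.1 sD (Lw false); have [lB cB _] := dB.
have sZ f g (a : R) : L2 mu f -> L2 mu g -> dot mu (a *: f) g = a * dot mu f g.
  move=> Lf Lg; have := lB a f 0 g Lf sD.1 Lg; rewrite addr0 => ->.
  have := lB 1 0 0 g sD.1 sD.1 Lg; rewrite scaler0 addr0 mul1r; lra.
rewrite /directional (dotDZ sD dB _ L1 (Lw true)) !sZ//.
rewrite (dotC mu (w false) (h.1 *: _)) sZ//; ring.
Qed.

Lemma dot_directional_le (w : bool -> plane -> R) h (e : R) : (forall j, L2 mu (w j)) ->
  (forall j, dot mu (w j) (w j) <= e) ->
  dot mu (directional w h) (directional w h) <= 2 * (h.1 ^+ 2 + h.2 ^+ 2) * e.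
Proof.
move=> Lw we; have sD := @L2_plane_subspace R.
have := dot_young ltr01 (subspaceZ h.1 sD (Lw false)) (subspaceZ h.2 sD (Lw true)).
rewrite !dotZZ// invr1 => /le_trans; apply.
have := ler_wpM2l (sqr_ge0 h.1) (we false); have := ler_wpM2l (sqr_ge0 h.2) (we true).
by lra.
Qed.

(** Density of the test functions. The approximation is of squared norm [e ^+ 2], so that the factor
    [1 + e^-1] of Young's inequality leaves an error of order [e]. *)
Lemma H1_increment_le h u : H1 u ->
  dot mu (increment h u) (increment h u) <=
  dot mu (directional (wderiv^~ u) h) (directional (wderiv^~ u) h).
Proof.
move=> Hu; have sD := @L2_plane_subspace R; have Lu := L2_H1 Hu.
have Lw j : L2 mu (wderiv j u) := wderiv_L2 j Hu.
pose Qu := dot mu (directional (wderiv^~ u) h) (directional (wderiv^~ u) h).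
pose k := 2 * (h.1 ^+ 2 + h.2 ^+ 2).
have k0 : 0 <= k by rewrite mulr_ge0// addr_ge0 ?sqr_ge0.
(* Collects the errors of the steps below: [(1 + e) ((1 + e) Qu + 2 k e) + 8 e] for [e <= 1]. *)
apply: (@le_limit _ _ (3 * Qu + 4 * k + 8)) => e /andP[e0 e1].
have e20 : 0 < e ^+ 2 by rewrite exprn_gt0.
have [phi tphi phiu] := test_dense Hu e20.
have Hphi := test_H1 tphi; have Lphi := test_L2 tphi.
have Hd := subspaceB (@H1_subspace R) Hu Hphi; have Ld := L2_H1 Hd.
have uE : increment h u = increment h phi + increment h (u - phi).
  by apply/funext => x; rewrite /increment !fctE; ring.
have step1 := dot_young e0 (increment_L2 h Lphi) (increment_L2 h Ld).
rewrite -uE in step1; apply: le_trans step1 _.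
have bd : dot mu (increment h (u - phi)) (increment h (u - phi)) <= 4 * e ^+ 2.
  apply: le_trans (dot_increment_le h Ld) _; apply: ler_wpM2l => //.
  exact: le_trans (dot_le_h1 Hd) phiu.
have step2 := test_increment_le h tphi.
pose w j := wderiv j phi - wderiv j u.
have Lw' j : L2 mu (w j) by exact: (subspaceB sD (wderiv_L2 j Hphi) (Lw j)).
have bw j : dot mu (w j) (w j) <= e ^+ 2.
  have -> : dot mu (w j) (w j) = dot mu (wderiv j u - wderiv j phi) (wderiv j u - wderiv j phi).
    by rewrite !dot_Rintegral; apply: eq_Rintegral => x _; rewrite /w !fctE; ring.
  by rewrite dot_wderivB//; exact: le_trans (dot_wderiv_le_h1 j _) phiu.
have Qphi : dot mu (directional (partial^~ phi) h) (directional (partial^~ phi) h) =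
    dot mu (directional (wderiv^~ u) h + directional w h)
           (directional (wderiv^~ u) h + directional w h).
  have -> : directional (wderiv^~ u) h + directional w h = directional (wderiv^~ phi) h.
    by apply/funext => x; rewrite /directional /w !fctE /GRing.scale/=; ring.
  have Lpp j : L2 mu (partial j phi) := test_L2 (test_partial j tphi).
  have Lwp j : L2 mu (wderiv j phi) := wderiv_L2 j Hphi.
  have E : directional (partial^~ phi) h = directional (wderiv^~ phi) h %[ae mu].
    apply: filterS2 (wderiv_test false tphi) (wderiv_test true tphi) => x /= h1 h2 _.
    by rewrite /directional !fctE h1// h2.
  apply: (dot_ae (directional_L2 h Lpp) (directional_L2 h Lpp)
    (directional_L2 h Lwp) (directional_L2 h Lwp) E E).
have step3 := dot_young e0 (directional_L2 h Lw) (directional_L2 h Lw').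
rewrite -Qphi -/Qu in step3.
have step4 := dot_directional_le h Lw' bw; rewrite -/k in step4.
have Qu0 : 0 <= Qu by exact: dot_ge0.
have e'0 : 0 <= 1 + e^-1 by rewrite addr_ge0// invr_ge0 ltW.
have ee : (1 + e^-1) * e ^+ 2 <= 2 * e.
  have -> : (1 + e^-1) * e ^+ 2 = (1 + e) * e by field; rewrite gt_eqF.
  by rewrite ler_wpM2r ?(ltW e0)//; lra.
have s5 : (1 + e^-1) * dot mu (increment h (u - phi)) (increment h (u - phi)) <= 8 * e.
  by have := ler_wpM2l e'0 bd; lra.
have s6 : (1 + e^-1) * dot mu (directional w h) (directional w h) <= 2 * k * e.
  have := ler_wpM2l e'0 step4; have := ler_wpM2l k0 ee; lra.
have s7 : (1 + e) * dot mu (increment h phi) (increment h phi) <=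
    (1 + e) * ((1 + e) * Qu + 2 * k * e).
  by apply: ler_wpM2l; lra.
have eQ : e * e * Qu <= e * Qu.
  by rewrite -mulrA ler_piMl// mulr_ge0// ltW.
have ek : e * e * k <= e * k.
  by rewrite -mulrA ler_piMl// mulr_ge0// ltW.
by rewrite -/Qu; lra.
Qed.

End translation_bound.

(** * The trace inequality *)

Section smear.
Context {R : realType}.
Local Notation plane := (R * R)%type.
Local Notation mu := (@lebesgue2 R).
Implicit Types (f g phi : plane -> R) (x y h : plane) (s t e : R).

(** The heat semigroup applied to the measure [f nu]: for [nu = mu] it acts on the function [f], and
    with [f = 1] it regularizes [nu]. *)
Definition smear (nu : {measure set (pl R) -> \bar R}) t f y : \bar R :=
  (\int[nu]_x (heat t (x - y) * f x)%:E)%E.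

Lemma smear_ge0 (nu : {measure set (pl R) -> \bar R}) t f y :
  (forall x, 0 <= f x) -> (0 <= smear nu t f y)%E.
Proof.
by move=> f0; apply: integral_ge0 => x _; rewrite lee_fin mulr_ge0 ?heat_ge0.
Qed.

Lemma measurable_heatM t f y : measurable_fun [set: pl R] f ->
  measurable_fun [set: pl R] (fun x : pl R => (heat t (x - y) * f x)%:E).
Proof.
move=> mf; apply/measurable_EFinP; apply: measurable_funM => //.
exact: measurable_heat_shift.
Qed.

Lemma smear_const t (a : R) y : 0 < t -> 0 <= a -> (smear mu t (cst a) y = a%:E)%E.
Proof.
move=> t0 a0; rewrite /smear; under eq_integral do rewrite EFinM /cst.
rewrite ge0_integralZr//; first by rewrite integral_heat// mul1e.
- by apply/measurable_EFinP; exact: measurable_heat_shift.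
- by move=> x _; rewrite lee_fin heat_ge0.
Qed.

Lemma smear_le (nu : {measure set (pl R) -> \bar R}) t f g y :
  measurable_fun [set: pl R] f -> measurable_fun [set: pl R] g ->
  (forall x, 0 <= f x <= g x) -> (smear nu t f y <= smear nu t g y)%E.
Proof.
move=> mf mg fg; apply: ge0_le_integral => //.
- by move=> x _; have /andP[f0 _] := fg x; rewrite lee_fin mulr_ge0 ?heat_ge0.
- exact: measurable_heatM.
- exact: measurable_heatM.
- by move=> x _; have /andP[_ le_fg] := fg x; rewrite lee_fin ler_wpM2l ?heat_ge0.
Qed.

Lemma smearD (nu : {measure set (pl R) -> \bar R}) t f g y :
  measurable_fun [set: pl R] f -> measurable_fun [set: pl R] g ->
  (forall x, 0 <= f x) -> (forall x, 0 <= g x) ->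
  (smear nu t (f + g)%R y = smear nu t f y + smear nu t g y)%E.
Proof.
move=> mf mg f0 g0; rewrite /smear -ge0_integralD//.
- by apply: eq_integral => x _; rewrite -EFinD -mulrDr.
- by move=> x _; rewrite lee_fin mulr_ge0 ?heat_ge0.
- exact: measurable_heatM.
- by move=> x _; rewrite lee_fin mulr_ge0 ?heat_ge0.
- exact: measurable_heatM.
Qed.

Lemma smearZ (nu : {measure set (pl R) -> \bar R}) t (a : R) f y :
  measurable_fun [set: pl R] f -> (forall x, 0 <= f x) -> 0 <= a ->
  (smear nu t (a *: f)%R y = a%:E * smear nu t f y)%E.
Proof.
move=> mf f0 a0; rewrite /smear -ge0_integralZl_EFin//.
- by apply: eq_integral => x _; rewrite -EFinM; congr (_%:E); rewrite !fctE mulrCA.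
- by move=> x _; rewrite lee_fin mulr_ge0 ?heat_ge0.
- exact: measurable_heatM.
Qed.

Lemma measurable_smear_kernel t f : measurable_fun [set: pl R] f ->
  measurable_fun [set: pl R * pl R] (fun p : pl R * pl R => (heat t (p.2 - p.1) * f p.2)%:E).
Proof.
move=> mf; apply/measurable_EFinP; apply: measurable_funM.
  exact: measurable_heat_sub.
exact: (measurableT_comp mf measurable_snd).
Qed.

Lemma measurable_smear (nu : {sigma_finite_measure set (pl R) -> \bar R}) t f :
  measurable_fun [set: pl R] f -> (forall x, 0 <= f x) ->
  measurable_fun [set: pl R] (smear nu t f : pl R -> \bar R).
Proof.
move=> mf f0; have F0 (p : pl R * pl R) : (0 <= (heat t (p.2 - p.1) * f p.2)%:E)%E.
  by rewrite lee_fin mulr_ge0 ?heat_ge0.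
exact: (@measurable_fun_fubini_tonelli_F _ _ _ _ _ nu _ (measurable_smear_kernel t mf) F0).
Qed.

Lemma measurable_smear_mu t f :
  measurable_fun [set: pl R] f -> (forall x, 0 <= f x) ->
  measurable_fun [set: pl R] (smear mu t f : pl R -> \bar R).
Proof. exact: (@measurable_smear (@leb2 R)). Qed.

Lemma tonelli_mu (nu : {sigma_finite_measure set (pl R) -> \bar R})
    (F : pl R * pl R -> \bar R) :
  measurable_fun [set: pl R * pl R] F -> (forall z, 0 <= F z)%E ->
  (\int[mu]_x \int[nu]_y F (x, y) = \int[nu]_y \int[mu]_x F (x, y))%E.
Proof.
by move=> mF F0; have := @fubini_tonelli _ _ _ _ _ (@leb2 R) nu F mF F0.
Qed.

(** Continuity near [y] and boundedness elsewhere combine into the single estimate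
    [|f y - f x| <= e / 2 + C |x - y|^2], and the second moment of the kernel tends to 0 with the
    time. *)
Lemma smear_cvg f y (B : R) : measurable_fun [set: pl R] f -> continuous f ->
  (forall x, 0 <= f x <= B) ->
  (fun n => fine (smear mu n.+1%:R^-1 f y)) @ \oo --> f y.
Proof.
move=> mf cf fB; have f0 x : 0 <= f x by have /andP[] := fB x.
have B0 : 0 <= B by apply: le_trans (f0 0) _; have /andP[] := fB 0.
have P0 t : 0 < t -> (smear mu t f y <= B%:E)%E.
  by move=> t0; rewrite -(smear_const y t0 B0); apply: smear_le.
have Pfin t : 0 < t -> (smear mu t f y) \is a fin_num.
  by move=> t0; rewrite ge0_fin_numE ?smear_ge0// (le_lt_trans (P0 t t0)) ?ltry.
apply/cvgrPdist_le => e e0.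
have e2 : 0 < e / 2 by rewrite divr_gt0.
have /cvgrPdist_le/(_ _ e2)/nbhs_ballP[d /= d0 dP] := cf y.
(* At distance at least [d] from [y] the quadratic term alone exceeds the bound [B] on the
   oscillation. *)
pose C := B / d ^+ 2; have C0 : 0 <= C by rewrite divr_ge0 ?sqr_ge0.
pose Q x := (x - y).1 ^+ 2 + (x - y).2 ^+ 2.
have Q0 x : 0 <= Q x by rewrite addr_ge0 ?sqr_ge0.
have near x : `|f y - f x| <= e / 2 + C * Q x.
  have [xd|dx] := ltP `|y - x| d.
    apply: (@le_trans _ _ (e / 2)); last by rewrite lerDl mulr_ge0.
    by apply: dP; rewrite -ball_normE.
  apply: (@le_trans _ _ B).
    have /andP[a1 a2] := fB x; have /andP[b1 b2] := fB y.
    by rewrite ler_norml; apply/andP; split; lra.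
  apply: (@le_trans _ _ (C * Q x)); last by rewrite lerDr ltW.
  rewrite /C mulrAC ler_pdivlMr ?exprn_gt0//; apply: ler_wpM2l => //.
  apply: (@le_trans _ _ (`|y - x| ^+ 2)); first by rewrite lerXn2r ?nnegrE// ltW.
  rewrite distrC prod_normE expr2 /Q.
  case: (leP `|(x - y).1| `|(x - y).2|) => _; rewrite -expr2 real_normK ?num_real//.
    by rewrite lerDr sqr_ge0.
  by rewrite lerDl sqr_ge0.
have mQ : measurable_fun [set: pl R] (Q : pl R -> mR R).
  have mt := measurable_translate (- y); apply: measurable_funD; apply: measurable_funX.
    exact: (measurableT_comp measurable_fst mt).
  exact: (measurableT_comp measurable_snd mt).
have SQ t : 0 < t -> (smear mu t Q y <= (4 * t)%:E)%E.
  move=> t0; have h0 (h : plane) : 0 <= 1 * h.1 ^+ 2 + 2 * 0 * (h.1 * h.2) + 1 * h.2 ^+ 2.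
    by rewrite mulr0 mul0r addr0 !mul1r addr_ge0 ?sqr_ge0.
  have := heat_quadratic_le t0 h0; rewrite (_ : 2 * t * (1 + 1) = 4 * t); last by ring.
  apply: le_trans; rewrite /smear.
  have E h : 1 * h.1 ^+ 2 + 2 * 0 * (h.1 * h.2) + 1 * h.2 ^+ 2 = h.1 ^+ 2 + h.2 ^+ 2 by ring.
  under [leRHS]eq_integral do rewrite E.
  rewrite -(@integral_shift2 R (- y) (fun h => (heat t h * (h.1 ^+ 2 + h.2 ^+ 2))%:E))//.
    apply/measurable_EFinP; apply: measurable_funM; first exact: measurable_heat.
    by apply: measurable_funD; apply: measurable_funX; [exact: measurable_fst|exact: measurable_snd].
  by move=> h; rewrite lee_fin mulr_ge0 ?heat_ge0// addr_ge0 ?sqr_ge0.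
have est t : 0 < t -> `|f y - fine (smear mu t f y)| <= e / 2 + 4 * C * t.
  move=> t0.
  have mc (a : R) : measurable_fun [set: pl R] (cst a : pl R -> mR R) by exact: measurable_cst.
  have mCQ : measurable_fun [set: pl R] (C *: Q : pl R -> mR R).
    exact: (measurable_funM (mc C) mQ).
  have CQ0 x : 0 <= (C *: Q) x by rewrite mulr_ge0.
  have SCQ : (smear mu t (C *: Q)%R y <= (4 * C * t)%:E)%E.
    rewrite smearZ// (_ : 4 * C * t = C * (4 * t)); last by ring.
    by rewrite (EFinM C) lee_wpmul2l// SQ.
  have up (a b : plane -> R) : measurable_fun [set: pl R] a -> measurable_fun [set: pl R] b ->
      (forall x, 0 <= a x) -> (forall x, 0 <= b x) ->
      (forall x, a x <= b x + e / 2 + C * Q x) ->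
      (smear mu t a y <= smear mu t b y + (e / 2)%:E + (4 * C * t)%:E)%E.
    move=> ma mb a0 b0 ab.
    have mbe : measurable_fun [set: pl R] (b + cst (e / 2)) by exact: measurable_funD.
    apply: (@le_trans _ _ (smear mu t (b + cst (e / 2) + C *: Q)%R y)).
      apply: smear_le => //; first exact: measurable_funD.
      by move=> x; rewrite a0/=; exact: ab.
    rewrite !smearD// ?smear_const ?(ltW e2)//; first exact: leeD2l.
      by move=> x; rewrite ltW.
    by move=> x; rewrite addr_ge0// ltW.
  have k1 x : f x <= cst (f y) x + e / 2 + C * Q x.
    by have := near x; rewrite ler_norml => /andP[]/=; lra.
  have k2 x : cst (f y) x <= f x + e / 2 + C * Q x.
    by have := near x; rewrite ler_norml => /andP[]/=; lra.
  have := up _ _ mf (mc (f y)) f0 (fun=> f0 y) k1.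
  have := up _ _ (mc (f y)) mf (fun=> f0 y) f0 k2.
  rewrite smear_const//; case: (smear mu t f y) (Pfin t t0) => [p| |]// _.
  rewrite -!EFinD !lee_fin/= => h1 h2.
  by rewrite ler_norml; apply/andP; split; lra.
have /cvgrPdist_le/(_ (e / 2 / (4 * C + 1)) _) := @cvg_harmonic R.
have C1 : 0 < 4 * C + 1 by rewrite ltr_wpDl// mulr_ge0.
move=> /(_ (divr_gt0 e2 C1)); apply: filterS => n; rewrite sub0r normrN.
have n0 : 0 < n.+1%:R^-1 :> R by rewrite invr_gt0.
rewrite /harmonic/= gtr0_norm// => ne.
apply: le_trans (est _ n0) _.
have : 4 * C * n.+1%:R^-1 <= e / 2.
  move: ne; rewrite ler_pdivlMr//; move: n0; move: (n.+1%:R^-1) => q q0; lra.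
by move: (n.+1%:R^-1) => q; lra.
Qed.

End smear.

(** * The discrete-time energy inequality *)

Section trace_inequality.
Context {R : realType}.
Local Notation plane := (R * R)%type.
Local Notation mu := (@lebesgue2 R).
Implicit Types (f g phi u : plane -> R) (x y z h : plane) (s t e : R).

Lemma sqr_quot_le (a b p r : R) : 0 < p -> 0 < r ->
  a * b + a * b <= a ^+ 2 / p * r + b ^+ 2 / r * p.
Proof.
move=> p0 r0; rewrite -subr_ge0.
have -> : a ^+ 2 / p * r + b ^+ 2 / r * p - (a * b + a * b) = (a * r - b * p) ^+ 2 / (p * r).
  by field; rewrite !gt_eqF.
by rewrite divr_ge0 ?sqr_ge0// mulr_ge0// ltW.
Qed.

Definition int2 (F : pl R * pl R -> \bar R) : \bar R := (\int[mu]_x \int[mu]_y F (x, y))%E.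

Lemma measurable_int2 F : measurable_fun [set: pl R * pl R] F -> (forall p, 0 <= F p)%E ->
  measurable_fun [set: pl R] (fun x => \int[mu]_y F (x, y))%E.
Proof.
by move=> mF F0; exact: (@measurable_fun_fubini_tonelli_F _ _ _ _ _ (@leb2 R) _ mF F0).
Qed.

Lemma measurable_section F x : measurable_fun [set: pl R * pl R] F ->
  measurable_fun [set: pl R] (fun y => F (x, y) : \bar R).
Proof. by move=> mF; exact: (measurableT_comp mF (pair1_measurable x)). Qed.

Lemma section_ge0 F x : (forall p, 0 <= F p)%E -> (0 <= \int[mu]_y F (x, y))%E.
Proof. by move=> F0; exact: integral_ge0. Qed.

Lemma int2_ge0 F : (forall p, 0 <= F p)%E -> (0 <= int2 F)%E.
Proof. by move=> F0; apply: integral_ge0 => x _; exact: section_ge0. Qed.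

Lemma int2D F G : measurable_fun [set: pl R * pl R] F -> measurable_fun [set: pl R * pl R] G ->
  (forall p, 0 <= F p)%E -> (forall p, 0 <= G p)%E ->
  (int2 (fun p => F p + G p) = int2 F + int2 G)%E.
Proof.
move=> mF mG F0 G0; rewrite /int2 -(ge0_integralD mu measurableT
    (fun x _ => section_ge0 x F0) (measurable_int2 mF F0)
    (fun x _ => section_ge0 x G0) (measurable_int2 mG G0)).
apply: eq_integral => x _.
exact: (ge0_integralD mu measurableT (fun y _ => F0 (x, y)) (measurable_section x mF)
  (fun y _ => G0 (x, y)) (measurable_section x mG)).
Qed.

Lemma int2_le F G : measurable_fun [set: pl R * pl R] F -> measurable_fun [set: pl R * pl R] G ->
  (forall p, 0 <= F p)%E -> (forall p, F p <= G p)%E -> (int2 F <= int2 G)%E.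
Proof.
move=> mF mG F0 FG; have G0 p : (0 <= G p)%E := le_trans (F0 p) (FG p).
rewrite /int2; apply: ge0_le_integral => //.
- by move=> x _; exact: section_ge0.
- exact: measurable_int2.
- exact: measurable_int2.
move=> x _; apply: ge0_le_integral => //; exact: measurable_section.
Qed.

(** The form [<P_t f, f>], with values in the extended reals until finiteness is established. *)
Definition heat_form t f : \bar R :=
  int2 (fun p => (heat t (p.2 - p.1) * (f p.1 * f p.2))%:E).

Lemma ereal_half_le (a b : \bar R) : (0 <= a -> 0 <= b -> a + a <= b + b -> a <= b)%E.
Proof.
case: a b => [a| |] [b| |]//=; rewrite ?leey// -?EFinD ?lee_fin; lra.
Qed.

Lemma measurable_kernel2 t (F : pl R * pl R -> R) :
  measurable_fun [set: pl R * pl R] F ->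
  measurable_fun [set: pl R * pl R] (fun p : pl R * pl R => (heat t (p.2 - p.1) * F p)%:E).
Proof.
move=> mF; apply/measurable_EFinP; apply: measurable_funM => //.
exact: measurable_heat_sub.
Qed.

(* The ground state representation in discrete time: the arithmetic-geometric
   mean inequality weighted with a positive function. *)
Lemma heat_form_le t f phi :
  measurable_fun [set: pl R] f -> (forall x, 0 <= f x) ->
  measurable_fun [set: pl R] phi -> (forall x, 0 < phi x) ->
  (heat_form t f <= \int[mu]_x ((f x ^+ 2 / phi x)%:E * smear mu t phi x))%E.
Proof.
move=> mf f0 mphi phi0.
have phi0' x : 0 <= phi x by exact: ltW.
have mq : measurable_fun [set: pl R] (fun x : pl R => f x ^+ 2 / phi x : mR R).
  apply: measurable_funM; first exact: measurable_funX.
  have -> : (fun x => (phi x)^-1) = (fun x => phi x `^ (- 1)).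
    by apply/funext => x; rewrite powR_inv1.
  exact: (measurableT_comp (measurable_powR (-1)) mphi).
have q0 x : 0 <= f x ^+ 2 / phi x by rewrite divr_ge0 ?sqr_ge0.
have m1 (g : pl R -> mR R) : measurable_fun setT g ->
    measurable_fun [set: pl R * pl R] (fun p : pl R * pl R => g p.1).
  by move=> mg; exact: (measurableT_comp mg measurable_fst).
have m2 (g : pl R -> mR R) : measurable_fun setT g ->
    measurable_fun [set: pl R * pl R] (fun p : pl R * pl R => g p.2).
  by move=> mg; exact: (measurableT_comp mg measurable_snd).
pose W (p : pl R * pl R) := (heat t (p.2 - p.1) * (f p.1 ^+ 2 / phi p.1 * phi p.2))%:E.
pose W' (p : pl R * pl R) := (heat t (p.2 - p.1) * (f p.2 ^+ 2 / phi p.2 * phi p.1))%:E.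
pose A (p : pl R * pl R) := (heat t (p.2 - p.1) * (f p.1 * f p.2))%:E.
have mW : measurable_fun setT W.
  by apply: measurable_kernel2; apply: measurable_funM; [exact: (m1 _ mq)|exact: m2].
have mW' : measurable_fun setT W'.
  by apply: measurable_kernel2; apply: measurable_funM; [exact: (m2 _ mq)|exact: m1].
have mA : measurable_fun setT A.
  by apply: measurable_kernel2; apply: measurable_funM; [exact: m1|exact: m2].
have W0 p : (0 <= W p)%E by rewrite lee_fin mulr_ge0 ?heat_ge0// mulr_ge0.
have W'0 p : (0 <= W' p)%E by rewrite lee_fin mulr_ge0 ?heat_ge0// mulr_ge0.
have A0 p : (0 <= A p)%E by rewrite lee_fin mulr_ge0 ?heat_ge0// mulr_ge0.
have -> : (\int[mu]_x ((f x ^+ 2 / phi x)%:E * smear mu t phi x) =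
    int2 W)%E.
  apply: eq_integral => x _; rewrite /smear -ge0_integralZl_EFin//.
  - by apply: eq_integral => y _; rewrite /W -EFinM/=; congr (_%:E); ring.
  - by move=> y _; rewrite lee_fin mulr_ge0 ?heat_ge0.
  - exact: measurable_heatM.
have -> : heat_form t f = int2 A by [].
apply: ereal_half_le; [exact: int2_ge0|exact: int2_ge0|].
have sym : int2 W' = int2 W.
  rewrite /int2 (fubini_lebesgue2 mW' W'0); apply: eq_integral => y _; apply: eq_integral => x _.
  by rewrite /W' /W/= heat_subC.
have WW := int2D mW mW' W0 W'0; rewrite sym in WW; rewrite -WW.
rewrite -(int2D mA mA A0 A0); apply: int2_le; first exact: emeasurable_funD.
- exact: emeasurable_funD.
- by move=> p; rewrite adde_ge0.
move=> p; rewrite -!EFinD lee_fin -(mulrDr (heat _ _)) -(mulrDr (heat _ _)).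
by apply: ler_wpM2l; [exact: heat_ge0|exact: sqr_quot_le].
Qed.

(** Integrates [f x^2 + f y^2 = 2 f x f y + (f y - f x)^2] against the kernel, of mass 1 in either
    variable. Written additively, because the heat form is not yet known to be finite. *)
Lemma heat_form_increment t f : 0 < t -> L2 mu f -> (forall x, 0 <= f x) ->
  ((2 * dot mu f f)%:E <= heat_form t f + heat_form t f +
    \int[mu]_h ((heat t h)%:E * (dot mu (increment h f) (increment h f))%:E))%E.
Proof.
move=> t0 Lf f0; have mf := L2_measurable Lf.
have m1 (g : pl R -> mR R) : measurable_fun setT g ->
    measurable_fun [set: pl R * pl R] (fun p : pl R * pl R => g p.1).
  by move=> mg; exact: (measurableT_comp mg measurable_fst).
have m2 (g : pl R -> mR R) : measurable_fun setT g ->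
    measurable_fun [set: pl R * pl R] (fun p : pl R * pl R => g p.2).
  by move=> mg; exact: (measurableT_comp mg measurable_snd).
pose A (p : pl R * pl R) := (heat t (p.2 - p.1) * (f p.1 * f p.2))%:E.
pose S1 (p : pl R * pl R) := (heat t (p.2 - p.1) * f p.1 ^+ 2)%:E.
pose S2 (p : pl R * pl R) := (heat t (p.2 - p.1) * f p.2 ^+ 2)%:E.
pose D (p : pl R * pl R) := (heat t (p.2 - p.1) * (f p.2 - f p.1) ^+ 2)%:E.
have mA : measurable_fun setT A.
  by apply: measurable_kernel2; apply: measurable_funM; [exact: m1|exact: m2].
have mS1 : measurable_fun setT S1.
  by apply: measurable_kernel2; apply: measurable_funX; exact: m1.
have mS2 : measurable_fun setT S2.
  by apply: measurable_kernel2; apply: measurable_funX; exact: m2.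
have mD : measurable_fun setT D.
  by apply: measurable_kernel2; apply: measurable_funX; apply: measurable_funB; [exact: m2|exact: m1].
have A0 p : (0 <= A p)%E by rewrite lee_fin mulr_ge0 ?heat_ge0// mulr_ge0.
have S10 p : (0 <= S1 p)%E by rewrite lee_fin mulr_ge0 ?heat_ge0// sqr_ge0.
have S20 p : (0 <= S2 p)%E by rewrite lee_fin mulr_ge0 ?heat_ge0// sqr_ge0.
have D0 p : (0 <= D p)%E by rewrite lee_fin mulr_ge0 ?heat_ge0// sqr_ge0.
have heatI y : (\int[mu]_x (heat t (x - y))%:E = 1)%E by exact: integral_heat.
have mh y : measurable_fun [set: pl R] (fun x : pl R => (heat t (x - y))%:E).
  by apply/measurable_EFinP; exact: measurable_heat_shift.
have h0 x : (0 <= (heat t x)%:E)%E by rewrite lee_fin heat_ge0.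
have I1 : (int2 S1 = (dot mu f f)%:E)%E.
  rewrite dotE//; apply: eq_integral => x _; rewrite /S1/=.
  under eq_integral do rewrite EFinM.
  by rewrite ge0_integralZr// ?heatI ?mul1e// lee_fin sqr_ge0.
have I2 : (int2 S2 = (dot mu f f)%:E)%E.
  rewrite /int2 (fubini_lebesgue2 mS2 S20) dotE//; apply: eq_integral => y _; rewrite /S2/=.
  under eq_integral do rewrite EFinM heat_subC.
  by rewrite ge0_integralZr// ?heatI ?mul1e// lee_fin sqr_ge0.
have ID : (int2 D =
    \int[mu]_h ((heat t h)%:E * (dot mu (increment h f) (increment h f))%:E))%E.
  pose D' (p : pl R * pl R) := ((heat t p.2)%:E * ((increment p.2 f p.1) ^+ 2)%:E)%E.
  have mD' : measurable_fun setT D'.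
    apply: emeasurable_funM.
      by apply/measurable_EFinP; exact: (m2 _ (measurable_heat t)).
    apply/measurable_EFinP; apply: measurable_funX; apply: measurable_funB; last exact: m1.
    apply: (measurableT_comp mf).
    by apply: measurable_fun_pair; apply: measurable_funD; apply: measurableT_comp.
  have D'0 p : (0 <= D' p)%E by rewrite mule_ge0// lee_fin sqr_ge0.
  transitivity (\int[mu]_x \int[mu]_h D' (x, h))%E.
    apply: eq_integral => x _; rewrite -(@integral_shift2 R x (fun y => D (x, y)))//; last exact: measurable_section.
    by apply: eq_integral => h _; rewrite /D/D'/= -EFinM addrK /increment !fctE (addrC h).
  rewrite (fubini_lebesgue2 mD' D'0); apply: eq_integral => h _; rewrite dotE; last exact: increment_L2.
  have sq0 x : [set: pl R] x -> (0 <= (increment h f x ^+ 2)%:E)%E by rewrite lee_fin sqr_ge0.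
  have mi := measurable_sqr (L2_measurable (increment_L2 h Lf)).
  by rewrite -(ge0_integralZl mu measurableT mi sq0 (h0 h)).
rewrite mulr_natl mulr2n EFinD -{1}I1 -I2 -ID.
have -> : heat_form t f = int2 A by [].
rewrite -(int2D mS1 mS2 S10 S20) -(int2D mA mA A0 A0).
have mAA : measurable_fun setT (fun p => A p + A p)%E by exact: emeasurable_funD.
have AA0 p : (0 <= A p + A p)%E by rewrite adde_ge0.
rewrite -(int2D mAA mD AA0 D0); apply: int2_le.
- exact: emeasurable_funD.
- exact: emeasurable_funD.
- by move=> p; rewrite adde_ge0.
move=> p; rewrite -!EFinD lee_fin le_eqVlt; apply/orP; left; apply/eqP.
by rewrite /=; ring.
Qed.

End trace_inequality.

(** * Heat potentials of a finite measure *)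

Section heat_potential.
Context {R : realType}.
Local Notation plane := (R * R)%type.
Local Notation mu := (@lebesgue2 R).
Variable m : {finite_measure set (pl R) -> \bar R}.
Implicit Types (f g u : plane -> R) (x y z h : plane) (s t e k c : R).

Definition potential s y : R := fine (smear m s (cst 1%R) y).

Let c1 : measurable_fun [set: pl R] (cst 1 : pl R -> mR R).
Proof. exact: measurable_cst. Qed.

(** The maximum of the kernel times the mass: crude, but valid at every point of the plane and
    decaying in [s]. It makes the potentials finite and controls the tail of the resolvent sum. *)
Lemma smear_mass_le s y : 0 < s ->
  (smear m s (cst 1%R) y <= ((4 * pi * s)^-1 * fine (m setT))%:E)%E.
Proof.
move=> s0; have mfin : m setT \is a fin_num by exact: fin_num_measure.
rewrite EFinM fineK// -integral_cst//.
apply: ge0_le_integral => //.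
- by move=> x _; rewrite lee_fin mulr_ge0 ?heat_ge0.
- exact: measurable_heatM.
- by move=> x _; rewrite lee_fin/= mulr1 heat_max.
Qed.

Lemma potentialE s y : 0 < s -> (potential s y)%:E = smear m s (cst 1%R) y.
Proof.
move=> s0; rewrite fineK// ge0_fin_numE; first exact: le_lt_trans (smear_mass_le y s0) (ltry _).
by apply: smear_ge0 => x.
Qed.

Lemma potential_ge0 s y : 0 <= potential s y.
Proof. by rewrite fine_ge0//; apply: smear_ge0 => x. Qed.

Lemma measurable_potential s : 0 < s ->
  measurable_fun [set: pl R] (potential s : pl R -> mR R).
Proof.
move=> s0; apply/measurable_EFinP.
have -> : EFin \o potential s = smear m s (cst 1%R) by apply/funext => y; rewrite /= potentialE.
by apply: measurable_smear.
Qed.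

Lemma smear_potential s t y : 0 < s -> 0 < t ->
  smear mu t (potential s) y = (potential (s + t) y)%:E.
Proof.
move=> s0 t0; rewrite potentialE ?addr_gt0//.
pose F (p : pl R * pl R) := (heat t (p.1 - y) * heat s (p.2 - p.1))%:E.
have mF : measurable_fun [set: pl R * pl R] F.
  apply/measurable_EFinP; apply: measurable_funM; last exact: measurable_heat_sub.
  exact: (measurableT_comp (measurable_heat_shift t y) measurable_fst).
have F0 p : (0 <= F p)%E by rewrite lee_fin mulr_ge0 ?heat_ge0.
transitivity (\int[mu]_x \int[m]_z F (x, z))%E.
  apply: eq_integral => x _; rewrite EFinM potentialE// /smear -ge0_integralZl_EFin//.
  - by apply: eq_integral => z _; rewrite -EFinM/= mulr1.
  - by move=> z _; rewrite lee_fin mulr_ge0 ?heat_ge0.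
  - exact: measurable_heatM.
  - exact: heat_ge0.
rewrite (tonelli_mu m mF F0); apply: eq_integral => z _.
rewrite /= mulr1 -(heat_semigroup z y s0 t0); apply: eq_integral => x _.
by rewrite /F/= mulrC.
Qed.

Lemma integral_smear t f : measurable_fun [set: pl R] f -> (forall x, 0 <= f x) -> 0 < t ->
  (\int[m]_y smear mu t f y = \int[mu]_x (f x * potential t x)%:E)%E.
Proof.
move=> mf f0 t0; pose F (p : pl R * pl R) := (heat t (p.2 - p.1) * f p.1)%:E.
have mF : measurable_fun [set: pl R * pl R] F.
  apply/measurable_EFinP; apply: measurable_funM; first exact: measurable_heat_sub.
  exact: (measurableT_comp mf measurable_fst).
have F0 p : (0 <= F p)%E by rewrite lee_fin mulr_ge0 ?heat_ge0.
transitivity (\int[m]_y \int[mu]_x F (x, y))%E.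
  by apply: eq_integral => y _; apply: eq_integral => x _; rewrite /F/= heat_subC.
rewrite -(tonelli_mu m mF F0); apply: eq_integral => x _.
rewrite EFinM potentialE// /smear -ge0_integralZl_EFin//.
- by apply: eq_integral => y _; rewrite /F -EFinM/=; congr (_%:E); ring.
- by move=> y _; rewrite lee_fin mulr_ge0 ?heat_ge0.
- exact: measurable_heatM.
Qed.

(* The truncated Riemann sum [e + t * \sum_n q^n P_(n t) m] of the resolvent
   [\int_0^oo e^(-k^2 s) P_s m ds], where [q = e^(-k^2 t)]. *)
Definition resolvent_sum e t q N x : R :=
  e + t * \sum_(n < N) q ^+ n.+1 * potential (n.+1%:R * t) x.

Section resolvent_sum.
Variables (e t q : R).
Hypotheses (e0 : 0 < e) (t0 : 0 < t) (q0 : 0 < q) (q1 : q < 1).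

Let nt0 n : 0 < n.+1%:R * t. Proof. by rewrite mulr_gt0. Qed.

Lemma resolvent_sum_gt0 N x : 0 < resolvent_sum e t q N x.
Proof.
rewrite ltr_wpDr// mulr_ge0 ?(ltW t0)//; apply: sumr_ge0 => n _.
by rewrite mulr_ge0 ?potential_ge0// exprn_ge0// ltW.
Qed.

Lemma measurable_resolvent_sum N :
  measurable_fun [set: pl R] (resolvent_sum e t q N : pl R -> mR R).
Proof.
apply: measurable_funD => //; apply: measurable_funM => //.
apply: measurable_sum => n; apply: measurable_funM => //; exact: measurable_potential.
Qed.

Lemma smear_resolvent_sum N y : smear mu t (resolvent_sum e t q N) y =
  (e + t * \sum_(n < N) q ^+ n.+1 * potential (n.+2%:R * t) y)%:E.
Proof.
elim: N => [|N ih].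
  rewrite big_ord0 mulr0 addr0 -(smear_const y t0 (ltW e0)).
  by congr (smear _ _ _ _); apply/funext => x; rewrite /resolvent_sum big_ord0 mulr0 addr0.
have -> : resolvent_sum e t q N.+1 =
    resolvent_sum e t q N + (t * q ^+ N.+1) *: potential (N.+1%:R * t).
  apply/funext => x; rewrite /resolvent_sum big_ord_recr !fctE (mulrDr t) addrA.
  by rewrite (mulrA t).
have mp := measurable_potential (nt0 N).
have tq0 : 0 <= t * q ^+ N.+1 by rewrite mulr_ge0 ?exprn_ge0// ltW.
rewrite smearD; last 4 first.
- exact: measurable_resolvent_sum.
- exact: (measurable_funM (measurable_cst _) mp).
- by move=> x; rewrite ltW ?resolvent_sum_gt0.
- by move=> x; rewrite mulr_ge0 ?potential_ge0.
rewrite ih smearZ//; last by move=> x; exact: potential_ge0.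
rewrite smear_potential// -EFinM -EFinD.
have -> : N.+1%:R * t + t = N.+2%:R * t by rewrite -[N.+2%:R]natr1 mulrDl mul1r.
by rewrite [in RHS]big_ord_recr (mulrDr t) addrA (mulrA t).
Qed.

(** The discrete form of [- Delta phi + k^2 phi >= m]. Applying [q P_t] shifts the sum by one term:
    the first one, [t q P_t m], drops out, and a term at time [(N + 1) t] appears. For large [N] the
    latter is at most [e (1 - q)], the amount by which the constant [e] shrinks. *)
Lemma resolvent_sum_super : exists N, forall x,
  q * fine (smear mu t (resolvent_sum e t q N) x) + t * q * potential t x <=
  resolvent_sum e t q N x.
Proof.
pose M := fine (m setT).
have q'0 : 0 < 1 - q by rewrite subr_gt0.
have eq0 : 0 < e * (1 - q) by rewrite mulr_gt0.
have M0 : 0 <= M by rewrite fine_ge0.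
have p4 : 0 < 4 * pi :> R by rewrite mulr_gt0 ?pi_gt0.
have [N hN] : exists N : nat, t * ((4 * pi * (N.+1%:R * t))^-1 * M) <= e * (1 - q).
  have d0 : 0 < e * (1 - q) * (4 * pi) / (M + 1) by apply: divr_gt0; [exact: mulr_gt0|rewrite ltr_wpDl].
  have [N] := ltr_add_invr d0; rewrite add0r => h; exists N.
  have -> : t * ((4 * pi * (N.+1%:R * t))^-1 * M) = N.+1%:R^-1 * (M / (4 * pi)).
    have p0 : pi != 0 :> R by rewrite gt_eqF ?pi_gt0.
    have tn0 : t != 0 by rewrite gt_eqF.
    have n0 : N.+1%:R != 0 :> R by rewrite pnatr_eq0.
    move: p0 n0; move: (N.+1%:R) (pi : R) => a p p0 a0.
    by field; rewrite p0 tn0 a0.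
  rewrite mulrA ler_pdivrMr//.
  move: h; rewrite ltr_pdivlMr ?ltr_wpDl// => /ltW; apply: le_trans.
  by rewrite ler_wpM2l// ?invr_ge0//; lra.
exists N => x; rewrite smear_resolvent_sum/=.
rewrite /resolvent_sum.
have E : \sum_(n < N) q ^+ n.+2 * potential (n.+2%:R * t) x + q * potential t x =
    \sum_(n < N) q ^+ n.+1 * potential (n.+1%:R * t) x + q ^+ N.+1 * potential (N.+1%:R * t) x.
  pose F n := q ^+ n.+1 * potential (n.+1%:R * t) x.
  have h : \sum_(n < N.+1) F n = \sum_(n < N) F n + F N by rewrite big_ord_recr.
  rewrite big_ord_recl in h.
  by rewrite -/(F N) -[RHS]h [RHS]addrC /F/= mul1r expr1.
have Eq : q * \sum_(n < N) q ^+ n.+1 * potential (n.+2%:R * t) x =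
    \sum_(n < N) q ^+ n.+2 * potential (n.+2%:R * t) x.
  by rewrite mulr_sumr; apply: eq_bigr => n _; rewrite mulrA -exprS.
have pN : potential (N.+1%:R * t) x <= (4 * pi * (N.+1%:R * t))^-1 * M.
  by rewrite -lee_fin potentialE//; exact: smear_mass_le.
have qN : q ^+ N.+1 * potential (N.+1%:R * t) x <= (4 * pi * (N.+1%:R * t))^-1 * M.
  by apply: le_trans pN; apply: ler_piMl; [exact: potential_ge0|apply: exprn_ile1; exact: ltW].
have := ler_wpM2l (ltW t0) qN => h.
rewrite mulrDr mulrCA Eq.
have := congr1 (fun a => t * a) E; rewrite !mulrDr.
set A := t * _; set B := t * \sum_(n < N) _; move: h hN.
set C := t * (q ^+ N.+1 * _); set D := t * (_ * M).
clearbody A B C D; lra.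
Qed.

End resolvent_sum.

(** The smeared sum starts at time [2 t]. After multiplication by [q] the powers of [q] match the
    times, which leaves the sum of [heat_sum_le] without its first term; this is the origin of the
    factor [q^-1]. *)
Lemma smear_resolvent_sum_le c k e t y N : 0 < c -> 0 < k -> 0 < e -> 0 < t ->
  (forall s, 0 < s -> potential s y <= (c * Num.sqrt (4 * pi * s))^-1) ->
  fine (smear mu t (resolvent_sum e t (expR (- (k ^+ 2 * t))) N) y) <=
  e + (expR (- (k ^+ 2 * t)))^-1 * (2 * k * c)^-1.
Proof.
move=> c0 k0 e0 t0 py; set q := expR _; have q0 : 0 < q by exact: expR_gt0.
rewrite (smear_resolvent_sum e0 t0 q0)/= lerD2l.
rewrite -(ler_pM2l q0) [leRHS]mulrA divff ?gt_eqF// mul1r.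
have heat := heat_sum_le N.+1 k0 t0; rewrite -/q in heat.
have -> : (2 * k * c)^-1 = c^-1 * (2 * k)^-1 by rewrite invfM mulrC.
have ci : 0 <= c^-1 by rewrite invr_ge0 ltW.
apply: le_trans (ler_wpM2l ci heat).
rewrite mulrCA [leRHS]mulrCA; apply: ler_wpM2l; first exact: ltW.
rewrite !mulr_sumr big_ord_recl; apply: ler_wpDl.
  by rewrite !mulr_ge0 ?exprn_ge0 ?invr_ge0 ?sqrtr_ge0// ltW.
apply: ler_sum => n _; rewrite [leLHS]mulrA -exprS (mulrCA c^-1) /bump/=.
apply: ler_wpM2l; first by rewrite exprn_ge0// ltW.
by rewrite -invfM; apply: py; rewrite mulr_gt0.
Qed.

End heat_potential.

Section trace_inequality.
Context {R : realType}.
Local Notation plane := (R * R)%type.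
Local Notation mu := (@lebesgue2 R).
Variables (m : {finite_measure set (pl R) -> \bar R}) (G : set (R * R)) (c : R).
Hypotheses (c0 : 0 < c) (mG : {ae m, forall y, G y}).
Hypothesis potential_le : forall y (s : R), G y -> 0 < s ->
  potential m s y <= (c * Num.sqrt (4 * pi * s))^-1.
Implicit Types (f g u : plane -> R) (x y z h : plane) (s t e k : R).

Section fixed_time.
Variables (f : plane -> R) (B E k e t : R).
Hypotheses (Lf : L2 mu f) (fB : forall x, 0 <= f x <= B).
Hypotheses (k0 : 0 < k) (e0 : 0 < e) (t0 : 0 < t) (E0 : 0 <= E).
Hypothesis incr_le : (\int[mu]_h ((heat t h)%:E *
  (dot mu (increment h f) (increment h f))%:E) <= (2 * t * E)%:E)%E.
Local Notation q := (expR (- (k ^+ 2 * t))).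
Local Notation K := (e + q^-1 * (2 * k * c)^-1).

Let f0 x : 0 <= f x. Proof. by have /andP[] := fB x. Qed.

Let mf : measurable_fun [set: pl R] (f : pl R -> mR R). Proof. exact: (L2_measurable Lf). Qed.

Let q0 : 0 < q. Proof. exact: expR_gt0. Qed.

Let q1 : q < 1.
Proof. by rewrite -[ltRHS]expR0 ltr_expR oppr_lt0 mulr_gt0 ?exprn_gt0. Qed.

Let K0 : 0 < K.
Proof. by rewrite addr_gt0// mulr_gt0 ?invr_gt0// !mulr_gt0. Qed.

Lemma smear_fin y : smear mu t f y \is a fin_num.
Proof.
have B0 : 0 <= B by apply: le_trans (f0 0) _; have /andP[] := fB 0.
rewrite ge0_fin_numE ?smear_ge0//; apply: le_lt_trans (ltry B).
by rewrite -(smear_const y t0 B0); apply: smear_le.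
Qed.

Lemma measurable_fine_smear : measurable_fun [set: pl R] (fun y => fine (smear mu t f y) : mR R).
Proof.
apply/measurable_EFinP; have -> : EFin \o (fun y => fine (smear mu t f y)) = smear mu t f.
  by apply/funext => y; rewrite /= fineK// smear_fin.
exact: measurable_smear_mu.
Qed.

Section weight.
Variable N : nat.
Local Notation phi := (resolvent_sum m e t q N).

Let phi0 x : 0 < phi x. Proof. exact: resolvent_sum_gt0. Qed.

Let mphi : measurable_fun [set: pl R] (phi : pl R -> mR R).
Proof. exact: measurable_resolvent_sum. Qed.

Let w x : R := f x ^+ 2 / phi x.

Let w0 x : 0 <= w x. Proof. by rewrite divr_ge0 ?sqr_ge0// ltW. Qed.

Let mw : measurable_fun [set: pl R] (w : pl R -> mR R).
Proof.
apply: measurable_funM; first exact: measurable_funX.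
have -> : (fun x => (phi x)^-1) = (fun x => phi x `^ (- 1)).
  by apply/funext => x; rewrite powR_inv1// ltW.
exact: (measurableT_comp (measurable_powR (-1)) mphi).
Qed.

(* Maximizing [2 th P - th ^+ 2 K] over [th]. *)
Let smear_weight_ge y : G y -> ((fine (smear mu t f y) ^+ 2 / K)%:E <= smear mu t w y)%E.
Proof.
move=> Gy; pose th := fine (smear mu t f y) / K.
have P0 : 0 <= fine (smear mu t f y) by rewrite fine_ge0// smear_ge0.
have th0 : 0 <= th by rewrite divr_ge0// ltW.
have phi0' x : 0 <= phi x by rewrite ltW.
have m1 : measurable_fun [set: pl R] ((2 * th) *: f : pl R -> mR R).
  by apply: measurable_funM; [exact: measurable_cst|exact: mf].
have m2 : measurable_fun [set: pl R] ((th ^+ 2) *: phi : pl R -> mR R).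
  by apply: measurable_funM; [exact: measurable_cst|exact: mphi].
have p2 x : 0 <= ((th ^+ 2) *: phi) x by apply: mulr_ge0; [exact: sqr_ge0|exact: phi0'].
have th2 : 0 <= 2 * th by rewrite mulr_ge0.
have h : (smear mu t ((2 * th) *: f)%R y <= smear mu t (w + (th ^+ 2) *: phi)%R y)%E.
  apply: smear_le => //; first exact: measurable_funD.
  move=> x; apply/andP; split; first exact: mulr_ge0.
  have -> : (w + (th ^+ 2) *: phi) x = f x ^+ 2 / phi x + th ^+ 2 * phi x by [].
  have -> : ((2 * th) *: f) x = 2 * th * f x by [].
  rewrite -subr_ge0; have px := phi0 x.
  have -> : f x ^+ 2 / phi x + th ^+ 2 * phi x - 2 * th * f x = (f x - th * phi x) ^+ 2 / phi x.
    by move: (phi x) px => p px; field; rewrite gt_eqF.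
  by rewrite divr_ge0 ?sqr_ge0.
have L : smear mu t ((2 * th) *: f)%R y = (2 * th * fine (smear mu t f y))%:E.
  by rewrite smearZ// [RHS]EFinM fineK// smear_fin.
have psi_fin : smear mu t phi y = (fine (smear mu t phi y))%:E.
  by rewrite smear_resolvent_sum.
have Rr : (smear mu t (w + (th ^+ 2) *: phi)%R y =
    smear mu t w y + (th ^+ 2 * fine (smear mu t phi y))%:E)%E.
  by rewrite smearD// smearZ ?sqr_ge0// [in RHS]EFinM -psi_fin.
have Kb := smear_resolvent_sum_le N c0 k0 e0 t0 (fun s => @potential_le y s Gy).
rewrite L Rr in h.
have : ((2 * th * fine (smear mu t f y))%:E <= smear mu t w y + (th ^+ 2 * K)%:E)%E.
  apply: le_trans h _; apply: leeD2l; rewrite lee_fin; apply: ler_wpM2l => //.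
  exact: sqr_ge0.
have -> : 2 * th * fine (smear mu t f y) = fine (smear mu t f y) ^+ 2 / K + th ^+ 2 * K.
  rewrite /th; move: (fine _) K0; move: (K) => kk p kk0; field; rewrite gt_eqF//.
by rewrite EFinD leeD2rE.
Qed.

(** [heat_form_le] bounds the heat form by the integral of [w] against [P_t phi], and by symmetry of
    the kernel the curve integral of [P_t w] is the integral of [w] against [P_t m]. By the
    supersolution property the two add up to at most the integral of [w phi = f^2]; on the curve
    [P_t w] is at least [(P_t f)^2 / K]. *)
Lemma weighted_bound :
  (forall x, q * fine (smear mu t phi x) + t * q * potential m t x <= phi x) ->
  (q%:E * heat_form t f + (t * q)%:E *
     \int[m]_y (fine (smear mu t f y) ^+ 2 / K)%:E <= (dot mu f f)%:E)%E.
Proof.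
move=> super; have psiE x : smear mu t phi x = (fine (smear mu t phi x))%:E.
  by rewrite smear_resolvent_sum.
have psi0 x : 0 <= fine (smear mu t phi x).
  by rewrite fine_ge0// smear_ge0// => z; rewrite ltW.
have mpsi : measurable_fun [set: pl R] (fun x => fine (smear mu t phi x) : mR R).
  apply/measurable_EFinP.
  have -> : EFin \o (fun y => fine (smear mu t phi y)) = smear mu t phi.
    by apply/funext => y; rewrite /= -psiE.
  by apply: measurable_smear_mu => // x; rewrite ltW.
have mp := measurable_potential m t0.
have m1 : measurable_fun [set: pl R] (fun x => (w x * fine (smear mu t phi x))%:E).
  by apply/measurable_EFinP; exact: measurable_funM.
have m2 : measurable_fun [set: pl R] (fun x => (w x * potential m t x)%:E).
  by apply/measurable_EFinP; exact: measurable_funM.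
have n1 x : (0 <= (w x * fine (smear mu t phi x))%:E)%E by rewrite lee_fin mulr_ge0.
have n2 x : (0 <= (w x * potential m t x)%:E)%E by rewrite lee_fin mulr_ge0 ?potential_ge0.
have tq0 : 0 <= t * q by rewrite mulr_ge0// ltW.
have H1 : (heat_form t f <= \int[mu]_x (w x * fine (smear mu t phi x))%:E)%E.
  apply: le_trans (heat_form_le t mf f0 mphi phi0) _.
  rewrite le_eqVlt; apply/orP; left; apply/eqP; apply: eq_integral => x _.
  by rewrite psiE.
have H2 : (\int[m]_y (fine (smear mu t f y) ^+ 2 / K)%:E <=
    \int[mu]_x (w x * potential m t x)%:E)%E.
  rewrite -(integral_smear m mw w0 t0); apply: ae_ge0_le_integral => //.
  - by move=> y _; rewrite lee_fin divr_ge0 ?sqr_ge0// ltW.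
  - apply/measurable_EFinP; apply: measurable_funM => //.
    by apply: measurable_funX; exact: measurable_fine_smear.
  - by move=> y _; exact: smear_ge0.
  - exact: measurable_smear_mu.
  - by apply: filterS mG => y Gy _; exact: smear_weight_ge.
have q0' : (0 <= q%:E)%E by rewrite lee_fin ltW.
have tq0' : (0 <= (t * q)%:E)%E by rewrite lee_fin.
apply: le_trans (leeD (lee_wpmul2l q0' H1) (lee_wpmul2l tq0' H2)) _.
have Z (a : R) (g : plane -> R) : measurable_fun [set: pl R] (fun x => (g x)%:E) ->
    (forall x, 0 <= (g x)%:E)%E -> 0 <= a ->
    (a%:E * \int[mu]_x (g x)%:E = \int[mu]_x (a%:E * (g x)%:E))%E.
  by move=> mg g0 a0; rewrite (ge0_integralZl_EFin mu measurableT (fun x _ => g0 x) mg a0).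
have Zm (a : R) (g : plane -> R) : measurable_fun [set: pl R] (fun x => (g x)%:E) ->
    measurable_fun [set: pl R] (fun x => a%:E * (g x)%:E)%E.
  by move=> mg; exact: emeasurable_funM.
have Z0 (a : R) (g : plane -> R) : (forall x, 0 <= (g x)%:E)%E -> 0 <= a ->
    forall x, [set: pl R] x -> (0 <= a%:E * (g x)%:E)%E.
  by move=> g0 a0 x _; rewrite mule_ge0.
rewrite (Z q _ m1 n1 (ltW q0)) (Z (t * q) _ m2 n2 tq0).
rewrite -(ge0_integralD mu measurableT (Z0 q _ n1 (ltW q0)) (Zm q _ m1)
  (Z0 (t * q) _ n2 tq0) (Zm (t * q) _ m2)).
rewrite dotE//; apply: ge0_le_integral => //.
- by move=> x _; apply: adde_ge0; [exact: (Z0 q _ n1 (ltW q0))|exact: (Z0 (t * q) _ n2 tq0)].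
- by apply: emeasurable_funD; exact: Zm.
- exact: measurable_sqr.
move=> x _; rewrite -!EFinM -EFinD lee_fin.
have := ler_wpM2l (w0 x) (super x); rewrite {2}/w divfK ?gt_eqF// => h.
by apply: le_trans h; rewrite le_eqVlt; apply/orP; left; apply/eqP; ring.
Qed.

End weight.

(** By [heat_form_increment], [<f, f> - q <P_t f, f>] is at most [(1 - q) <f, f> + q t E]. With
    [1 - q <= k^2 t] everything is of order [t], and [t] is divided out. *)
Lemma fixed_time_bound :
  (\int[m]_y (q / K * fine (smear mu t f y) ^+ 2)%:E <= (k ^+ 2 * dot mu f f + E)%:E)%E.
Proof.
have [N super] := resolvent_sum_super m e0 t0 q0 q1.
have := weighted_bound super.
have H := le_trans (heat_form_increment t0 Lf f0) (leeD2l _ incr_le).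
have hf0 : (0 <= heat_form t f)%E.
  by apply: int2_ge0 => p; rewrite lee_fin mulr_ge0 ?heat_ge0// mulr_ge0.
set X := (\int[m]_y _)%E.
have X0 : (0 <= X)%E by apply: integral_ge0 => y _; rewrite lee_fin divr_ge0 ?sqr_ge0// ltW.
have -> : (\int[m]_y (q / K * fine (smear mu t f y) ^+ 2)%:E = q%:E * X)%E.
  have sq0 y : [set: pl R] y -> (0 <= (fine (smear mu t f y) ^+ 2 / K)%:E)%E.
    by move=> _; rewrite lee_fin divr_ge0 ?sqr_ge0// ltW.
  have msq : measurable_fun [set: pl R] (fun y => (fine (smear mu t f y) ^+ 2 / K)%:E).
    apply/measurable_EFinP; apply: measurable_funM => //.
    by apply: measurable_funX; exact: measurable_fine_smear.
  rewrite /X -(ge0_integralZl_EFin m measurableT sq0 msq (ltW q0)).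
  by apply: eq_integral => y _; rewrite -EFinM; congr (_%:E); rewrite [LHS]mulrAC [RHS]mulrA.
have tq : 0 < t * q by rewrite mulr_gt0.
have ql : 1 - k ^+ 2 * t <= q by have := expR_ge1Dx (- (k ^+ 2 * t)).
have U0 := dot_ge0 mu f; move: H hf0 X0.
have qn0 := q0; move: qn0 q1 ql tq; move: (q) (dot mu f f) U0 => r U U0 r0 r1 ql tq.
(* The upper bound [<f, f>] in [weighted_bound] excludes infinite values of the heat form and of the
   curve integral, after which the argument is linear arithmetic. *)
case: (heat_form t f) => [a| |]//; last first.
  by move=> _ _; case: (X) => [b| |]// _; rewrite gt0_muley ?lte_fin// ?gt0_muley ?lte_fin//.
move=> H a0; case: (X) => [b| |]// b0; last first.
  by rewrite gt0_muley ?lte_fin// addey// leye_eq.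
move: H b0; rewrite -!EFinM -!EFinD !lee_fin => H b0 W.
have rH := ler_wpM2l (ltW r0) H.
have tb : t * (r * b) <= t * (k ^+ 2 * U + E).
  have h1 := ler_wpM2r U0 ql.
  have h2 : r * (t * E) <= t * E by rewrite ler_piMl ?(ltW r1)// mulr_ge0// ltW.
  by lra.
by move: tb; rewrite ler_pM2l.
Qed.

End fixed_time.
End trace_inequality.

(** * The limit of vanishing time step *)

Section trace_inequality_limit.
Context {R : realType}.
Local Notation plane := (R * R)%type.
Local Notation mu := (@lebesgue2 R).
Implicit Types (f g u : plane -> R) (x y z h : plane) (s t e k : R).

Lemma bounded_L2 (m : {finite_measure set (pl R) -> \bar R}) u (B : R) :
  measurable_fun [set: pl R] u -> (forall x, `|u x| <= B) -> L2 m u.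
Proof.
move=> mu' uB; split => //.
apply: (@le_lt_trans _ _ (\int[m]_x (B ^+ 2)%:E)%E).
  apply: ge0_le_integral => //.
  - by move=> x _; rewrite lee_fin sqr_ge0.
  - exact: measurable_sqr.
  - move=> x _; rewrite lee_fin -[leLHS]real_normK ?num_real//.
    by rewrite lerXn2r ?nnegrE// (le_trans (normr_ge0 _) (uB 0)).
rewrite integral_cst//; apply: lte_mul_pinfty => //; first by rewrite lee_fin sqr_ge0.
exact: fin_num_fun_lty (fin_num_measure m).
Qed.

(** The weighted inequality needs a nonnegative function, hence [|u|]. Its increments are dominated
    pointwise by those of [u], so the weak derivatives of [|u|] never have to be considered; the
    factor [2 t] is the second moment of the kernel. *)
Lemma heat_increment_le t u : 0 < t -> H1 u ->
  (\int[mu]_h ((heat t h)%:E * (dot mu (increment h (fun x => `|u x|))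
    (increment h (fun x => `|u x|)))%:E) <= (2 * t * grad_dot u u)%:E)%E.
Proof.
move=> t0 Hu; have Lu := L2_H1 Hu; pose f x : R := `|u x|.
have mf : measurable_fun [set: pl R] (f : pl R -> mR R).
  by apply: measurableT_comp => //; exact: (L2_measurable Lu).
have Lf : L2 mu f.
  split => //; have := Lu.2; congr (_ < _)%E; apply: eq_integral => x _.
  by rewrite /f real_normK ?num_real.
have Lw j : L2 mu (wderiv j u) := wderiv_L2 j Hu.
pose D h : R := dot mu (increment h f) (increment h f).
have mD : measurable_fun [set: pl R] (fun h => (D h)%:E).
  pose F (p : pl R * pl R) := ((f (p.2 + p.1)%R - f p.2) ^+ 2)%:E.
  have mF : measurable_fun [set: pl R * pl R] F.
    apply/measurable_EFinP; apply: measurable_funX; apply: measurable_funB.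
      apply: (measurableT_comp mf).
      by apply: measurable_fun_pair; apply: measurable_funD; apply: measurableT_comp.
    exact: (measurableT_comp mf measurable_snd).
  have F0 p : (0 <= F p)%E by rewrite lee_fin sqr_ge0.
  have := measurable_int2 mF F0; congr measurable_fun; apply/funext => h.
  by rewrite /D dotE//; exact: increment_L2.
pose A := dot mu (wderiv false u) (wderiv false u).
pose B := dot mu (wderiv false u) (wderiv true u).
pose C := dot mu (wderiv true u) (wderiv true u).
have DQ h : D h <= A * h.1 ^+ 2 + 2 * B * (h.1 * h.2) + C * h.2 ^+ 2.
  rewrite -(dot_directionalE h Lw); apply: le_trans (H1_increment_le h Hu).
  rewrite -lee_fin !dotE//; [|exact: increment_L2|exact: increment_L2].
  apply: ge0_le_integral => //.
  - by move=> x _; rewrite lee_fin sqr_ge0.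
  - by apply: measurable_sqr; exact: (L2_measurable (increment_L2 h Lf)).
  - by apply: measurable_sqr; exact: (L2_measurable (increment_L2 h Lu)).
  - move=> x _; rewrite lee_fin -[leLHS]real_normK ?num_real// -[leRHS]real_normK ?num_real//.
    by rewrite lerXn2r ?nnegrE//; exact: ler_dist_dist.
have Q0 h : 0 <= A * h.1 ^+ 2 + 2 * B * (h.1 * h.2) + C * h.2 ^+ 2.
  by rewrite -(dot_directionalE h Lw) dot_ge0.
apply: le_trans (heat_quadratic_le t0 Q0); apply: ge0_le_integral => //.
- by move=> h _; rewrite -EFinM lee_fin mulr_ge0 ?heat_ge0 ?dot_ge0.
- by apply: emeasurable_funM => //; apply/measurable_EFinP; exact: measurable_heat.
- have m1 : measurable_fun [set: pl R] (fst : pl R -> mR R) := measurable_fst.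
  have m2 : measurable_fun [set: pl R] (snd : pl R -> mR R) := measurable_snd.
  apply/measurable_EFinP; apply: measurable_funM; first exact: measurable_heat.
  apply: measurable_funD; last by apply: measurable_funM => //; exact: measurable_funX.
  apply: measurable_funD; first by apply: measurable_funM => //; exact: measurable_funX.
  by apply: measurable_funM => //; exact: measurable_funM.
- by move=> h _; rewrite -EFinM lee_fin ler_wpM2l ?heat_ge0//; exact: DQ.
Qed.

(** The choice [k = a / (2 c)] makes the bound [1 / (2 k c)] on the potential equal to [1 / a], so
    [q n / K n] tends to [a]. The averages of [|u|] converge pointwise by continuity, and Fatou
    passes to the limit in the curve integral. *)
Lemma trace_inequality (m : {finite_measure set (pl R) -> \bar R}) (G : set (R * R))
    (a c B : R) u : 0 < a -> 0 < c -> {ae m, forall y, G y} ->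
  (forall y s, G y -> 0 < s -> potential m s y <= (c * Num.sqrt (4 * pi * s))^-1) ->
  H1 u -> continuous u -> (forall x, `|u x| <= B) ->
  a * dot m u u <= grad_dot u u + (a / (2 * c)) ^+ 2 * dot mu u u.
Proof.
move=> a0 c0 mG pot Hu cu uB; have Lu := L2_H1 Hu; have mu' := L2_measurable Lu.
pose f x : R := `|u x|; pose k := a / (2 * c).
have k0 : 0 < k by rewrite divr_gt0// mulr_gt0.
have kc : 2 * k * c = a by rewrite /k; field; rewrite gt_eqF.
have mf : measurable_fun [set: pl R] (f : pl R -> mR R) by exact: measurableT_comp.
have fB x : 0 <= f x <= B by rewrite normr_ge0 uB.
have f2 x : f x ^+ 2 = u x ^+ 2 by rewrite real_normK ?num_real.
have Lf : L2 mu f.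
  by split => //; have := Lu.2; congr (_ < _)%E; apply: eq_integral => x _; rewrite f2.
have cf : continuous f by move=> x; apply: cvg_norm; exact: cu.
have E0 : 0 <= grad_dot u u by rewrite addr_ge0 ?dot_ge0.
have Lmu : L2 m u := bounded_L2 m mu' uB.
pose t (n : nat) : R := n.+1%:R^-1.
have t0 n : 0 < t n by rewrite invr_gt0.
pose q n : R := expR (- (k ^+ 2 * t n)).
pose K n := t n + (q n)^-1 * (2 * k * c)^-1.
(* The regularizing constant and the time step are both [t n] and vanish together. *)
have bound n := fixed_time_bound c0 mG pot Lf fB k0 (t0 n) (t0 n) E0
  (heat_increment_le (t0 n) Hu).
have t_cvg : t @ \oo --> (0 : R) by exact: cvg_harmonic.
have q_cvg : q @ \oo --> (1 : R).
  rewrite -expR0; apply: (cvg_comp _ expR); last exact: continuous_expR.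
  have h : (fun n => - (k ^+ 2 * t n)) @ \oo --> - (k ^+ 2 * 0).
    by apply: cvgN; exact: cvgMr.
  by rewrite mulr0 oppr0 in h.
have K_cvg : K @ \oo --> a^-1.
  have h : K @ \oo --> 0 + 1^-1 * (2 * k * c)^-1.
    by apply: cvgD => //; apply: cvgMl; apply: cvgV => //; rewrite oner_eq0.
  by rewrite add0r invr1 mul1r kc in h.
have qK_cvg : (fun n => q n / K n) @ \oo --> a.
  have h : (fun n => q n / K n) @ \oo --> 1 / a^-1.
    by apply: cvgM => //; apply: cvgV => //; rewrite invr_eq0 gt_eqF.
  by rewrite mul1r invrK in h.
have Kpos n : 0 <= q n / K n.
  apply: divr_ge0; first exact: expR_ge0.
  apply: addr_ge0; first exact: ltW.
  by rewrite kc mulr_ge0 ?invr_ge0 ?expR_ge0// ltW.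
have fatou : (\int[m]_y (a * f y ^+ 2)%:E <= (k ^+ 2 * dot mu f f + grad_dot u u)%:E)%E.
  apply: (@fatou_le _ _ _ m (fun n y => q n / K n * fine (smear mu (t n) f y) ^+ 2) _ _ 0%N).
  - move=> n; apply: measurable_funM => //; apply: measurable_funX.
    exact: (measurable_fine_smear Lf fB (t0 n)).
  - by move=> n x; apply: mulr_ge0; [exact: Kpos|exact: sqr_ge0].
  - move=> y; apply: cvgM => //; have h := smear_cvg (y := y) mf cf fB.
    by rewrite expr2; apply: cvgM.
  - by move=> n _; exact: bound.
have ff : dot mu f f = dot mu u u.
  by rewrite !dot_Rintegral; apply: eq_Rintegral => x _; rewrite -!expr2 f2.
rewrite addrC -lee_fin -ff; apply: le_trans fatou; rewrite EFinM dotE//.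
rewrite -(ge0_integralZl_EFin m measurableT _ _ (ltW a0)).
- rewrite le_eqVlt; apply/orP; left; apply/eqP.
  by apply: eq_integral => x _; rewrite -EFinM f2.
- by move=> x _; rewrite lee_fin sqr_ge0.
- exact: measurable_sqr.
Qed.

End trace_inequality_limit.

(** * Arc length and Hausdorff measure *)

Section loop_measure.
Context {R : realType}.
Local Notation plane := (R * R)%type.
Local Notation lam := (@lebesgue_measure R).
Implicit Types (x y z : plane) (s t : R).

Lemma dot_le_enorm (v w : plane) : v.1 * w.1 + v.2 * w.2 <= enorm v * enorm w.
Proof.
rewrite -sqrtrM ?addr_ge0 ?sqr_ge0//; apply: le_trans (ler_norm _) _.
rewrite -sqrtr_sqr; apply: ler_wsqrtr.
by have := sqr_ge0 (v.1 * w.2 - v.2 * w.1); lra.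
Qed.

Lemma enorm_subC x y : enorm (x - y) = enorm (y - x).
Proof. by rewrite /enorm/= -sqrrN opprB -[in LHS](sqrrN (x.2 - y.2)) opprB. Qed.

Lemma is_derive_component (gamma : R -> plane) (v d : plane) s : is_derive s (1 : R) gamma d ->
  is_derive s (1 : R) (fun s => v.1 * (gamma s).1 + v.2 * (gamma s).2) (v.1 * d.1 + v.2 * d.2).
Proof.
move=> [dg dgE]; pose F := (fun h : R => h^-1 *: ((gamma \o shift s) (h *: (1 : R)) - gamma s)).
have F_cvg : F @ 0^' --> d by rewrite -dgE; exact: dg.
pose g s := v.1 * (gamma s).1 + v.2 * (gamma s).2.
have E : (fun h : R => h^-1 *: ((g \o shift s) (h *: (1 : R)) - g s)) =
    (fun h => v.1 * (F h).1 + v.2 * (F h).2).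
  by apply/funext => h; rewrite /F /g /= /GRing.scale/=; ring.
have G_cvg : (fun h : R => h^-1 *: ((g \o shift s) (h *: (1 : R)) - g s)) @ 0^' -->
    v.1 * d.1 + v.2 * d.2.
  rewrite E; apply: cvgD; apply: cvgMr.
    by apply: (cvg_comp _ _ F_cvg); exact: cvg_fst.
  by apply: (cvg_comp _ _ F_cvg); exact: cvg_snd.
by split; [apply/cvg_ex; exists (v.1 * d.1 + v.2 * d.2)|exact: cvg_lim].
Qed.

(** The curve is projected on the direction of the chord, which reduces the claim to the real mean
    value theorem on each smooth piece; the bounds add up because their direction is the same on all
    pieces. *)
Lemma loop_lipschitz L (gamma : R -> plane) s t : is_loop L gamma ->
  0 <= s <= L -> 0 <= t <= L -> enorm (gamma s - gamma t) <= `|s - t|.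
Proof.
move=> [L0 _ cg [n [tt [t0 tn piece]]]].
wlog st : s t / s <= t.
  move=> h sL tL; have [|/ltW ts] := leP s t; first by move=> st; exact: h.
  by have := h t s ts tL sL; rewrite distrC enorm_subC.
move=> /andP[s0 sL] /andP[t0' tL].
have tt_mono i : (i <= n)%N -> 0 <= tt i <= L.
  have lo j : (j <= n)%N -> 0 <= tt j.
    elim: j => [|j ih] jn; first by rewrite t0.
    by rewrite (le_trans (ih (ltnW jn)))// ltW// (piece j jn).1.
  have hi j : (j <= n)%N -> tt (n - j)%N <= L.
    elim: j => [|j ih] jn; first by rewrite subn0 tn.
    apply: le_trans (ih (ltnW jn)).
    have k : (n - j.+1 < n)%N by rewrite ltn_subrL (leq_ltn_trans _ jn).
    by have := (piece _ k).1; rewrite subnSK// => /ltW.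
  by move=> i_n; rewrite lo//=; have := hi _ (leq_subr i n); rewrite subKn.
set w := gamma t - gamma s.
have [w0|wn0] := eqVneq (enorm w) 0.
  by rewrite enorm_subC w0.
pose g r := w.1 * (gamma r).1 + w.2 * (gamma r).2.
have cgi : {within `[0, L], continuous g}.
  move=> r; apply: cvgD; apply: cvgMr; apply: (cvg_comp _ _ (cg r)).
    exact: cvg_fst.
  exact: cvg_snd.
have on_piece i a b : (i < n)%N -> tt i <= a -> a <= b -> b <= tt i.+1 ->
    g b - g a <= enorm w * (b - a).
  move=> i_n ia ab bi; have [/eqP|] := boolP (a == b).
    by move=> ->; rewrite !subrr mulr0.
  move=> anb; have a_lt_b : a < b by rewrite lt_neqAle anb.
  have [_ [d [_ dP]]] := piece i i_n.
  have der r : r \in `]a, b[ -> is_derive r (1 : R) g (w.1 * (d r).1 + w.2 * (d r).2).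
    rewrite in_itv/= => /andP[ar rb]; apply: is_derive_component.
    by apply: (dP r _).1; rewrite in_itv/=; apply/andP; split; lra.
  have /andP[i0 iL] := tt_mono i (ltnW i_n); have /andP[j0 jL] := tt_mono i.+1 i_n.
  have [|r rab ->] := MVT a_lt_b der.
    apply: continuous_subspaceW cgi => r /=; rewrite !in_itv/= => /andP[ar rb].
    by apply/andP; split; lra.
  rewrite ler_wpM2r ?subr_ge0//; have := dot_le_enorm w (d r).
  rewrite (dP r _).2 ?mulr1//; move: rab; rewrite !in_itv/= => /andP[ar rb].
  by apply/andP; split; lra.
have global i a b : (i <= n)%N -> 0 <= a -> a <= b -> b <= tt i ->
    g b - g a <= enorm w * (b - a).
  elim: i a b => [|i ih] a b i_n a0 ab bi.
    have -> : a = b by apply/eqP; rewrite eq_le ab; rewrite t0 in bi; lra.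
    by rewrite !subrr mulr0.
  have [bi'|ib] := leP b (tt i); first exact: ih (ltnW i_n) a0 ab bi'.
  have [ia|ai] := leP (tt i) a; first exact: on_piece i_n ia ab bi.
  have h1 := ih a (tt i) (ltnW i_n) a0 (ltW ai) (lexx _).
  have h2 := on_piece i (tt i) b i_n (lexx _) (ltW ib) bi.
  by move: h1 h2; rewrite !mulrBr; lra.
have := global n s t (leqnn n) s0 st; rewrite tn => /(_ tL).
have -> : g t - g s = enorm w ^+ 2.
  by rewrite sqr_sqrtr ?addr_ge0 ?sqr_ge0// /g /w/=; ring.
have wp : 0 < enorm w by rewrite lt_neqAle eq_sym wn0 sqrtr_ge0.
rewrite expr2 ler_pM2l// => h.
by rewrite distrC ger0_norm ?subr_ge0// enorm_subC.
Qed.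

(* Outside [0, L] the path is continued by constants. *)
Definition clamp L s : R := Num.max 0 (Num.min s L).

Lemma clamp_itv L s : 0 <= L -> 0 <= clamp L s <= L.
Proof. by move=> L0; rewrite /clamp le_max lexx ge_max L0 ge_min lexx orbT. Qed.

Lemma clamp_id L s : 0 <= s <= L -> clamp L s = s.
Proof. by move=> /andP[s0 sL]; rewrite /clamp min_l// max_r. Qed.

Lemma clamp_lipschitz L s t : 0 <= L -> `|clamp L s - clamp L t| <= `|s - t|.
Proof.
move=> L0; wlog st : s t / s <= t.
  move=> h; have [|/ltW ts] := leP s t; first exact: h.
  by rewrite distrC (distrC s); exact: h.
rewrite distrC (distrC s) (ger0_norm (x := t - s)) ?subr_ge0// /clamp.
have [sL|Ls] := leP s L; have [tL|Lt] := leP t L; rewrite ?subrr ?normr0; last 2 first.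
- by lra.
- by lra.
- have [s0|s0] := leP 0 s; have [t0|t0] := leP 0 t; rewrite ?subrr ?normr0; try lra.
  + by rewrite ger0_norm//; lra.
  + by rewrite ger0_norm//; lra.
- have [s0|s0] := leP 0 s; rewrite (max_r L0).
  + by rewrite ger0_norm//; lra.
  + by rewrite ger0_norm//; lra.
Qed.

Section arc_length.
Variables (L : R) (gamma : R -> plane).
Hypothesis loop : is_loop L gamma.
Local Notation Gamma := (loop_image L gamma).
Local Notation m := (arc_measure Gamma).

Let L0 : 0 < L. Proof. by case: loop. Qed.

Definition path s : plane := gamma (clamp L s).

Lemma path_lipschitz s t : enorm (path s - path t) <= `|s - t|.
Proof.
apply: le_trans (loop_lipschitz loop (clamp_itv s (ltW L0)) (clamp_itv t (ltW L0))) _.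
exact: clamp_lipschitz (ltW L0).
Qed.

Lemma measurable_path : measurable_fun [set: mR R] (path : mR R -> pl R).
Proof.
have lip_cont (f : R -> R) : (forall s t, `|f s - f t| <= `|s - t|) ->
    measurable_fun [set: mR R] (f : mR R -> mR R).
  move=> lip; apply: continuous_measurable_fun => s; apply/cvgrPdist_le => e e0.
  by exists e => //= t /= /ltW; apply: le_trans.
apply/measurable_fun_pairP; split; apply: lip_cont => s t; apply: le_trans (path_lipschitz s t).
  exact: norm_fst_le.
exact: norm_snd_le.
Qed.

(** Subdivision into [N + 1] parameter intervals of length [h <= delta]; their images have diameter
    at most [h], and the covering is padded by empty sets of diameter 0. *)
Lemma hausdorff1_arc_le a b : a <= b ->
  (hausdorff1 (path @` `]a, b]) <= (b - a)%:E)%E.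
Proof.
move=> ab; apply: ge_ereal_sup => _ [delta /= d0 <-].
have [N Nd] : exists N : nat, (b - a) / N.+1%:R <= delta.
  have d1 : 0 < delta / (b - a + 1) by rewrite divr_gt0//; lra.
  have [N] := ltr_add_invr d1; rewrite add0r => /ltW Nd; exists N.
  move: Nd; rewrite ler_pdivlMr; last by lra.
  move: (N.+1%:R^-1) (invr_ge0 (N.+1%:R : R)) => q; rewrite ler0n => q0; lra.
pose h := (b - a) / N.+1%:R.
have h0 : 0 <= h by rewrite divr_ge0// subr_ge0.
pose U (k : nat) : set plane := if (k < N.+1)%N
  then path @` `]a + k%:R * h, a + k.+1%:R * h] else set0.
have dU k : (ediam (U k) <= (if (k < N.+1)%N then h else 0)%:E)%E.
  rewrite /U; case: ifP => kN; last by rewrite ediam0.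
  apply: ge_ereal_sup => _ [->|[[p q] [[s /= + <-] [t /= + <-]] <-]].
    by rewrite lee_fin.
  rewrite !in_itv/= => /andP[s1 s2] /andP[t1 t2]; rewrite lee_fin.
  apply: le_trans (path_lipschitz s t) _.
  by rewrite ler_norml -natr1 in s2 t2 *; apply/andP; split; lra.
apply: (@le_trans _ _ (\sum_(k <oo) ediam (U k))%E).
  apply: ereal_inf_lbound; exists U => //; split.
    move=> _ [s /= + <-]; rewrite in_itv/= => /andP[as_ sb].
    have [h00|hn0] := eqVneq h 0.
      have : b - a = 0.
        by move/eqP: h00; rewrite /h mulf_eq0 invr_eq0 pnatr_eq0 orbF => /eqP.
      by lra.
    have hp : 0 < h by rewrite lt_neqAle eq_sym hn0.
    have ex : exists k : nat, s <= a + k.+1%:R * h.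
      exists N; rewrite /h mulrC divfK ?pnatr_eq0//; lra.
    have [k sk kmin] := ex_minnP ex; exists k => //.
    have kN : (k < N.+1)%N by rewrite ltnS kmin// /h mulrC divfK ?pnatr_eq0//; lra.
    rewrite /U kN; exists s => //=; rewrite in_itv/= sk andbT.
    case: k {sk kN} kmin => [|k] kmin; first by rewrite mul0r addr0.
    rewrite ltNge; apply/negP => /kmin; by rewrite ltnn.
  move=> k; apply: le_trans (dU k) _; rewrite lee_fin; case: ifP => // _; exact: ltW.
apply: (@le_trans _ _ (\sum_(k <oo) (if (k < N.+1)%N then h else 0)%:E)%E).
  by apply: lee_nneseries => [*|k _]; [exact: ediam_ge0|exact: dU].
rewrite (nneseries_split 0 N.+1)//; last by move=> k _; rewrite lee_fin; case: ifP.
rewrite add0n [X in (_ + X)%E]eseries0 ?adde0; last first.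
  by move=> k Nk _; rewrite ltnNge Nk.
rewrite sumEFin lee_fin big_mkord (eq_bigr (fun=> h)); last by move=> i _; rewrite ltn_ord.
by rewrite sumr_const card_ord -mulr_natr /h divfK// pnatr_eq0.
Qed.

(** Lebesgue measure is an infimum over coverings by half-open intervals; each covering is carried
    to the plane by countable subadditivity, so [A] can be arbitrary. *)
Lemma hausdorff1_path_le (A : set (mR R)) : (hausdorff1 (path @` A) <= lam A)%E.
Proof.
rewrite /lebesgue_measure/= /lebesgue_stieltjes_measure/= /measure_extension/=.
apply: le_ereal_inf_tmp => _ [I [mI AI] <-].
apply: (@le_trans _ _ (\sum_(k <oo) hausdorff1 (path @` (I k)))%E).
  apply: le_trans (hausdorff1_sigma_subadditive _); apply: le_hausdorff1.
  by move=> _ [s /AI[k _ Iks] <-]; exists k => //; exists s.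
apply: lee_nneseries => [*|k _]; first exact: hausdorff1_ge0.
have [[a b] _ /= <-] := mI k.
have [ab|ba] := leP a b; first by rewrite wlength_itv_bnd//; exact: hausdorff1_arc_le.
rewrite set_itv_ge; last by rewrite bnd_simp -leNgt ltW.
by rewrite image_set0 hausdorff1_0 wlength0.
Qed.

End arc_length.
End loop_measure.

(** * The heat potential of a loop *)

Section loop_heat.
Context {R : realType}.
Local Notation plane := (R * R)%type.
Local Notation lam := (@lebesgue_measure R).
Implicit Types (x y z : plane) (s t : R).

Lemma integral_mrestr (D : set (mR R)) (mD : measurable D) (f : mR R -> \bar R) :
  measurable_fun [set: mR R] f -> (forall s, 0 <= f s)%E ->
  (\int[mrestr lam mD]_s f s = \int[lam]_(s in D) f s)%E.
Proof.
move=> mf f0; have mS (A : set (mR R)) : measurable_fun A f by exact: measurable_funS mf.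
have mC : measurable (~` D) by exact: measurableC.
rewrite -(setUv D) ge0_integral_setU//; last by rewrite disj_set2E setICr.
rewrite [X in (_ + X)%E](null_set_integral mC)//; last first.
  by rewrite /= /mrestr setIC setICr measure0.
by rewrite adde0; apply: eq_measure_integral => A mA AD; rewrite /= /mrestr (setIidl AD).
Qed.

Section integral_period.
Variables (L s0 k : R).
Hypotheses (L0 : 0 < L) (k0 : 0 < k) (s0L : 0 <= s0 <= L).
Local Notation D := (`[0, L[%classic : set (mR R)).
Local Notation p := (fun s : R => heat1 k (s - s0)).

Let mD : measurable D. Proof. exact: measurable_itv. Qed.

Let mp (b : R) : measurable_fun [set: mR R] (fun s : mR R => p (s + b) : mR R).
Proof.
apply: (measurableT_comp (measurable_heat1 k)); apply: measurable_funB => //.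
exact: measurable_funD.
Qed.

Let mI (b : R) : measurable_fun [set: mR R] (fun s : mR R => \1_D (s - b) : mR R).
Proof.
have mi : measurable_fun [set: mR R] (\1_D : mR R -> mR R) by exact: measurable_indic.
by apply: (measurableT_comp mi); exact: measurable_funB.
Qed.

Let p0 (b s : R) : (0 <= (p (s + b))%:E)%E. Proof. by rewrite lee_fin heat1_ge0. Qed.

Let mpI (b : R) : measurable_fun [set: mR R] (fun s : mR R => (p s * \1_D (s - b))%:E).
Proof.
apply/measurable_EFinP; apply: measurable_funM (mI b).
by have := mp 0; under eq_fun do rewrite addr0.
Qed.

Let pI0 (b s : R) : (0 <= (p s * \1_D (s - b))%:E)%E.
Proof. by rewrite lee_fin mulr_ge0 ?heat1_ge0// indicE. Qed.

Let shifted (b : R) : (\int[lam]_(s in D) (p (s + b))%:E =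
  \int[lam]_s (p s * \1_D (s - b))%:E)%E.
Proof.
rewrite -(@integral_shift R b (fun s => (p s * \1_D (s - b))%:E) (mpI b) (pI0 b)).
rewrite integral_mkcond; apply: eq_integral => s _; rewrite patchE addrK indicE.
by case: (s \in D); rewrite ?mulr1 ?mulr0.
Qed.

(** The distance on a circle of length [L] is attained by one of three translates, so the integrand
    is at most the sum of the Gaussians at [s], [s - L] and [s + L]. Shifted back, these live on
    three disjoint intervals of the line, where the Gaussian has mass 1. *)
Lemma integral_period_le : (\int[lam]_(s in D)
  (heat1 k (Num.min `|s - s0| (L - `|s - s0|)))%:E <= 1)%E.
Proof.
have mpD b : measurable_fun D (fun s : mR R => (p (s + b))%:E).
  by apply: measurable_funS (measurableT) (@subsetT _ _) _; apply/measurable_EFinP; exact: mp.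
apply: (@le_trans _ _ (\int[lam]_(s in D)
    ((p (s + 0))%:E + (p (s + - L))%:E + (p (s + L))%:E))%E).
  apply: ge0_le_integral => //.
  - by move=> s _; rewrite lee_fin heat1_ge0.
  - apply: measurable_funS (measurableT) (@subsetT _ _) _; apply/measurable_EFinP.
    apply: (measurableT_comp (measurable_heat1 k)).
    have ma : measurable_fun [set: mR R] (fun s : mR R => `|s - s0| : mR R).
      by apply: measurableT_comp => //; exact: measurable_funB.
    by apply: measurable_minr => //; exact: measurable_funB.
  - by apply: emeasurable_funD; [exact: emeasurable_funD|].
  move=> s; rewrite /= in_itv/= => /andP[s_ge s_lt]; rewrite -!EFinD lee_fin.
  have h0 b : 0 <= p (s + b) by exact: heat1_ge0.
  have [_|_] := leP `|s - s0| (L - `|s - s0|).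
    have -> : heat1 k `|s - s0| = p (s + 0).
      by rewrite addr0; case: (ger0P (s - s0)) => // _; rewrite heat1N.
    by have := h0 (- L); have := h0 L; lra.
  have [s0s|ss0] := leP s0 s.
    have -> : heat1 k (L - `|s - s0|) = p (s + - L).
      by rewrite ger0_norm ?subr_ge0// -heat1N; congr heat1; ring.
    by have := h0 0; have := h0 L; lra.
  have -> : heat1 k (L - `|s - s0|) = p (s + L).
    by rewrite ltr0_norm ?subr_lt0//; congr heat1; ring.
  by have := h0 0; have := h0 (- L); lra.
rewrite !ge0_integralD//.
all: try by first [exact: emeasurable_funD|by move=> s _; rewrite adde_ge0].
rewrite !shifted -!ge0_integralD//.
all: try by first [exact: emeasurable_funD|by move=> s _; rewrite adde_ge0].
rewrite -(integral_heat1_shift s0 k0); apply: ge0_le_integral => //.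
- by move=> s _; rewrite !adde_ge0.
- by apply: emeasurable_funD => //; exact: emeasurable_funD.
- by have := mp 0; under eq_fun do rewrite addr0; move/measurable_EFinP.
move=> s _; rewrite -!EFinD lee_fin -!mulrDr; apply: ler_piMr; first exact: heat1_ge0.
rewrite !indicE !mem_setE !in_itv/= subr0 opprK.
case: (leP 0 s) => h1; case: (ltP s L) => h2; case: (leP 0 (s + L)) => h3;
  case: (ltP (s + L) L) => h4; case: (leP 0 (s - L)) => h5; case: (ltP (s - L) L) => h6 /=;
  rewrite ?addr0 ?add0r//; lra.
Qed.

End integral_period.

Section loop_heat.
Variables (L : R) (gamma : R -> plane).
Hypothesis loop : is_loop L gamma.
Local Notation Gamma := (loop_image L gamma).

Let L0 : 0 < L. Proof. by case: loop. Qed.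

Local Notation D := (`[0, L[%classic : set (mR R)).

Let mD : measurable D. Proof. exact: measurable_itv. Qed.

(** An inequality, so self-intersections cause no trouble; it is enough because the measure is only
    estimated from above. *)
Lemma arc_measure_le (M : set (pl R)) : (arc_measure Gamma M <=
  pushforward (mrestr lam mD) (path L gamma : mR R -> pl R) M)%E.
Proof.
rewrite /pushforward /mrestr; apply: le_trans (hausdorff1_path_le loop _).
apply: le_hausdorff1 => x [Mx [s /=]]; rewrite in_itv/= => /andP[s_ge sL] sx.
have [sltL|Ls] := ltP s L.
  exists s; last by rewrite /path clamp_id// s_ge ltW.
  by split; [rewrite /= /path clamp_id ?sx// s_ge ltW|rewrite /= in_itv/= s_ge].
(* [D] omits the end point [L], whose image is that of 0 because the curve is closed. *)
have pE : path L gamma 0 = x.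
  rewrite /path clamp_id ?lexx ?ltW// -sx.
  have -> : s = L by apply/eqP; rewrite eq_le sL.
  by case: loop.
by exists 0 => //; split; rewrite /= ?pE// in_itv/= lexx.
Qed.

(** The arc measure indexed by a proof that the curve is a loop: finiteness depends on that proof,
    and the index lets it be registered as a structure. *)
Definition loop_measure of is_loop L gamma : set (pl R) -> \bar R := arc_measure Gamma.

HB.instance Definition _ (h : is_loop L gamma) := Measure.on (loop_measure h).

Let loop_measure_finite (h : is_loop L gamma) : fin_num_fun (loop_measure h).
Proof.
move=> M mM; rewrite ge0_fin_numE; last exact: (measure_ge0 (loop_measure h)).
apply: (@le_lt_trans _ _ (lam D)).
  apply: le_trans (arc_measure_le _) _; rewrite /pushforward /mrestr.
  apply: le_measure; rewrite ?inE; [|exact: mD|exact: (@subIsetr (mR R))].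
  apply: measurableI => //; rewrite -[X in measurable X]setTI.
  exact: (measurable_path h).
by rewrite lebesgue_measure_itv/= lte_fin L0 -EFinB ltry.
Qed.

HB.instance Definition _ (h : is_loop L gamma) :=
  Measure_isFinite.Build _ _ _ (loop_measure h) (loop_measure_finite h).

Lemma integral_loop_le (f : pl R -> \bar R) : measurable_fun [set: pl R] f ->
  (forall x, 0 <= f x)%E ->
  (\int[loop_measure loop]_x f x <= \int[lam]_(s in D) f (path L gamma s))%E.
Proof.
move=> mf f0; have mpath := measurable_path loop.
rewrite -(integral_mrestr mD (measurableT_comp mf mpath) (fun s => f0 _)).
have := @ge0_integral_pushforward _ _ _ _ _ _ mpath (mrestr lam mD) setT f measurableT mf (fun y _ => f0 y).
rewrite preimage_setT => <-; apply: ge0_le_measure_integral => // M mM.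
exact: arc_measure_le.
Qed.

Lemma c_Gamma_le s t : 0 < c_Gamma L gamma -> 0 <= s <= L -> 0 <= t <= L ->
  c_Gamma L gamma * Num.max 0 (Num.min `|s - t| (L - `|s - t|)) <= enorm (gamma s - gamma t).
Proof.
move=> c0 sL tL.
(* Here [|s - t|] is 0 or [L]; such pairs are excluded from the infimum and are covered by
   nonnegativity of the norm. *)
have [d0|d0] := leP (Num.min `|s - t| (L - `|s - t|)) 0.
  by rewrite mulr0 sqrtr_ge0.
have st : 0 < `|s - t| < L.
  by move: d0; rewrite lt_min => /andP[-> h]/=; lra.
rewrite -ler_pdivlMr//; apply: ge_inf; last first.
  by exists (s, t) => //=; split; rewrite ?in_itv.
exists 0 => _ [[a b] /= [_ _ /andP[ab0 abL]] <-].
by rewrite divr_ge0 ?sqrtr_ge0// le_min ltW//= subr_ge0 ltW.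
Qed.

(** Pointwise in the arc parameter, [heat_le] with [r] the distance along the loop leaves a Gaussian
    at time [t / c^2], whose integral over one period is at most 1. *)
Lemma loop_potential_le y t : 0 < c_Gamma L gamma -> Gamma y -> 0 < t ->
  potential (loop_measure loop) t y <= (c_Gamma L gamma * Num.sqrt (4 * pi * t))^-1.
Proof.
move=> c0 [s0 /=]; rewrite in_itv/= => s0L <- t0; set c := c_Gamma L gamma.
set K := (c * _)^-1; have K0 : 0 <= K.
  by rewrite invr_ge0 mulr_ge0 ?sqrtr_ge0// ltW.
have k0 : 0 < t / c ^+ 2 by rewrite divr_gt0// exprn_gt0.
rewrite -lee_fin potentialE// /smear.
have m1 : measurable_fun [set: pl R] (cst 1%R : pl R -> mR R) by exact: measurable_cst.
apply: le_trans (integral_loop_le (measurable_heatM t (gamma s0) m1) _) _.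
  by move=> x; rewrite lee_fin mulr_ge0 ?heat_ge0.
pose r s : R := Num.min `|s - s0| (L - `|s - s0|).
have ma : measurable_fun [set: mR R] (fun s : mR R => `|s - s0| : mR R).
  by apply: measurableT_comp => //; exact: measurable_funB.
have mr : measurable_fun [set: mR R] (r : mR R -> mR R).
  by apply: measurable_minr => //; exact: measurable_funB.
have mh : measurable_fun [set: mR R] (fun s : mR R => (heat1 (t / c ^+ 2) (r s))%:E).
  by apply/measurable_EFinP; exact: (measurableT_comp (measurable_heat1 _) mr).
have mhD := measurable_funS measurableT (@subsetT _ D) mh.
have h0 (s : mR R) : D s -> (0 <= (heat1 (t / c ^+ 2) (r s))%:E)%E by rewrite lee_fin heat1_ge0.
apply: (@le_trans _ _ (\int[lam]_(s in D) (K%:E * (heat1 (t / c ^+ 2) (r s))%:E))%E).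
  apply: ge0_le_integral => //.
  - by move=> s _; rewrite lee_fin mulr_ge0 ?heat_ge0.
  - apply: measurable_funS measurableT (@subsetT _ _) _.
    exact: (measurableT_comp (measurable_heatM t (gamma s0) m1) (measurable_path loop)).
  - exact: emeasurable_funM.
  move=> s; rewrite /= in_itv/= => /andP[s_ge s_lt]; rewrite mulr1 -EFinM lee_fin.
  have sL : 0 <= s <= L by rewrite s_ge ltW.
  have r0 : 0 <= r s.
    rewrite le_min normr_ge0/=; move: sL s0L => /andP[a1 a2] /andP[b1 b2].
    by rewrite subr_ge0 ler_norml; apply/andP; split; lra.
  apply: heat_le => //; rewrite /path clamp_id//.
  by have := c_Gamma_le c0 sL s0L; rewrite -/(r s) max_r.
rewrite (ge0_integralZl_EFin lam mD h0 mhD K0) -[leRHS]mule1.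
by apply: lee_wpmul2l; [rewrite lee_fin|exact: integral_period_le].
Qed.

Lemma loop_trace_inequality (a B : R) u : 0 < a -> 0 < c_Gamma L gamma ->
  H1 u -> continuous u -> (forall x, `|u x| <= B) ->
  L2 (arc_measure Gamma) u /\
  a * dot (arc_measure Gamma) u u <=
    grad_dot u u + (a / (2 * c_Gamma L gamma)) ^+ 2 * dot (@lebesgue2 R) u u.
Proof.
move=> a0 c0 Hu cu uB.
have aeG : {ae loop_measure loop, forall y, Gamma y}.
  exists (~` Gamma); split => //.
    apply: open_measurable2; rewrite openC.
    apply: compact_closed; first exact: norm_hausdorff.
    apply: continuous_compact; last exact: segment_compact.
    by case: loop.
  by rewrite /loop_measure /arc_measure /= setICl hausdorff1_0.
split.
  exact: (@bounded_L2 R (loop_measure loop) u B (L2_measurable (L2_H1 Hu)) uB).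
exact: (@trace_inequality R (loop_measure loop) Gamma a _ B u a0 c0 aeG
  (fun y s Gy s_gt => loop_potential_le c0 Gy s_gt) Hu cu uB).
Qed.

End loop_heat.
End loop_heat.

(** * Traces *)

Section real_trace.
Context {R : realType}.
Local Notation plane := (R * R)%type.
Local Notation mu := (@lebesgue2 R).
Implicit Types (phi u v g w : plane -> R).
Variables (m : {measure set (pl R) -> \bar R}) (k : R -> R).
Hypothesis k0 : forall a, 0 <= k a.
Hypothesis ineq : forall (a B : R) u, 0 < a -> H1 u -> continuous u ->
  (forall x, `|u x| <= B) ->
  L2 m u /\ a * dot m u u <= grad_dot u u + k a * dot mu u u.

Let sH := @H1_subspace R.
Let dH := @h1_semi_dot R.
Let sL : is_subspace (L2 m : (plane -> R) -> Prop). Proof. exact: L2_subspace. Qed.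
Let dL : semi_dot (L2 m : (plane -> R) -> Prop) (dot m). Proof. exact: (@semi_dot_L2 _ (pl R) R m). Qed.

(** The closure of the restriction map: one test function has to be close to [u] in H^1 and to [g]
    on the curve at the same time. *)
Definition is_rtrace u g := L2 m g /\ forall e : R, 0 < e ->
  exists phi, [/\ test_function phi, h1_dot (u - phi) (u - phi) <= e &
    dot m (g - phi) (g - phi) <= e].

Let C := 1 + k 1.

Let C0 : 0 < C. Proof. by have := k0 1; rewrite /C; lra. Qed.

Let bound u (B : R) : H1 u -> continuous u -> (forall x, `|u x| <= B) ->
  L2 m u /\ dot m u u <= C * h1_dot u u.
Proof.
move=> Hu cu uB; have [Lu] := ineq ltr01 Hu cu uB; rewrite mul1r => h; split=> //.
apply: le_trans h _; rewrite /C /h1_dot.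
have h1 : 0 <= grad_dot u u by rewrite addr_ge0 ?dot_ge0.
have := mulr_ge0 (k0 1) h1; have := dot_ge0 mu u; lra.
Qed.

Let test_bound phi : test_function phi -> L2 m phi /\ dot m phi phi <= C * h1_dot phi phi.
Proof.
move=> tphi; have [B _ PB] := test_bounded tphi.
exact: (bound (test_H1 tphi) (smooth_continuous (test_smooth tphi)) PB).
Qed.

Let neg_h1 u v : H1 u -> H1 v -> h1_dot (u - v) (u - v) = h1_dot (v - u) (v - u).
Proof.
move=> Hu Hv; have H0 : H1 (0 : plane -> R) := sH.1.
have Huv := subspaceB sH Hu Hv; have [lB cB _] := dH.
have E : v - u = (-1) *: (u - v) + 0 by rewrite addr0 scaleN1r opprB.
have Z w : H1 w -> h1_dot 0 w = 0.
  by move=> Hw; have := lB 1 0 0 w H0 H0 Hw; rewrite scaler0 addr0 mul1r; lra.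
have Hvu := subspaceB sH Hv Hu.
rewrite [in RHS]E lB//; last by rewrite -E.
rewrite -E Z// addr0 [in RHS]cB// [in RHS]E lB// Z// addr0.
by rewrite mulrA mulrNN !mul1r.
Qed.

(** By [test_bound], test functions that approximate [u] in H^1 form a Cauchy sequence in L^2 of the
    curve, which is complete. *)
Lemma rtrace_ex u : H1 u -> exists g, is_rtrace u g.
Proof.
move=> Hu; have en (n : nat) : 0 < (n.+1%:R^-1 : R) by rewrite invr_gt0.
have /choice[phi phiP] : forall n : nat, exists phi, test_function phi /\
    h1_dot (u - phi) (u - phi) <= n.+1%:R^-1.
  by move=> n; have [phi t h] := test_dense Hu (en n); exists phi.
have tphi n := (phiP n).1; have Hphi n := test_H1 (tphi n).
have Lphi n : L2 m (phi n) := (test_bound (tphi n)).1.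
have small (e : R) : 0 < e -> exists N, forall n, (N <= n)%N -> n.+1%:R^-1 <= e.
  move=> e0; have [N] := ltr_add_invr e0; rewrite add0r => Ne; exists N => n Nn.
  by apply/ltW/(le_lt_trans _ Ne); rewrite lef_pV2 ?posrE// ler_nat.
have [|g Lg gP] := L2_complete Lphi.
  move=> e e0; have [N NP] := small _ (divr_gt0 e0 (mulr_gt0 (ltr0n R 4) C0)).
  exists N => n l Nn Nl; have tnl := subspaceB test_subspace (tphi n) (tphi l).
  apply: le_trans (test_bound tnl).2 _.
  have Ha := subspaceB sH (Hphi n) Hu; have Hb := subspaceB sH Hu (Hphi l).
  have := semi_dot_young sH dH ltr01 Ha Hb; rewrite addrA subrK invr1 (neg_h1 (Hphi n) Hu).
  move=> h; have h1 := le_trans (phiP n).2 (NP n Nn); have h2 := le_trans (phiP l).2 (NP l Nl).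
  have : h1_dot (phi n - phi l) (phi n - phi l) <= 4 * (e / (4 * C)).
    by move: (e / (4 * C)) h1 h2 => d h1 h2; lra.
  move=> /(ler_wpM2l (ltW C0)) /le_trans; apply.
  by rewrite le_eqVlt; apply/orP; left; apply/eqP; field; rewrite gt_eqF.
exists g; split=> // e e0; have [N NP] := small e e0; have [N' N'P] := gP e e0.
pose n := maxn N N'; exists (phi n); split=> //.
  by apply: le_trans (phiP n).2 _; apply: NP; rewrite leq_maxl.
have := N'P n (leq_maxr _ _); rewrite !dot_Rintegral => h.
by apply: le_trans h; rewrite le_eqVlt; apply/orP; left; apply/eqP;
  apply: eq_Rintegral => x _; rewrite !fctE; ring.
Qed.

Lemma rtrace_linear (a : R) u v g w : H1 u -> H1 v -> is_rtrace u g -> is_rtrace v w ->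
  is_rtrace (a *: u + v) (a *: g + w).
Proof.
move=> Hu Hv [Lg gP] [Lw wP]; split; first by apply: sL.2.
move=> e e0; have d0 : 0 < 2 * a ^+ 2 + 2 by have := sqr_ge0 a; lra.
have ed : 0 < e / (2 * a ^+ 2 + 2) by rewrite divr_gt0.
have [p [tp hp1 hp2]] := gP _ ed; have [q [tq hq1 hq2]] := wP _ ed.
exists (a *: p + q); split; first by apply: test_subspace.2.
- have Hp := test_H1 tp; have Hq := test_H1 tq.
  have E : a *: u + v - (a *: p + q) = a *: (u - p) + (v - q).
    by rewrite scalerBr opprD addrACA.
  have H1' := subspaceB sH Hu Hp; have H2' := subspaceB sH Hv Hq.
  have := semi_dot_young sH dH ltr01 (subspaceZ a sH H1') H2'.
  have := dotDZ sH dH a sH.1 H1'; rewrite add0r; have [lB cB _] := dH.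
  have Z w' : H1 w' -> h1_dot 0 w' = 0.
    by move=> Hw; have := lB 1 0 0 w' sH.1 sH.1 Hw; rewrite scaler0 addr0 mul1r; lra.
  rewrite !Z//; last exact: sH.1.
  rewrite E invr1 => -> h; apply: le_trans h _.
  have := ler_wpM2l (sqr_ge0 a) hp1; move: hp1 hq1.
  move: (h1_dot _ _) (h1_dot _ _) => A B' h1 h2 h3.
  have : e = (2 * a ^+ 2 + 2) * (e / (2 * a ^+ 2 + 2)) by rewrite mulrC divfK ?gt_eqF.
  by move: (e / _) h1 h2 h3 => d h1 h2 h3 ->; lra.
- have Lp := (test_bound tp).1; have Lq := (test_bound tq).1.
  have E : a *: g + w - (a *: p + q) = a *: (g - p) + (w - q).
    by rewrite scalerBr opprD addrACA.
  have H1' := subspaceB sL Lg Lp; have H2' := subspaceB sL Lw Lq.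
  have := semi_dot_young sL dL ltr01 (subspaceZ a sL H1') H2'.
  have := dotDZ sL dL a sL.1 H1'; rewrite add0r; have [lB cB _] := dL.
  have Z w' : L2 m w' -> dot m 0 w' = 0.
    by move=> Hw; have := lB 1 0 0 w' sL.1 sL.1 Hw; rewrite scaler0 addr0 mul1r; lra.
  rewrite !Z//; last exact: sL.1.
  rewrite E invr1 => -> h; apply: le_trans h _.
  have := ler_wpM2l (sqr_ge0 a) hp2; move: hp2 hq2.
  move: (dot _ _ _) (dot _ _ _) => A B' h1 h2 h3.
  have : e = (2 * a ^+ 2 + 2) * (e / (2 * a ^+ 2 + 2)) by rewrite mulrC divfK ?gt_eqF.
  by move: (e / _) h1 h2 h3 => d h1 h2 h3 ->; lra.
Qed.

Lemma rtrace_ineq (a : R) u g : 0 < a -> H1 u -> is_rtrace u g ->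
  a * dot m g g <= grad_dot u u + k a * dot mu u u.
Proof.
move=> a0 Hu [Lg gP].
pose Q v := grad_dot v v + k a * dot mu v v.
(* Collects, for [e <= 1], the errors of [(1 + e) ((1 + e) Q u + 2 e (1 + k a)) + 2 e a]. *)
apply: (@le_limit R _ _ (3 * Q u + 2 * (2 * (1 + k a)) + 2 * a)) => e /andP[e0 e1].
have e2 : 0 < e ^+ 2 by rewrite exprn_gt0.
have [phi [tphi h1 h2]] := gP _ e2.
have Hphi := test_H1 tphi; have [B _ PB] := test_bounded tphi.
have [Lphi hphi] := ineq a0 Hphi (smooth_continuous (test_smooth tphi)) PB.
have e'0 : 0 <= 1 + e^-1 by rewrite addr_ge0// invr_ge0 ltW.
have ee : (1 + e^-1) * e ^+ 2 <= 2 * e.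
  have -> : (1 + e^-1) * e ^+ 2 = (1 + e) * e by field; rewrite gt_eqF.
  by rewrite ler_wpM2r ?(ltW e0)//; lra.
have s1 := semi_dot_young sL dL e0 Lphi (subspaceB sL Lg Lphi).
have gE : phi + (g - phi) = g by rewrite addrC subrK.
rewrite gE in s1.
have Hd := subspaceB sH Hphi Hu; have uE : u + (phi - u) = phi by rewrite addrC subrK.
have s2 := semi_dot_young sH (@grad_semi_dot R) e0 Hu Hd.
have s3 := dot_young e0 (L2_H1 Hu) (L2_H1 Hd).
rewrite uE in s2 s3; rewrite (neg_h1 Hu Hphi) in h1.
have g0 v : 0 <= grad_dot v v by rewrite addr_ge0 ?dot_ge0.
have ka := k0 a.
have Qd : Q (phi - u) <= (1 + k a) * e ^+ 2.
  have hd : h1_dot (phi - u) (phi - u) = dot mu (phi - u) (phi - u) + grad_dot (phi - u) (phi - u) by [].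
  have := ler_wpM2l (addr_ge0 ler01 ka) h1; rewrite hd /Q.
  have := mulr_ge0 ka (g0 (phi - u)); have := dot_ge0 mu (phi - u); lra.
have Qphi : Q phi <= (1 + e) * Q u + (1 + e^-1) * Q (phi - u).
  by have := ler_wpM2l ka s3; rewrite /Q; lra.
have Qu0 : 0 <= Q u by rewrite addr_ge0// mulr_ge0// dot_ge0.
have t1 := ler_wpM2l e'0 Qd.
have t2 : (1 + e^-1) * ((1 + k a) * e ^+ 2) <= (1 + k a) * (2 * e).
  by rewrite mulrCA ler_wpM2l// addr_ge0.
have t3 : (1 + e^-1) * dot m (g - phi) (g - phi) <= 2 * e.
  by apply: le_trans ee; exact: ler_wpM2l.
have t4 := ler_wpM2l (ltW a0) s1.
have t5 := ler_wpM2l (ltW a0) t3.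
have t6 : (1 + e) * (a * dot m phi phi) <= (1 + e) * Q phi.
  by rewrite ler_wpM2l//; lra.
have t7 : (1 + e) * Q phi <= (1 + e) * ((1 + e) * Q u + (1 + k a) * (2 * e)).
  by rewrite ler_wpM2l//; lra.
have t8 : e * e * Q u <= e * Q u by rewrite -mulrA ler_piMl// mulr_ge0// ltW.
have t9 : e * e * (1 + k a) <= e * (1 + k a).
  by rewrite -mulrA ler_piMl// mulr_ge0 ?addr_ge0// ltW.
by rewrite -/(Q u); move: t4 t5 t6 t7 t8 t9; move: (Q u) (Q phi) (1 + k a) => q qq kk; lra.
Qed.

(** The difference of two traces of [u] is a trace of 0, and the inequality bounds its norm by that
    of 0. *)
Lemma rtrace_unique u g w : H1 u -> is_rtrace u g -> is_rtrace u w -> g = w %[ae m].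
Proof.
move=> Hu gP wP; have H0 : H1 (0 : plane -> R) := sH.1.
have d := rtrace_linear (-1) Hu Hu wP gP.
have uu : -1 *: u + u = 0 by rewrite scaleN1r addrC subrr.
rewrite uu in d; have := rtrace_ineq ltr01 H0 d.
have Z : dot mu (0 : plane -> R) 0 = 0 /\ grad_dot (0 : plane -> R) 0 = 0.
  split.
    have [lB _ _] := @dot_plane_semi_dot R; have L0 := (@L2_plane_subspace R).1.
    by have := lB 1 0 0 0 L0 L0 L0; rewrite scaler0 addr0 mul1r; lra.
  have [lB _ _] := @grad_semi_dot R.
  by have := lB 1 0 0 0 H0 H0 H0; rewrite scaler0 addr0 mul1r; lra.
rewrite Z.1 Z.2 mulr0 addr0 mul1r scaleN1r addrC => h.
apply: (dotB_ae gP.1 wP.1); apply/eqP; rewrite eq_le dot_ge0 andbT.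
exact: h.
Qed.

(** If [phi] approximates [u] in H^1, then [u - phi] is again bounded and continuous, so the
    inequality applies to it directly and the same [phi] is close to [u] on the curve. *)
Lemma rtrace_continuous u (B : R) : H1 u -> continuous u -> (forall x, `|u x| <= B) ->
  is_rtrace u u.
Proof.
move=> Hu cu uB; split; first exact: (bound Hu cu uB).1.
move=> e e0; have C1 : 0 < C + 1 by rewrite ltr_wpDl// ltW.
have [phi tphi h] := test_dense Hu (divr_gt0 e0 C1).
have le_e : e / (C + 1) <= e by rewrite ler_pdivrMr// ler_peMr ?ltW//; have := C0; lra.
exists phi; split=> //; first exact: le_trans le_e.
have [B' _ PB] := test_bounded tphi; have Hphi := test_H1 tphi.
have cd : continuous (u - phi).
  move=> x; apply: cvgB; first exact: cu.
  exact: (smooth_continuous (test_smooth tphi)).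
have bd x : `|(u - phi) x| <= B + B'.
  by rewrite !fctE; apply: le_trans (ler_normB _ _) _; exact: lerD.
have [_] := bound (subspaceB sH Hu Hphi) cd bd => /le_trans; apply.
apply: le_trans (ler_wpM2l (ltW C0) h) _.
by rewrite mulrA ler_pdivrMr// [leRHS]mulrC; apply: ler_wpM2r; [exact: ltW|lra].
Qed.

Definition rtr u : plane -> R := xget 0 [set g | is_rtrace u g].

Lemma rtrP u : H1 u -> is_rtrace u (rtr u).
Proof. by move=> /rtrace_ex[g gP]; exact: (xgetPex _ (ex_intro _ g gP)). Qed.

Lemma rtr_linear (a : R) u v : H1 u -> H1 v ->
  rtr (a *: u + v) = a *: rtr u + rtr v %[ae m].
Proof.
move=> Hu Hv; have Huv : H1 (a *: u + v) by exact: sH.2.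
exact: (rtrace_unique Huv (rtrP Huv) (rtrace_linear a Hu Hv (rtrP Hu) (rtrP Hv))).
Qed.

End real_trace.

Lemma sum_bool (V : nmodType) (F : bool -> V) : \sum_(j : bool) F j = F true + F false.
Proof. exact: big_bool. Qed.

(** * From real to complex functions *)

Section complex_valued.
Context {R : realType}.
Local Notation plane := (R * R)%type.
Local Notation C := R[i].
Local Notation mu := (@lebesgue2 R).
Implicit Types (f g u v w : plane -> C) (phi : plane -> R).

Definition re f : plane -> R := fun x => complex.Re (f x).
Definition im f : plane -> R := fun x => complex.Im (f x).

Lemma re_linear (a : C) u v :
  re (fun x => a * u x + v x) = complex.Re a *: re u + (- complex.Im a *: im u + re v).
Proof.
apply/funext => x; rewrite /re /im !fctE /GRing.scale/=.
by case: a (u x) (v x) => a b [c d] [e f] /=; ring.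
Qed.

Lemma im_linear (a : C) u v :
  im (fun x => a * u x + v x) = complex.Re a *: im u + (complex.Im a *: re u + im v).
Proof.
apply/funext => x; rewrite /re /im !fctE /GRing.scale/=.
by case: a (u x) (v x) => a b [c d] [e f] /=; ring.
Qed.

Section L2.
Variable nu : {measure set (pl R) -> \bar R}.

Lemma inL2P f : inL2 nu f <-> L2 nu (re f) /\ L2 nu (im f).
Proof.
by split=> -[h1 h2]; split; [apply/(L2P nu (re f))|apply/(L2P nu (im f))|
  apply/(L2P nu (re f))|apply/(L2P nu (im f))].
Qed.

Lemma L2norm_ge0 f : 0 <= L2norm nu f.
Proof. by rewrite /L2norm fine_ge0// Lnorm_ge0. Qed.

Lemma L2norm_sqr f : inL2 nu f ->
  L2norm nu f ^+ 2 = dot nu (re f) (re f) + dot nu (im f) (im f).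
Proof.
move=> /inL2P[Lr Li].
have E x : Normc.normc (f x) ^+ 2 = re f x ^+ 2 + im f x ^+ 2.
  by rewrite /re /im; case: (f x) => a b /=; rewrite sqr_sqrtr// addr_ge0 ?sqr_ge0.
have sq : (\int[nu]_x (Normc.normc (f x) ^+ 2)%:E =
    (dot nu (re f) (re f) + dot nu (im f) (im f))%:E)%E.
  rewrite EFinD !dotE// -ge0_integralD//.
  - by apply: eq_integral => x _; rewrite E EFinD.
  - by move=> x _; rewrite lee_fin sqr_ge0.
  - by apply: measurable_sqr; exact: (L2_measurable Lr).
  - by move=> x _; rewrite lee_fin sqr_ge0.
  - by apply: measurable_sqr; exact: (L2_measurable Li).
have d0 : 0 <= dot nu (re f) (re f) + dot nu (im f) (im f) by rewrite addr_ge0 ?dot_ge0.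
have -> : L2norm nu f = fine ((\int[nu]_x (Normc.normc (f x) ^+ 2)%:E) `^ 2^-1)%E.
  by rewrite -(Lnorm2E nu (fun x => Normc.normc (f x))).
by rewrite sq poweR_EFin/= powR12_sqrt// sqr_sqrtr.
Qed.

Lemma L2dotE f g : inL2 nu f -> inL2 nu g ->
  L2dot nu f g = Complex (dot nu (re f) (re g) + dot nu (im f) (im g))
                         (dot nu (im f) (re g) - dot nu (re f) (im g)).
Proof.
move=> /inL2P[f1 f2] /inL2P[g1 g2]; rewrite /L2dot /cintegral !dot_Rintegral.
rewrite -RintegralD//; [|exact: L2_integrableM|exact: L2_integrableM].
rewrite -RintegralB//; [|exact: L2_integrableM|exact: L2_integrableM].
congr Complex; apply: eq_Rintegral => x _; rewrite /re /im;
  by case: (f x) (g x) => a b [c d] /=; ring.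
Qed.

End L2.

Lemma weak_partialP j u w : is_weak_partial j u w <->
  wpartial j (re u) (re w) /\ wpartial j (im u) (im w).
Proof.
have E1 v phi : cintegral mu (fun x => v x * (phi x)%:C%C) =
    Complex (dot mu (re v) phi) (dot mu (im v) phi).
  rewrite /cintegral !dot_Rintegral; congr Complex; apply: eq_Rintegral => x _;
    by rewrite /re /im; case: (v x) => a b /=; ring.
have N (a b : R) : - Complex a b = Complex (- a) (- b) by [].
split.
  move=> [/inL2P[L1 L2'] wP]; split; split=> // phi tphi;
    by have := wP phi tphi; rewrite !E1 N => -[].
move=> [[L1 h1] [L2' h2]]; split; first exact/inL2P.
by move=> phi tphi; rewrite !E1 N h1// h2.
Qed.

Lemma inH1P u : inH1 u <-> H1 (re u) /\ H1 (im u).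
Proof.
split.
  move=> [/inL2P[L1 L2'] wP]; split; split=> // j; have [w /weak_partialP[h1 h2]] := wP j.
    by exists (re w).
  by exists (im w).
move=> [[L1 h1] [L2' h2]]; split; first exact/inL2P.
move=> j; have [w1 w1P] := h1 j; have [w2 w2P] := h2 j.
by exists (fun x => Complex (w1 x) (w2 x)); apply/weak_partialP.
Qed.

Lemma weak_partial_spec j u : inH1 u -> [/\ inL2 mu (weak_partial j u),
  re (weak_partial j u) = wderiv j (re u) %[ae mu] &
  im (weak_partial j u) = wderiv j (im u) %[ae mu]].
Proof.
move=> Hu; have [Hr Hi] := (inH1P u).1 Hu; have [_ /(_ j) wP] := Hu.
have wpP : is_weak_partial j u (weak_partial j u) := xgetPex _ wP.
have [h1 h2] := (weak_partialP _ _ _).1 wpP; have [Lw _] := wpP.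
split; [exact: Lw|exact: (wpartial_unique h1 (wderivP j Hr))|
  exact: (wpartial_unique h2 (wderivP j Hi))].
Qed.

Lemma weak_partial_dot j u v : inH1 u -> inH1 v ->
  L2dot mu (weak_partial j u) (weak_partial j v) =
  Complex (dot mu (wderiv j (re u)) (wderiv j (re v)) + dot mu (wderiv j (im u)) (wderiv j (im v)))
          (dot mu (wderiv j (im u)) (wderiv j (re v)) - dot mu (wderiv j (re u)) (wderiv j (im v))).
Proof.
move=> Hu Hv; have [ur ui] := (inH1P u).1 Hu; have [vr vi] := (inH1P v).1 Hv.
have [Lu u1 u2] := weak_partial_spec j Hu; have [Lv v1 v2] := weak_partial_spec j Hv.
rewrite L2dotE//; have [Lu1 Lu2] := (inL2P _ _).1 Lu; have [Lv1 Lv2] := (inL2P _ _).1 Lv.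
have d1 := wderiv_L2 j ur; have d2 := wderiv_L2 j ui.
have d3 := wderiv_L2 j vr; have d4 := wderiv_L2 j vi.
by rewrite (dot_ae Lu1 Lv1 d1 d3 u1 v1) (dot_ae Lu2 Lv2 d2 d4 u2 v2)
  (dot_ae Lu2 Lv1 d2 d3 u2 v1) (dot_ae Lu1 Lv2 d1 d4 u1 v2).
Qed.

Lemma H1norm_sqr u : inH1 u ->
  H1norm u ^+ 2 = h1_dot (re u) (re u) + h1_dot (im u) (im u).
Proof.
move=> Hu; have [ur ui] := (inH1P u).1 Hu; have [Lu _] := Hu.
have N j : L2norm mu (weak_partial j u) ^+ 2 =
    dot mu (wderiv j (re u)) (wderiv j (re u)) + dot mu (wderiv j (im u)) (wderiv j (im u)).
  have [Lw w1 w2] := weak_partial_spec j Hu; rewrite L2norm_sqr//.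
  have [L1 L2'] := (inL2P _ _).1 Lw.
  have d1 := wderiv_L2 j ur; have d2 := wderiv_L2 j ui.
  by rewrite (dot_ae L1 L1 d1 d1 w1 w1) (dot_ae L2' L2' d2 d2 w2 w2).
rewrite /H1norm sqr_sqrtr; last first.
  by rewrite addr_ge0 ?sqr_ge0//; apply: sumr_ge0 => j _; exact: sqr_ge0.
rewrite (sum_bool (fun j => L2norm mu (weak_partial j u) ^+ 2)) (L2norm_sqr Lu).
have := N false; have := N true.
generalize (L2norm mu (weak_partial true u)) (L2norm mu (weak_partial false u)) => a b -> ->.
rewrite /h1_dot /grad_dot.
by do 6 move: (dot _ _ _) => ?; ring.
Qed.

Lemma test_iter_partial (s : seq bool) phi : test_function phi -> test_function (iter_partial s phi).
Proof. by move=> tphi; elim: s => // j s ih; exact: (test_partial j ih). Qed.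

Lemma test_schwartz phi : test_function phi -> schwartz_real phi.
Proof.
move=> tphi; split; first exact: test_smooth.
move=> s k; have ts := test_iter_partial s tphi.
have [M M0 MP] := test_bounded ts; have [_ [r rP]] := ts.
exists (Num.max 0 r ^+ k * M) => x; have [xr|rx] := leP (enorm x) r.
  apply: ler_pM => //; first by rewrite exprn_ge0// sqrtr_ge0.
  by rewrite lerXn2r ?nnegrE ?sqrtr_ge0 ?le_max ?lexx// xr orbT.
rewrite (rP x rx) normr0 mulr0 mulr_ge0 ?(ltW M0)// exprn_ge0// le_max lexx//.
Qed.

Section trace.
Variables (Gamma : set plane) (k : R -> R).
Local Notation m := (arc_measure Gamma).
Hypothesis k0 : forall a, 0 <= k a.
Hypothesis ineq : forall (a B : R) (u : plane -> R), 0 < a -> H1 u -> continuous u ->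
  (forall x, `|u x| <= B) ->
  L2 m u /\ a * dot m u u <= grad_dot u u + k a * dot mu u u.

Let rP (u : plane -> R) (Hu : H1 u) : is_rtrace m u (rtr m u) := rtrP k0 ineq Hu.

(** Off H^1 the identity is the right default: [is_trace] prescribes the value on every Schwartz
    function without requiring [inH1] of it. *)
Let ctrace u : plane -> C :=
  if `[< inH1 u >] then fun x => Complex (rtr m (re u) x) (rtr m (im u) x) else u.

Let ctraceE u : inH1 u -> ctrace u = fun x => Complex (rtr m (re u) x) (rtr m (im u) x).
Proof. by move=> Hu; rewrite /ctrace asboolT. Qed.

Let h1_bound (u g : plane -> R) : H1 u -> is_rtrace m u g -> dot m g g <= (1 + k 1) * h1_dot u u.
Proof.
move=> Hu ug; have := rtrace_ineq k0 ineq ltr01 Hu ug; rewrite mul1r => h.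
apply: le_trans h _; rewrite /h1_dot.
have h1 : 0 <= grad_dot u u by rewrite addr_ge0 ?dot_ge0.
by have := mulr_ge0 (k0 1) h1; have := dot_ge0 mu u; lra.
Qed.

Lemma linear_inH1 (a : C) u v : inH1 u -> inH1 v -> inH1 (fun x => a * u x + v x).
Proof.
move=> /inH1P[ur ui] /inH1P[vr vi]; apply/inH1P; have [_ sH] := @H1_subspace R.
by rewrite re_linear im_linear; split; apply: (sH) => //; apply: (sH).
Qed.

Let ctrace_linear (a : C) u v : inH1 u -> inH1 v ->
  ctrace (fun x => a * u x + v x) = (fun x => a * ctrace u x + ctrace v x) %[ae m].
Proof.
move=> Hu Hv; have Huv := linear_inH1 a Hu Hv.
have [ur ui] := (inH1P u).1 Hu; have [vr vi] := (inH1P v).1 Hv.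
have [_ sH] := @H1_subspace R.
have H1' : H1 (- complex.Im a *: im u + re v) by exact: sH.
have H2' : H1 (complex.Im a *: re u + im v) by exact: sH.
have l1 := rtr_linear k0 ineq (complex.Re a) ur H1'.
have l2 := rtr_linear k0 ineq (- complex.Im a) ui vr.
have l3 := rtr_linear k0 ineq (complex.Re a) ui H2'.
have l4 := rtr_linear k0 ineq (complex.Im a) ur vi.
rewrite !ctraceE// re_linear im_linear.
apply: filterS2 (filterI l1 l2) (filterI l3 l4) => x /= [e1 e2] [e3 e4] _.
have P (c : R) (f g : plane -> R) : (c *: f + g) x = c * f x + g x by [].
rewrite e1// e3// !P// e2// e4// !P//.
move: (rtr m (re u) x) (rtr m (im u) x) (rtr m (re v) x) (rtr m (im v) x) => r1 r2 r3 r4.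
clear; case: a => a b; apply/eqP; rewrite eq_complex/=.
by apply/andP; split; apply/eqP; ring.
Qed.

(** One witness is enough to know that the choice made in [trace] has the defining properties. *)
Let ctrace_is_trace : is_trace Gamma ctrace.
Proof.
split.
- move=> u Hu; have [ur ui] := (inH1P u).1 Hu; apply/inL2P; rewrite ctraceE//.
  by split; [exact: (rP ur).1|exact: (rP ui).1].
- exact: ctrace_linear.
- exists (Num.sqrt (1 + k 1)) => u Hu; have [ur ui] := (inH1P u).1 Hu.
  have L : inL2 m (ctrace u).
    apply/inL2P; rewrite ctraceE//.
    by split; [exact: (rP ur).1|exact: (rP ui).1].
  have c0 : 0 <= 1 + k 1 by rewrite addr_ge0.
  rewrite -(@ler_pXn2r _ 2)// ?nnegrE ?L2norm_ge0//; last first.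
    by rewrite mulr_ge0 ?sqrtr_ge0.
  rewrite exprMn sqr_sqrtr// L2norm_sqr// H1norm_sqr// mulrDr ctraceE//.
  by apply: lerD; apply: h1_bound => //; exact: rP.
- move=> psi [[s1 b1] [s2 b2]]; rewrite /ctrace; case: asboolP => [Hpsi|_]; last exact: nearW.
  have [ur ui] := (inH1P psi).1 Hpsi.
  have [M1 M1P] := b1 [::] 0%N; have [M2 M2P] := b2 [::] 0%N.
  have B1 x : `|re psi x| <= M1 by have := M1P x; rewrite expr0 mul1r.
  have B2 x : `|im psi x| <= M2 by have := M2P x; rewrite expr0 mul1r.
  have t1 := rtrace_continuous k0 ineq ur (smooth_continuous s1) B1.
  have t2 := rtrace_continuous k0 ineq ui (smooth_continuous s2) B2.
  have u1 := rtrace_unique k0 ineq ur (rP ur) t1.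
  have u2 := rtrace_unique k0 ineq ui (rP ui) t2.
  apply: filterS2 u1 u2 => x /= e1 e2 _; rewrite e1// e2//.
  by rewrite /re /im; case: (psi x).
Qed.

Let trace_is_trace : is_trace Gamma (trace Gamma).
Proof. exact: (xgetPex _ (ex_intro _ _ ctrace_is_trace)). Qed.

Lemma trace_inL2 u : inH1 u -> inL2 m (trace Gamma u).
Proof. by case: trace_is_trace => h _ _ _ Hu; exact: h. Qed.

(** Any operator satisfying [is_trace] fixes test functions, these being Schwartz. Linearity and
    boundedness applied to [u - phi] show that its values are limits in the sense of [is_rtrace],
    and these are unique. *)
Lemma trace_rtr u : inH1 u -> re (trace Gamma u) = rtr m (re u) %[ae m] /\
  im (trace Gamma u) = rtr m (im u) %[ae m].
Proof.
move=> Hu; have [trL2 trlin [M trM] trS] := trace_is_trace.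
have [ur ui] := (inH1P u).1 Hu; have [L1 L2'] := (inL2P _ _).1 (trL2 u Hu).
have approx e : 0 < e -> exists p q : plane -> R, [/\ test_function p, test_function q,
    h1_dot (re u - p) (re u - p) <= e /\ h1_dot (im u - q) (im u - q) <= e,
    dot m (re (trace Gamma u) - p) (re (trace Gamma u) - p) <= e &
    dot m (im (trace Gamma u) - q) (im (trace Gamma u) - q) <= e].
  (* Real and imaginary parts each contribute [e / K] to the squared H^1 norm, so the squared trace
     norm is at most [2 M^2 e / K <= e]; and [K >= 1] gives [e / K <= e]. *)
  move=> e0; pose K := 2 * M ^+ 2 + 1.
  have K0 : 0 < K by have := sqr_ge0 M; rewrite /K; lra.
  have K1 : 1 <= K by have := sqr_ge0 M; rewrite /K; lra.
  have d0 : 0 < e / K by rewrite divr_gt0.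
  have de : e / K <= e by rewrite ler_pdivrMr// ler_peMr// ltW.
  have [p tp hp] := test_dense ur d0; have [q tq hq] := test_dense ui d0.
  pose phi : plane -> C := fun x => Complex (p x) (q x).
  have Hphi : inH1 phi by apply/inH1P; split; exact: test_H1.
  have Sphi : schwartz phi by split; exact: test_schwartz.
  pose w := fun x => (-1) * phi x + u x.
  have Hw : inH1 w by exact: linear_inH1.
  have rw : re w = re u - p.
    by apply/funext => x; rewrite /re /w !fctE /re; case: (u x) => a b /=; ring.
  have iw : im w = im u - q.
    by apply/funext => x; rewrite /im /w !fctE /im; case: (u x) => a b /=; ring.
  have Lw := trL2 w Hw; have [Lw1 Lw2] := (inL2P _ _).1 Lw.
  have nw : L2norm m (trace Gamma w) ^+ 2 <= e.
    have h : L2norm m (trace Gamma w) ^+ 2 <= (M * H1norm w) ^+ 2.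
      rewrite lerXn2r ?nnegrE ?L2norm_ge0//; last exact: trM.
      exact: le_trans (L2norm_ge0 _ _) (trM w Hw).
    apply: le_trans h _; rewrite exprMn H1norm_sqr// rw iw.
    have : M ^+ 2 * (h1_dot (re u - p) (re u - p) + h1_dot (im u - q) (im u - q)) <=
        M ^+ 2 * (e / K + e / K) by apply: ler_wpM2l; [exact: sqr_ge0|exact: lerD].
    move=> /le_trans; apply.
    have : e = K * (e / K) by rewrite mulrC divfK ?gt_eqF.
    rewrite {1}/K; move: (e / K) d0 => d d0 ->; have := mulr_ge0 (sqr_ge0 M) (ltW d0); lra.
  have wE : trace Gamma w = (fun x => -1 * phi x + trace Gamma u x) %[ae m].
    apply: filterS2 (trlin (-1) phi u Hphi Hu) (trS phi Sphi) => x /= e1 e2 _.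
    by rewrite e1// e2.
  have Lp : L2 m p by have [B _ PB] := test_bounded tp;
    exact: (ineq ltr01 (test_H1 tp) (smooth_continuous (test_smooth tp)) PB).1.
  have Lq : L2 m q by have [B _ PB] := test_bounded tq;
    exact: (ineq ltr01 (test_H1 tq) (smooth_continuous (test_smooth tq)) PB).1.
  have sL := @L2_subspace _ (pl R) R m.
  have r1 : re (trace Gamma w) = re (trace Gamma u) - p %[ae m].
    apply: filterS wE => x /= e1 _; rewrite /re e1// !fctE /re.
    by case: (trace Gamma u x) => a b /=; ring.
  have r2 : im (trace Gamma w) = im (trace Gamma u) - q %[ae m].
    apply: filterS wE => x /= e1 _; rewrite /im e1// !fctE /im.
    by case: (trace Gamma u x) => a b /=; ring.
  have Ls1 := subspaceB sL L1 Lp; have Ls2 := subspaceB sL L2' Lq.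
  rewrite L2norm_sqr// in nw.
  have d1 := dot_ae Lw1 Lw1 Ls1 Ls1 r1 r1; have d2 := dot_ae Lw2 Lw2 Ls2 Ls2 r2 r2.
  have p1 := dot_ge0 m (re (trace Gamma w)); have p2 := dot_ge0 m (im (trace Gamma w)).
  exists p, q; split=> //.
  - by split; [exact: le_trans hp de|exact: le_trans hq de].
  - by rewrite -d1; apply: le_trans nw; rewrite lerDl.
  - by rewrite -d2; apply: le_trans nw; rewrite lerDr.
split; apply: (rtrace_unique k0 ineq).
- exact: ur.
- split; first exact: L1.
  by move=> e e0; have [p [q [tp tq [h1 h2] h3 h4]]] := approx e e0; exists p.
- exact: rP.
- exact: ui.
- split; first exact: L2'.
  by move=> e e0; have [p [q [tp tq [h1 h2] h3 h4]]] := approx e e0; exists q.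
- exact: rP.
Qed.

(* The real form is the restriction of the sesquilinear one to real functions. *)
Definition real_form (alpha : R) (u v : plane -> R) : R :=
  grad_dot u v - alpha * dot m (rtr m u) (rtr m v).

Lemma delta_formE (alpha : R) u v : inH1 u -> inH1 v ->
  delta_form alpha Gamma u v =
  Complex (real_form alpha (re u) (re v) + real_form alpha (im u) (im v))
          (real_form alpha (im u) (re v) - real_form alpha (re u) (im v)).
Proof.
move=> Hu Hv; have [ur ui] := (inH1P u).1 Hu; have [vr vi] := (inH1P v).1 Hv.
have Lu := trace_inL2 Hu; have Lv := trace_inL2 Hv.
have [Lu1 Lu2] := (inL2P _ _).1 Lu; have [Lv1 Lv2] := (inL2P _ _).1 Lv.
have [u1 u2] := trace_rtr Hu; have [v1 v2] := trace_rtr Hv.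
have d1 := (rP ur).1; have d2 := (rP ui).1; have d3 := (rP vr).1; have d4 := (rP vi).1.
rewrite /delta_form (sum_bool (fun j => L2dot mu (weak_partial j u) (weak_partial j v))).
have := weak_partial_dot false Hu Hv; have := weak_partial_dot true Hu Hv.
generalize (L2dot mu (weak_partial true u) (weak_partial true v))
  (L2dot mu (weak_partial false u) (weak_partial false v)) => a b -> ->.
rewrite (L2dotE Lu Lv).
rewrite (dot_ae Lu1 Lv1 d1 d3 u1 v1) (dot_ae Lu2 Lv2 d2 d4 u2 v2)
  (dot_ae Lu2 Lv1 d2 d3 u2 v1) (dot_ae Lu1 Lv2 d1 d4 u1 v2) /real_form /grad_dot.
do 12 move: (dot _ _ _) => ?; clear.
by apply/eqP; rewrite eq_complex/=; apply/andP; split; apply/eqP; ring.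
Qed.

End trace.
End complex_valued.

(** * The resolvent set *)

Section spectral_bound.
Context {R : realType}.
Local Notation plane := (R * R)%type.
Local Notation mu := (@lebesgue2 R).
Variables (Gamma : set plane) (alpha l d : R) (k : R -> R).
Local Notation m := (arc_measure Gamma).
Hypotheses (alpha0 : 0 < alpha) (d0 : 0 < d) (lE : l = - d - k alpha).
Hypothesis k0 : forall a, 0 <= k a.
Hypothesis kM : forall s a, k (s * a) = s ^+ 2 * k a.
Hypothesis ineq : forall (a B : R) (u : plane -> R), 0 < a -> H1 u -> continuous u ->
  (forall x, `|u x| <= B) ->
  L2 m u /\ a * dot m u u <= grad_dot u u + k a * dot mu u u.
Implicit Types (u v w g : plane -> R).

Let rP u (Hu : H1 u) : is_rtrace m u (rtr m u) := rtrP k0 ineq Hu.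

Let rL u (Hu : H1 u) : L2 m (rtr m u) := (rP Hu).1.

Let l0 : 0 <= - l. Proof. by have := k0 alpha; have := d0; rewrite lE; lra. Qed.

(** Here [k a] stands for [(a / (2 c))^2], and [d] is the distance of [l] below [- k alpha]. *)
Definition shifted_form u v : R := real_form Gamma alpha u v - l * dot mu u v.

Let g0 u : 0 <= grad_dot u u. Proof. by rewrite addr_ge0 ?dot_ge0. Qed.

Lemma shifted_form_ge u : H1 u -> d * dot mu u u <= shifted_form u u.
Proof.
move=> Hu; have := rtrace_ineq k0 ineq alpha0 Hu (rP Hu).
rewrite /shifted_form /real_form lE; move: (dot mu u u) (grad_dot u u) (k alpha) => a b q.
by move: (dot m _ _) => e; lra.
Qed.

Lemma shifted_form_semi_dot : semi_dot H1 shifted_form.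
Proof.
have [glin gC gp] := @grad_semi_dot R.
have [mlin mC mp] := @dot_plane_semi_dot R.
have sL := @L2_subspace _ (pl R) R m.
have [llin lC lp] := @semi_dot_L2 _ (pl R) R m.
split.
- move=> a u v w Hu Hv Hw.
  have Huv : H1 (a *: u + v) by exact: (@H1_subspace R).2.
  have E := rtr_linear k0 ineq a Hu Hv.
  have Ew : rtr m w = rtr m w %[ae m] by exact: nearW.
  have Ls : L2 m (a *: rtr m u + rtr m v) by exact: sL.2 _ _ _ (rL Hu) (rL Hv).
  rewrite /shifted_form /real_form (glin a u v w Hu Hv Hw).
  rewrite (mlin a u v w (L2_H1 Hu) (L2_H1 Hv) (L2_H1 Hw)).
  rewrite (dot_ae (rL Huv) (rL Hw) Ls (rL Hw) E Ew) (llin a _ _ _ (rL Hu) (rL Hv) (rL Hw)).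
  by do 4 move: (dot _ _ _) => ?; do 2 move: (grad_dot _ _) => ?; ring.
- move=> u v Hu Hv; rewrite /shifted_form /real_form (gC u v Hu Hv).
  by rewrite (dotC mu u) (dotC m (rtr m u)).
- move=> u Hu; apply: le_trans (shifted_form_ge Hu).
  by apply: mulr_ge0; [exact: ltW|exact: dot_ge0].
Qed.

(* Using the trace inequality with a slightly larger constant than [alpha]. *)
Lemma shifted_form_coercive : exists2 e : R, 0 < e &
  forall u, H1 u -> e * h1_dot u u <= shifted_form u u.
Proof.
pose q := k alpha; have q0 : 0 <= q by exact: k0.
(* The inequality at [(1 + s) alpha] keeps the fraction [s / (1 + s)] of the gradient term at the
   cost of [s q] in the mass term; [s <= 1] and [q s <= d / 2] leave at least [s / 2] and
   [d / 2]. *)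
have [s s0 [s1 s2]] : exists2 s : R, 0 < s & s <= 1 /\ q * s <= d / 2.
  exists (Num.min 1 (d / 2 / (q + 1))).
    rewrite lt_min ltr01/=; apply: divr_gt0; last by rewrite ltr_wpDl.
    exact: divr_gt0.
  split; first by rewrite ge_min lexx.
  apply: (@le_trans _ _ (q * (d / 2 / (q + 1)))).
    by apply: ler_wpM2l => //; rewrite ge_min lexx orbT.
  rewrite mulrA ler_pdivrMr ?ltr_wpDl// [leRHS]mulrC.
  by apply: ler_wpM2r; [apply/ltW/divr_gt0|lra].
pose b := (1 + s) * alpha; have b0 : 0 < b by rewrite mulr_gt0//; lra.
have kb : k b = (1 + s) ^+ 2 * q by exact: kM.
exists (Num.min (s / 2) (d / 2)).
  by rewrite lt_min; apply/andP; split; exact: divr_gt0.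
move=> u Hu; have h := rtrace_ineq k0 ineq b0 Hu (rP Hu).
have hm : Num.min (s / 2) (d / 2) * h1_dot u u <=
    s / 2 * grad_dot u u + d / 2 * dot mu u u.
  rewrite /h1_dot mulrDr addrC; apply: lerD; apply: ler_wpM2r => //.
  - by rewrite ge_min lexx.
  - exact: dot_ge0.
  - by rewrite ge_min lexx orbT.
apply: le_trans hm _; move: h; rewrite kb /shifted_form /real_form.
have := g0 u; have := dot_ge0 mu u; have := dot_ge0 m (rtr m u).
rewrite lE -/q /b; move: (grad_dot u u) (dot mu u u) (dot m _ _) => G U T T0 U0 G0 h.
have s3 : 0 < 1 + s by lra.
rewrite -(ler_pM2l s3).
have e1 := mulr_ge0 (ltW s0) G0.
have e2 : s * (s * G) <= s * G by rewrite ler_piMl.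
have e3 := ler_wpM2r U0 s2.
have e4 := mulr_ge0 (ltW s0) (mulr_ge0 q0 U0).
have e5 : s * (q * s * U) <= s * (d / 2 * U) by apply: ler_wpM2l => //; exact: ltW.
have e6 := mulr_ge0 (ltW s0) (mulr_ge0 (ltW d0) U0).
by move: h e1 e2 e3 e4 e5 e6; lra.
Qed.

Lemma shifted_form_le u : H1 u -> shifted_form u u <= (1 - l) * h1_dot u u.
Proof.
move=> Hu; rewrite /shifted_form /real_form /h1_dot.
have := mulr_ge0 l0 (g0 u); have := mulr_ge0 (ltW alpha0) (dot_ge0 m (rtr m u)).
by have := dot_ge0 mu u; lra.
Qed.

Lemma shifted_form_complete : dot_complete H1 shifted_form.
Proof.
have [e e0 coer] := shifted_form_coercive; have sH := @H1_subspace R.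
have l1 : 0 < 1 - l by have := l0; lra.
move=> u Hu cau; have [|v Hv vP] := h1_complete Hu.
  move=> r r0; have [N NP] := cau _ (mulr_gt0 e0 r0); exists N => n p Nn Np.
  have := le_trans (coer _ (subspaceB sH (Hu n) (Hu p))) (NP n p Nn Np).
  by rewrite ler_pM2l.
exists v => // r r0; have [N NP] := vP _ (divr_gt0 r0 l1); exists N => n Nn.
apply: le_trans (shifted_form_le (subspaceB sH (Hu n) Hv)) _.
by have := NP n Nn; rewrite ler_pdivlMr// mulrC.
Qed.

Lemma shifted_form_solve g : L2 mu g -> exists2 p, H1 p &
  forall v, H1 v -> shifted_form p v = dot mu g v.
Proof.
move=> Lg; have sH := @H1_subspace R; have [mlin mC mp] := @dot_plane_semi_dot R.
have idH u : H1 u -> H1 u by [].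
have lin (a : R) u v : H1 u -> H1 v ->
    dot mu g (a *: u + v) = a * dot mu g u + dot mu g v.
  move=> Hu Hv; rewrite !(dotC mu g); exact: mlin (L2_H1 Hu) (L2_H1 Hv) Lg.
have bd v : H1 v -> dot mu g v ^+ 2 <= dot mu g g / d * shifted_form v v.
  move=> Hv; apply: le_trans
    (dot_cauchy_schwarz (@L2_plane_subspace R) (@dot_plane_semi_dot R) Lg (L2_H1 Hv)) _.
  rewrite [leRHS]mulrAC ler_pdivlMr// -[leLHS]mulrA; apply: ler_wpM2l; first exact: dot_ge0.
  by rewrite mulrC; exact: shifted_form_ge.
have [p [Hp pE _]] := riesz_approx sH sH idH shifted_form_semi_dot
  shifted_form_complete lin bd.
by exists p.
Qed.

(** Since [l] is real, the equation decouples into two real problems, solved by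
    [shifted_form_solve]. The bound [1 / d] on the inverse comes from testing the equation with [u]
    itself. *)
Lemma resolvent_below : resolvent_set (hamiltonian alpha Gamma) l%:C%C.
Proof.
have sH := @H1_subspace R; have sL := @L2_plane_subspace R.
have [mlin mC mp] := @dot_plane_semi_dot R.
have reZ (u f : plane -> R[i]) : re (fun x => f x - l%:C%C * u x) = re f - l *: re u.
  by apply/funext => x; rewrite /re !fctE /GRing.scale/=; case: (f x) (u x) => a b [a' b'] /=; ring.
have imZ (u f : plane -> R[i]) : im (fun x => f x - l%:C%C * u x) = im f - l *: im u.
  by apply/funext => x; rewrite /im !fctE /GRing.scale/=; case: (f x) (u x) => a b [a' b'] /=; ring.
have dotB f u v : L2 mu f -> L2 mu u -> L2 mu v ->
    dot mu (f - l *: u) v = dot mu f v - l * dot mu u v.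
  move=> Lf Lu Lv; rewrite addrC -scaleNr mlin// mulNr; exact: addrC.
split.
- move=> g Lg; have [Lg1 Lg2] := (inL2P _ _).1 Lg.
  have [p Hp pE] := shifted_form_solve Lg1; have [q Hq qE] := shifted_form_solve Lg2.
  pose u : plane -> R[i] := fun x => Complex (p x) (q x).
  (* The image of [u] is prescribed, so the resolvent equation holds everywhere; what is left is the
     identity of forms. *)
  pose f : plane -> R[i] := fun x => l%:C%C * u x + g x.
  have Hu : inH1 u by apply/inH1P.
  have ref : re f = l *: p + re g.
    by apply/funext => x; rewrite /f /u /re !fctE /GRing.scale/=; case: (g x) => a b /=; ring.
  have imf : im f = l *: q + im g.
    by apply/funext => x; rewrite /f /u /im !fctE /GRing.scale/=; case: (g x) => a b /=; ring.
  have Lf : inL2 mu f.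
    apply/inL2P; rewrite ref imf; split; apply: sL.2 => //; exact: L2_H1.
  exists u, f; split; last by apply: nearW => x _; rewrite /f addrC addKr.
  split=> // v Hv; have [vr vi] := (inH1P v).1 Hv.
  rewrite (delta_formE k0 ineq alpha Hu Hv) (L2dotE Lf Hv.1) ref imf.
  have D w z v' : L2 mu w -> L2 mu z -> L2 mu v' ->
    dot mu (l *: w + z) v' = l * dot mu w v' + dot mu z v' by exact: mlin.
  have [Lp Lq Lvr Lvi] := And4 (L2_H1 Hp) (L2_H1 Hq) (L2_H1 vr) (L2_H1 vi).
  rewrite !D//; have [e1 e2 e3 e4] := And4 (pE _ vr) (qE _ vi) (qE _ vr) (pE _ vi).
  rewrite -e1 -e2 -e3 -e4 /shifted_form; have -> : re u = p by [].
  have -> : im u = q by [].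
  do 4 move: (real_form _ _ _ _) => ?; do 4 move: (dot _ _ _) => ?.
  by apply/eqP; rewrite eq_complex/=; apply/andP; split; apply/eqP; ring.
exists d^-1 => u f [Hu Lf form]; have [ur ui] := (inH1P u).1 Hu.
have [f1 f2] := (inL2P _ _).1 Lf; have [Lur Lui] := conj (L2_H1 ur) (L2_H1 ui).
pose h := fun x => f x - l%:C%C * u x.
have h1 : L2 mu (re h) by rewrite reZ; apply: subspaceB => //; exact: subspaceZ.
have h2 : L2 mu (im h) by rewrite imZ; apply: subspaceB => //; exact: subspaceZ.
have Lh : inL2 mu h by apply/inL2P.
have E : shifted_form (re u) (re u) + shifted_form (im u) (im u) =
    dot mu (re h) (re u) + dot mu (im h) (im u).
  have := form u Hu; rewrite (delta_formE k0 ineq alpha Hu Hu) (L2dotE Lf Hu.1) => -[e _].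
  rewrite reZ imZ !dotB// /shifted_form; move: e.
  do 2 move: (real_form _ _ _ _) => ?; do 4 move: (dot _ _ _) => ?; lra.
have c1 := shifted_form_ge ur; have c2 := shifted_form_ge ui.
(* The weight [d] lets half of the coercive term [d |u|^2] absorb the contribution of [u]. *)
have young (a b : plane -> R) : L2 mu a -> L2 mu b ->
    dot mu a b <= (dot mu a a / d + d * dot mu b b) / 2.
  move=> La Lb; have := dot_ge0 mu (a + (- d) *: b).
  rewrite (dotDZ sL (@dot_plane_semi_dot R) _ La Lb).
  move: (dot mu a a) (dot mu a b) (dot mu b b) => A B' C' hh.
  rewrite -subr_ge0; have E' : (A / d + d * C') / 2 - B' =
      (A + - d *+ 2 * B' + (- d) ^+ 2 * C') / (2 * d).
    have dn0 : d != 0 by rewrite gt_eqF.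
    by field.
  by rewrite E'; apply: divr_ge0 => //; apply: mulr_ge0 => //; exact: ltW.
have y1 := young _ _ h1 Lur; have y2 := young _ _ h2 Lui.
rewrite -(@ler_pXn2r _ 2)// ?nnegrE ?L2norm_ge0//; last first.
  by apply: mulr_ge0; [rewrite invr_ge0 ltW|exact: L2norm_ge0].
rewrite exprMn (L2norm_sqr Hu.1) (L2norm_sqr Lh) exprVn mulrC ler_pdivlMr ?exprn_gt0//.
rewrite -(ler_pM2r (x := d^-1)) ?invr_gt0//.
move: E c1 c2 y1 y2; move: (shifted_form _ _) (shifted_form _ _) => S1 S2.
move: (dot mu (re h) (re u)) (dot mu (im h) (im u)) => D1 D2.
move: (dot mu (re u) (re u)) (dot mu (im u) (im u)) => U1 U2.
move: (dot mu (re h) (re h)) (dot mu (im h) (im h)) => A1 A2 EE c1 c2 y1 y2.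
rewrite expr2 mulrA mulfK ?gt_eqF//.
by lra.
Qed.

End spectral_bound.

Theorem theorem1p1 (R : realType) (alpha L : R) (gamma : R -> R * R) :
  0 < alpha -> is_loop L gamma -> 0 < c_Gamma L gamma ->
  ((- (alpha ^+ 2 / (4 * c_Gamma L gamma ^+ 2)))%:E <=
     inf_spectrum (hamiltonian alpha (loop_image L gamma)))%E.
Proof.
move=> alpha0 loop c0; apply: le_ereal_inf_tmp => _ [l spec <-]; rewrite lee_fin leNgt.
apply/negP => l_lt; apply: spec; pose k (a : R) := (a / (2 * c_Gamma L gamma)) ^+ 2.
(* The gap [d = - l - k alpha] is positive exactly because [l] lies strictly below the asserted
   bound. *)
apply: (@resolvent_below _ _ _ _ (- l - k alpha) k) => //.
- have kE : k alpha = alpha ^+ 2 / (4 * c_Gamma L gamma ^+ 2).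
    by rewrite /k; field; rewrite gt_eqF.
  by rewrite kE; move: l_lt; move: (_ / _) => q; lra.
- by move: (k alpha) => q; ring.
- by move=> a; exact: sqr_ge0.
- by move=> s a; rewrite /k -mulrA exprMn.
- by move=> a B u a0 Hu cu uB; exact: (loop_trace_inequality loop a0 c0 Hu cu uB).
Qed.
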